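(* Let $0<\alpha<1$, $T>0$, $a\in\mathbb R$, and let $\tau_3,\tau_4\in C[0,T]$ (bounded). Define $$w_3(x,t)=\int_0^t\frac{\partial^2}{\partial x^2}G_\alpha^{2\alpha/3}(x-a,t-\eta)\,\tau_3(\eta)\,d\eta\quad(x\neq a),\qquad w_4(x,t)=\int_0^t\frac{\partial^2}{\partial x^2}V_\alpha^{2\alpha/3}(x-a,t-\eta)\,\tau_4(\eta)\,d\eta\quad(x>a).$$ Then, for every fixed $t\in(0,T]$, $$\lim_{x\to a-0}w_3(x,t)=\frac13\,\tau_3(t),\qquad \lim_{x\to a+0}w_3(x,t)=-\frac23\,\tau_3(t),\qquad \lim_{x\to a+0}w_4(x,t)=0.$$
   Context: The Wright function is $\phi(\rho,\mu;z)=\sum_{n=0}^\infty\frac{z^n}{n!\,\Gamma(\rho n+\mu)}$, $-1<\rho<0$, $\mu\in\mathbb C$ (with $1/\Gamma=0$ at the poles of $\Gamma$). For $t>0$, $$G_\alpha^{2\alpha/3}(x,t)=\frac{1}{3t^{1-2\alpha/3}}\begin{cases}\phi\left(-\frac\alpha3,\frac{2\alpha}3;\frac{x}{t^{\alpha/3}}\right),&x<0,\\-2\operatorname{Re}\left[e^{2\pi i/3}\phi\left(-\frac\alpha3,\frac{2\alpha}3;e^{2\pi i/3}\frac{x}{t^{\alpha/3}}\right)\right],&x>0,\end{cases}$$ $$V_\alpha^{2\alpha/3}(x,t)=\frac{1}{3t^{1-2\alpha/3}}\operatorname{Im}\left[e^{2\pi i/3}\phi\left(-\frac\alpha3,\frac{2\alpha}3;e^{2\pi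 i/3}\frac{x}{t^{\alpha/3}}\right)\right],\quad x>0.$$ *)

(* Defs.v *)
(* MathComp world: MathComp-Analysis over an abstract realType R, with the
   complex numbers R[i] of mathcomp-real-closed. *)
From HB Require Import structures.
From mathcomp Require Import all_boot all_order all_algebra.
From mathcomp Require Import complex.
From mathcomp Require Import all_classical all_reals all_analysis.

Set Implicit Arguments.
Unset Strict Implicit.
Unset Printing Implicit Defensive.

Import Order.TTheory GRing.Theory Num.Theory.
Import numFieldNormedType.Exports.

Local Open Scope classical_set_scope.
Local Open Scope ring_scope.
Local Open Scope complex_scope.

Definition cexp (R : realType) (z : R[i]) : R[i] :=
  (expR (complex.Re z) * cos (complex.Im z)) +i*
  (expR (complex.Re z) * sin (complex.Im z)).

(* Integrand s^(z-1) e^(-s) of Euler's integral, for s > 0. *)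
Definition Gamma_integrand (R : realType) (z : R[i]) (s : R) : R[i] :=
  cexp ((z - 1) * (ln s)%:C - s%:C).

(* Equal to Gamma z only for Re z > 0, where Euler's integral converges. *)
Definition Gamma_integral (R : realType) (z : R[i]) : R[i] :=
  (\int[lebesgue_measure]_(s in `]0, +oo[) complex.Re (Gamma_integrand z s)) +i*
  (\int[lebesgue_measure]_(s in `]0, +oo[) complex.Im (Gamma_integrand z s)).

(* The entire function 1/Gamma.  The recurrence Gamma (z + 1) = z Gamma z gives
   1/Gamma z = z (z + 1) ... (z + n - 1) / Gamma (z + n); the n chosen below
   satisfies Re z + n > 0.  At the poles 0, -1, -2, ... of Gamma one factor of
   the product vanishes, so the value is 0. *)
Definition rGamma (R : realType) (z : R[i]) : R[i] :=
  let n := (Num.truncn (- complex.Re z)).+1 in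
  (\prod_(k < n) (z + k%:R)) / Gamma_integral (z + n%:R).

Definition wright_term (R : realType) (rho : R) (mu z : R[i]) (n : nat) : R[i] :=
  z ^+ n / n`!%:R * rGamma ((rho * n%:R)%:C + mu).

(* The sum of the complex series is taken on real and imaginary parts. *)
Definition wright (R : realType) (rho : R) (mu z : R[i]) : R[i] :=
  limn (series (fun n => complex.Re (wright_term rho mu z n))) +i*
  limn (series (fun n => complex.Im (wright_term rho mu z n))).

Definition omega3 (R : realType) : R[i] := cexp ((2 * pi / 3) *i).

(* For x < 0 the Wright function has real arguments, hence a real value: taking
   its real part only changes the type.  The value at x = 0, where G is not
   defined, is irrelevant. *)
Definition G (R : realType) (alpha x t : R) : R :=
  1 / (3 * t `^ (1 - 2 * alpha / 3)) *
  (if x < 0 then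
     complex.Re (wright (- (alpha / 3)) (2 * alpha / 3)%:C
                        (x / t `^ (alpha / 3))%:C)
   else
     - 2 * complex.Re (omega3 R *
             wright (- (alpha / 3)) (2 * alpha / 3)%:C
                    (omega3 R * (x / t `^ (alpha / 3))%:C))).

(* Only meaningful for x > 0. *)
Definition V (R : realType) (alpha x t : R) : R :=
  1 / (3 * t `^ (1 - 2 * alpha / 3)) *
  complex.Im (omega3 R *
    wright (- (alpha / 3)) (2 * alpha / 3)%:C
           (omega3 R * (x / t `^ (alpha / 3))%:C)).

(* Only meaningful for x <> a.  The endpoint eta = t, where the kernel is not
   defined, is left out. *)
Definition w3 (R : realType) (alpha a : R) (tau : R -> R) (x t : R) : R :=
  \int[lebesgue_measure]_(eta in `[0, t[)
    (derive1n 2 (fun y => G alpha (y - a) (t - eta)) x * tau eta).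

(* Only meaningful for x > a. *)
Definition w4 (R : realType) (alpha a : R) (tau : R -> R) (x t : R) : R :=
  \int[lebesgue_measure]_(eta in `[0, t[)
    (derive1n 2 (fun y => V alpha (y - a) (t - eta)) x * tau eta).

(* Main.v *)
(* Put beta = alpha / 3.  Two derivatives turn the coefficient 1/Gamma(2 beta - beta n)
   into 1/Gamma(- beta n), and the kernels become kappa / s * f(|x - a| / s^beta)
   with f(v) = sum_n cos(dl + n psi) v^n / (n! Gamma(- beta n)), where psi is pi on
   the left and 2 pi / 3 on the right.  If beta v g'(v) = - f(v), then
   f(h / (t - eta)^beta) / (t - eta) is the eta-derivative of
   - g(h / (t - eta)^beta); its integral tends to g(0) = cos dl as soon as g
   vanishes at infinity, and a bound |f(v)| <= C v / (1 + v^2) makes it an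
   approximate identity at eta = t.  Hence the limit kappa * cos dl * tau(t), with
   dl = 0 for G and dl = - pi / 2 for V.

   For the decay of f and g: by the reflection formula the coefficients are
   - Gamma(1 + beta n) sin(pi beta n) / pi.  Euler's integral for them is taken on a
   rotated ray, and summing the series under the integral sign produces
   exp(v s^beta cos chi) with cos chi < 0; the integrals that survive as v tends to
   infinity are evaluated by rotating the ray back. *)

(* On the positive axis Euler's integral would produce exponentials exp(v s^beta e^(i chi)) in
   directions up to pi beta + pi / 3 away from the negative real axis; for beta > 1 / 6 this exceeds
   pi / 2 and they grow. Turning the ray by an angle th replaces pi beta by beta (pi - th), and th
   close to pi / 2 keeps the total below pi / 2 for every beta < 1 / 3. No contour integral is
   needed for the rotation: the angle derivative of the integrand is an exact derivative along the
   ray, so an integral depends on the angle only through boundary terms. For g the integrand has a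
   factor 1 / s, the boundary terms at 0 survive, and they add up to exactly 2 pi cos dl; this is
   why g vanishes at infinity. The function g is the Wright series with 1/Gamma(1 - beta n), and
   beta v g' = - f is Gamma(1 + beta n) = beta n Gamma(beta n) read on coefficients. The reflection
   formula comes from a squeeze: Wendel's inequality controls Gamma at large arguments, and Euler's
   sine product follows from the integrals of cos(2 x t) cos^n t over [0, pi / 2]. *)
Require Import Defs.
From HB Require Import structures.
From mathcomp Require Import all_boot all_order all_algebra.
From mathcomp Require Import complex ring lra.
From mathcomp Require Import all_classical all_reals all_analysis measurable_realfun.

Set Implicit Arguments.
Unset Strict Implicit.
Unset Printing Implicit Defensive.

Import Order.TTheory GRing.Theory Num.Theory.
Import numFieldNormedType.Exports.

Local Open Scope classical_set_scope.
Local Open Scope ring_scope.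

(** * Improper integrals *)

Section improper_FTC.
Context {R : realType}.
Notation mu := (@lebesgue_measure R).
Implicit Types (D : set R) (F f g : R -> R) (a b : R ^nat).

Lemma open_integrable_le D f g : open D ->
  measurable_fun D f -> (forall x, D x -> `|f x| <= g x) ->
  mu.-integrable D (EFin \o g) -> mu.-integrable D (EFin \o f).
Proof.
move=> oD mf fg ig; apply: le_integrable ig.
- exact: open_measurable.
- exact/measurable_EFinP.
- move=> x Dx; rewrite /= lee_fin (le_trans (fg _ Dx))//.
  exact: ler_norm.
Qed.

Lemma is_derive_continuous f (x df : R) : is_derive x 1 f df -> {for x, continuous f}.
Proof.
by move=> [dfx _]; apply/differentiable_continuous/derivable1_diffP.
Qed.

Lemma FTC2_Rintegral F f (u v : R) : u < v ->
  (forall x, x \in `[u, v] -> is_derive x 1 F (f x)) ->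
  {within `[u, v], continuous f} ->
  \int[mu]_(x in `[u, v]) f x = F v - F u.
Proof.
move=> uv dF cf; rewrite /Rintegral (@continuous_FTC2 _ f F)//.
- have uuv : u \in `[u, v] by rewrite in_itv/= lexx ltW.
  have vuv : v \in `[u, v] by rewrite in_itv/= lexx ltW.
  have cF x : x \in `[u, v] -> F y @[y --> x] --> F x.
    by move=> /dF; exact: is_derive_continuous.
  split.
  + by move=> x /subset_itv_oo_cc xuv; have [] := dF x xuv.
  + exact/cvg_at_right_filter/cF.
  + exact/cvg_at_left_filter/cF.
- move=> x /subset_itv_oo_cc xuv; rewrite derive1E.
  by have [_] := dF x xuv.
Qed.

(** * Integrals over an open set exhausted by segments *)

Section exhaustion.
Variables (D : set R) (F f : R -> R) (a b : R ^nat).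
Hypothesis oD : open D.
Hypothesis ab : forall n, a n < b n.
Hypothesis nda : nonincreasing_seq a.
Hypothesis ndb : nondecreasing_seq b.
Hypothesis DE : D = \bigcup_n `[a n, b n]%classic.
Hypothesis dF : forall x, D x -> is_derive x 1 F (f x).
Hypothesis cf : forall x, D x -> {for x, continuous f}.

Let abD n x : x \in `[a n, b n] -> D x.
Proof. by move=> xab; rewrite DE; exists n. Qed.

Let cfab n : {within `[a n, b n], continuous f}.
Proof.
apply: continuous_in_subspaceT => x; rewrite inE => xab.
by apply: cf; exact: (abD xab).
Qed.

Let mf : measurable_fun D f.
Proof. by apply: open_continuous_measurable_fun => // x; rewrite inE => /cf. Qed.

Let ndab : {homo (fun n => `[a n, b n]%classic) : n m / (n <= m)%N >-> (n <= m)%O}.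
Proof.
move=> n m nm; apply/subsetPset; apply: subset_itv; rewrite bnd_simp.
  exact: nda.
exact: ndb.
Qed.

Let FTCab n : (\int[mu]_(x in `[a n, b n]) (f x)%:E = (F (b n) - F (a n))%:E)%E.
Proof.
have <- : \int[mu]_(x in `[a n, b n]) f x = F (b n) - F (a n).
  by apply: FTC2_Rintegral => // x xab; apply: dF; exact: (abD xab).
rewrite /Rintegral fineK//; apply: integrable_fin_num => //.
by apply: continuous_compact_integrable; [exact: segment_compact|exact: cfab].
Qed.

Let ge0_exhaustion (M : R) : (forall x, D x -> 0 <= f x) ->
  (forall n, F (b n) - F (a n) <= M) -> (\int[mu]_(x in D) (f x)%:E <= M%:E)%E.
Proof.
move=> f0 FM.
have cv : (\int[mu]_(x in `[a i, b i]) (EFin \o f) x)%E @[i --> \oo] -->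
    (\int[mu]_(x in D) (EFin \o f) x)%E.
  rewrite [X in _ --> (\int[mu]_(x in X) _)%E]DE.
  apply: ge0_nondecreasing_set_cvg_integral => //.
  - move=> n; apply/measurable_EFinP; apply: measurable_funS mf.
      exact: open_measurable.
    by move=> x; exact: abD.
  - by move=> n x xab; rewrite lee_fin; apply: f0; apply: abD xab.
rewrite -(cvg_lim _ cv)//; apply: lime_le; first by apply/cvg_ex; eexists; exact: cv.
by apply: nearW => n; rewrite FTCab lee_fin; exact: FM.
Qed.

(** Monotone convergence along the segments: integrability costs no more than a primitive with
    bounded increments. *)
Lemma ge0_exhaustion_integrable (M : R) : (forall x, D x -> 0 <= f x) ->
  (forall n, F (b n) - F (a n) <= M) -> mu.-integrable D (EFin \o f).
Proof.
move=> f0 FM; apply/integrableP; split; first exact/measurable_EFinP.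
have -> : (\int[mu]_(x in D) `|(EFin \o f) x| = \int[mu]_(x in D) (f x)%:E)%E.
  apply: eq_integral => x; rewrite inE => Dx /=.
  by rewrite ger0_norm// f0.
by apply: (le_lt_trans (ge0_exhaustion f0 FM)); exact: ltry.
Qed.

Lemma ge0_exhaustion_le (M : R) : (forall x, D x -> 0 <= f x) ->
  (forall n, F (b n) - F (a n) <= M) -> \int[mu]_(x in D) f x <= M.
Proof.
move=> f0 FM; rewrite -lee_fin /Rintegral fineK; first exact: ge0_exhaustion.
by apply: integrable_fin_num (ge0_exhaustion_integrable f0 FM); exact: open_measurable.
Qed.

(** Dominated convergence for [f] cut off outside [[a n, b n]], with [|f|] itself as dominating
    function. *)
Lemma exhaustion_FTC2 (la lb : R) : mu.-integrable D (EFin \o f) ->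
  F (a n) @[n --> \oo] --> la -> F (b n) @[n --> \oo] --> lb ->
  \int[mu]_(x in D) f x = lb - la.
Proof.
move=> fi Fa Fb.
have mD : measurable D by exact: open_measurable.
pose f_ n := (EFin \o f) \_ `[a n, b n].
have mf_ n : measurable_fun D (f_ n).
  apply/measurable_restrict => //; rewrite setIidr; last by move=> x; exact: abD.
  apply/measurable_EFinP; apply: measurable_funS mf => //.
  by move=> x; exact: abD.
have : (\int[mu]_(x in D) f_ n x)%E @[n --> \oo] --> (\int[mu]_(x in D) (EFin \o f) x)%E.
  have [||||_ _] // := @dominated_convergence _ _ _ mu D mD f_ (EFin \o f)
    (abse \o EFin \o f) mf_.
  - exact/measurable_EFinP.
  - apply: aeW => x Dx.
    have : D x by []; rewrite {1}DE => -[m _ xm].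
    apply: cvg_near_cst; exists m => // n /= mn.
    rewrite /f_ patchE mem_set//.
    by have /subsetPset := ndab mn; exact.
  - exact: integrable_abse.
  - apply: aeW => x n Dx; rewrite /f_ patchE; case: ifPn => //= _.
    by rewrite normr0 lee_fin.
have fE n : (\int[mu]_(x in D) f_ n x = (F (b n) - F (a n))%:E)%E.
  rewrite -FTCab /f_ -integral_mkcondr setIidr//.
  by move=> x; exact: abD.
under [X in X @ _ --> _]eq_fun do rewrite fE.
move=> h.
have /fine_cvg : (F (b n) - F (a n))%:E @[n --> \oo] -->
    (\int[mu]_(x in D) f x)%:E.
  by rewrite /Rintegral fineK//; exact: integrable_fin_num.
move=> h'.
apply: (cvg_unique _ h') => //.
exact: cvgB.
Qed.

End exhaustion.

(** Starting at 2 makes even the first segment nondegenerate, as the fundamental theorem on segments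
    requires. *)
Lemma itv0yE : `]0, +oo[%classic = \bigcup_n `[(n.+2%:R : R)^-1, n.+2%:R]%classic.
Proof.
apply/seteqP; split => x /=.
  rewrite in_itv/= andbT => x0.
  pose N := maxn (Num.truncn x^-1).+1 (Num.truncn x).+1.
  exists N => //=; rewrite in_itv/=; apply/andP; split.
    rewrite -[leRHS]invrK lef_pV2 ?posrE ?invr_gt0//.
    rewrite (le_trans (ltW (truncnS_gt _)))// ler_nat.
    by rewrite (@leq_trans N)//; [exact: leq_maxl|rewrite ltnW].
  rewrite (le_trans (ltW (truncnS_gt _)))// ler_nat.
  by rewrite (@leq_trans N)//; [exact: leq_maxr|rewrite ltnW].
move=> [n _]/=; rewrite !in_itv/= andbT => /andP[nx _].
by rewrite (lt_le_trans _ nx).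
Qed.

Section itv0y.
Variables (F f : R -> R).
Hypothesis dF : forall x : R, 0 < x -> is_derive x 1 F (f x).
Hypothesis cf : forall x : R, 0 < x -> {for x, continuous f}.

Let lt_ab n : (n.+2%:R : R)^-1 < n.+2%:R.
Proof. by rewrite (@lt_trans _ _ 1)// ?invf_lt1// ltr1n. Qed.

Let nda : nonincreasing_seq (fun n => (n.+2%:R : R)^-1).
Proof. by move=> n m nm; rewrite lef_pV2 ?posrE// ler_nat. Qed.

Let ndb : nondecreasing_seq (fun n => (n.+2%:R : R)).
Proof. by move=> n m nm; rewrite ler_nat. Qed.

Lemma ge0_itv0y_integrable (M : R) : (forall x : R, 0 < x -> 0 <= f x) ->
  (forall x : R, 0 < x -> 0 <= F x <= M) -> mu.-integrable `]0, +oo[ (EFin \o f).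
Proof.
move=> f0 FM.
apply: (@ge0_exhaustion_integrable _ F f _ _ _ lt_ab nda ndb itv0yE _ _ M) => //.
- by move=> x/=; rewrite in_itv/= andbT; exact: dF.
- by move=> x/=; rewrite in_itv/= andbT; exact: cf.
- by move=> x/=; rewrite in_itv/= andbT; exact: f0.
- move=> n.
  have /andP[_ h1] := FM n.+2%:R ltac:(by []).
  have /andP[h2 _] := FM (n.+2%:R)^-1 ltac:(by []).
  lra.
Qed.

Lemma itv0y_FTC2 (la lb : R) : mu.-integrable `]0, +oo[ (EFin \o f) ->
  F x @[x --> 0^'+] --> la -> F x @[x --> +oo] --> lb ->
  \int[mu]_(x in `]0, +oo[) f x = lb - la.
Proof.
move=> fi Fa Fb.
have cb : (n.+2%:R : R) @[n --> \oo] --> +oo.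
  have := @cvgr_idn R; rewrite -(cvg_shiftn 2).
  by have -> : (fun n => (n + 2)%:R : R) = (fun n => n.+2%:R) by apply/funext => n; rewrite addn2.
apply: (@exhaustion_FTC2 _ F f _ _ _ lt_ab nda ndb itv0yE) => //.
- by move=> x/=; rewrite in_itv/= andbT; exact: dF.
- by move=> x/=; rewrite in_itv/= andbT; exact: cf.
- move/cvg_at_rightP : Fa; apply; split => //.
  apply/gtr0_cvgV0 => //; first by apply: nearW.
- by move/cvg_pinftyP : Fb; apply.
Qed.

End itv0y.

End improper_FTC.

(** * Differentiation rules *)

Section derivatives.
Context {R : realType}.
Implicit Types (f g : R -> R) (x a b c : R).

(* Unlike [is_derive], this is not a typeclass: the derivative is computed by the
   tactic [drv] below instead of being inferred. *)
Definition has_deriv f x a := is_derive x 1 f a.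

Lemma has_deriv_eq f x a b : has_deriv f x a -> a = b -> is_derive x 1 f b.
Proof. by move=> fa <-. Qed.

Lemma has_deriv_continuous f x a : has_deriv f x a -> {for x, continuous f}.
Proof. exact: is_derive_continuous. Qed.

Lemma drv_cst c x : has_deriv (fun=> c) x 0.
Proof. exact: is_derive_cst. Qed.

Lemma drv_id x : has_deriv (fun y => y) x 1.
Proof. exact: is_derive_id. Qed.

Lemma drvD f g x a b : has_deriv f x a -> has_deriv g x b ->
  has_deriv (fun y => f y + g y) x (a + b).
Proof. by move=> fa gb; exact: is_deriveD. Qed.

Lemma drvN f x a : has_deriv f x a -> has_deriv (fun y => - f y) x (- a).
Proof. by move=> fa; exact: is_deriveN. Qed.

Lemma drvM f g x a b : has_deriv f x a -> has_deriv g x b ->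
  has_deriv (fun y => f y * g y) x (a * g x + f x * b).
Proof.
move=> fa gb; apply: (is_derive_eq (is_deriveM fa gb)).
by rewrite /GRing.scale/= addrC mulrC.
Qed.

Lemma drvV f x a : f x != 0 -> has_deriv f x a ->
  has_deriv (fun y => (f y)^-1) x (- (f x ^- 2 * a)).
Proof.
move=> fx fa; apply: is_derive_eq (is_deriveV fx fa) _.
by rewrite /GRing.scale/= mulNr.
Qed.

Lemma drvX f n x a : has_deriv f x a ->
  has_deriv (fun y => f y ^+ n) x (n%:R * f x ^+ n.-1 * a).
Proof.
move=> fa; elim: n => [|n IHn]; first by rewrite !mul0r; exact: is_derive_cst.
have -> : (fun y => f y ^+ n.+1) = (fun y => f y * f y ^+ n).
  by apply/funext => y; rewrite exprS.
apply: (is_derive_eq (drvM fa IHn)) => /=.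
case: n {IHn} => [|n]; first by rewrite !expr0; ring.
by rewrite /= -[in RHS]natr1 !exprS; ring.
Qed.

Lemma drv_comp h f x a b : has_deriv h (f x) a -> has_deriv f x b ->
  has_deriv (fun y => h (f y)) x (a * b).
Proof. by move=> ha fb; exact: is_derive1_comp. Qed.

Lemma drv_exp f x a : has_deriv f x a ->
  has_deriv (fun y => expR (f y)) x (expR (f x) * a).
Proof. by move=> fa; apply: drv_comp fa; exact: is_derive_expR. Qed.

Lemma drv_sin f x a : has_deriv f x a ->
  has_deriv (fun y => sin (f y)) x (cos (f x) * a).
Proof. by move=> fa; apply: drv_comp fa; exact: is_derive_sin. Qed.

Lemma drv_cos f x a : has_deriv f x a ->
  has_deriv (fun y => cos (f y)) x (- sin (f x) * a).
Proof. by move=> fa; apply: drv_comp fa; exact: is_derive_cos. Qed.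

Lemma drv_powR f p x a : 0 < f x -> has_deriv f x a ->
  has_deriv (fun y => f y `^ p) x (p * f x `^ (p - 1) * a).
Proof.
move=> fx fa; apply: (@drv_comp (fun z => z `^ p)) => //.
exact: is_derive1_powR.
Qed.

Lemma drv_atan f x a : has_deriv f x a ->
  has_deriv (fun y => atan (f y)) x ((1 + f x ^+ 2)^-1 * a).
Proof. by move=> fa; apply: drv_comp fa; exact: is_derive1_atan. Qed.

Lemma measurable_sin : measurable_fun setT (@sin R).
Proof. apply: continuous_measurable_fun; exact: continuous_sin. Qed.

Lemma measurable_cos : measurable_fun setT (@cos R).
Proof. apply: continuous_measurable_fun; exact: continuous_cos. Qed.

Lemma MVT_derive f f' a b : a < b -> (forall x, is_derive x 1 f (f' x)) ->
  exists2 c, a < c < b & f b - f a = f' c * (b - a).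
Proof.
move=> ab df; have [|c] := @MVT R f f' a b ab (fun x _ => df x).
- by apply: derivable_within_continuous => x _; have [] := df x.
- by rewrite in_itv/=; exists c.
Qed.

End derivatives.

Ltac drv := repeat first [apply: drv_cst | apply: drv_id | apply: drvD
  | apply: drvN | apply: drvX | apply: drvM | apply: drv_exp | apply: drv_sin
  | apply: drv_cos | apply: drv_atan | apply: drv_powR | apply: drvV].

Ltac derive_eq := apply: has_deriv_eq; [drv|rewrite /=].

Ltac meas := repeat first [exact: measurable_cst | exact: measurable_id
  | apply: measurable_funD | apply: measurable_funB | apply: measurable_funM
  | apply: measurable_funX
  | apply: (measurableT_comp measurable_sin)
  | apply: (measurableT_comp measurable_cos)
  | apply: (measurableT_comp (@measurable_expR _))
  | apply: (measurableT_comp (measurable_powR _))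
  | apply: (measurableT_comp (@oppr_measurable _ _))
  | apply: (measurableT_comp (@normr_measurable _ _)) ].

(** * Integrability of powers times exponentials *)

Section integrability.
Context {R : realType}.
Notation mu := (@lebesgue_measure R).
Implicit Types (f g : R -> R) (b c q r s C K V : R).

Lemma powRE s r : 0 < s -> s `^ r = expR (r * ln s).
Proof. by move=> s0; rewrite /powR gt_eqF. Qed.

Lemma powRDp s r q : 0 < s -> s `^ (r + q) = s `^ r * s `^ q.
Proof. by move=> s0; rewrite powRD//; apply/implyP => _; rewrite gt_eqF. Qed.

Lemma powRB1 s q : 0 < s -> s `^ (q - 1) = s `^ q / s.
Proof. by move=> s0; rewrite powRDp// powR_inv1// ltW. Qed.

Lemma powR_le_expR r b c : 0 <= r -> 0 < b -> 0 < c ->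
  exists K, forall s, 0 < s -> s `^ r <= K * expR (c * s `^ b).
Proof.
rewrite le_eqVlt => /predU1P[<-|r0] b0 c0.
  exists 1 => s s0; rewrite powRr0 mul1r -expR0 ler_expR.
  by rewrite mulr_ge0 ?powR_ge0// ltW.
pose k := r / b; have k0 : 0 < k by rewrite divr_gt0.
(* The exact maximum of s^r exp(- c s^b), attained where s^b = k / c; the bound is [1 + x <= expR x]
   at [x = b * ln s + ln (c / k)]. *)
exists (expR (- k * (1 + ln (c / k)))) => s s0.
rewrite !powRE// -expRD ler_expR.
set L := ln s.
have := expR_ge1Dx (b * L + ln (c / k)).
rewrite expRD lnK ?posrE ?divr_gt0// => h.
have -> : r * L = k * (b * L) by rewrite /k; field; rewrite gt_eqF.
have h2 : k * (1 + (b * L + ln (c / k))) <= c * expR (b * L).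
  have -> : c * expR (b * L) = k * (expR (b * L) * (c / k)) by field; rewrite gt_eqF.
  by rewrite ler_pM2l.
lra.
Qed.

Lemma powR_le_linear b c V : 0 < b < 1 -> 0 < c -> 0 <= V ->
  exists K, forall s, 0 < s -> V * s `^ b <= c * s + K.
Proof.
move=> /andP[b0 b1] c0; rewrite le_eqVlt => /predU1P[<-|V0].
  by exists 0 => s s0; rewrite mul0r addr0 mulr_ge0// ltW.
(* The point where V k^b = c k: below it the constant V k^b is enough, above it the linear term
   is. *)
pose k := (V / c) `^ (1 - b)^-1.
have k0 : 0 < k by rewrite powR_gt0// divr_gt0.
exists (V * k `^ b) => s s0.
have [sk|ks] := leP s k.
  apply: ler_wpDl; first by rewrite mulr_ge0// ltW.
  by rewrite ler_pM2l// ge0_ler_powR// ?nnegrE ltW.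
apply: ler_wpDr; first by rewrite mulr_ge0 ?powR_ge0// ltW.
have kE : k `^ (1 - b) = V / c.
  by rewrite /k -powRrM mulVf ?powRr1// ?divr_ge0 ?ltW// gt_eqF// subr_gt0.
have : V / c <= s `^ (1 - b).
  by rewrite -kE ge0_ler_powR ?nnegrE ?subr_ge0// ltW.
rewrite ler_pdivrMr// => h.
have -> : c * s = (s `^ (1 - b) * c) * s `^ b.
    by rewrite mulrAC -powRDp// subrK powRr1 1?mulrC// ltW.
by rewrite ler_wpM2r ?powR_ge0.
Qed.

(** Comparison with the derivative of 1 - 1 / (1 + s^q), integrable because this primitive stays in
    [0, 1]. It is of the same order s^(q - 1) at 0, and at infinity the exponential beats (1 +
    s^q)^2. *)
Lemma integrable_powR_expRN q b c : 0 < q -> 0 < b -> 0 < c ->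
  mu.-integrable `]0, +oo[ (EFin \o (fun s => s `^ (q - 1) * expR (- (c * s `^ b)))).
Proof.
move=> q0 b0 c0.
pose f s := q * s `^ (q - 1) * (1 + s `^ q) ^- 2.
pose F s := - (1 + s `^ q)^-1 + 1.
have pos s : 0 < 1 + s `^ q by rewrite ltr_pwDl// powR_ge0.
have fi : mu.-integrable `]0, +oo[ (EFin \o f).
  apply: (@ge0_itv0y_integrable _ F f _ _ 1).
  - move=> s s0; rewrite /F /f; derive_eq => //; first by rewrite gt_eqF.
    by field; rewrite gt_eqF.
  - move=> s s0; apply: has_deriv_continuous; rewrite /f; drv => //.
    by rewrite expf_eq0 gt_eqF.
  - move=> s s0; rewrite /f mulr_ge0 ?invr_ge0 ?exprn_ge0// ?(ltW (pos _))//.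
    by rewrite mulr_ge0 ?powR_ge0// ltW.
  - move=> s s0; rewrite /F addrC subr_ge0 lerBlDr lerDl invr_ge0 (ltW (pos _)) andbT.
    by rewrite invf_le1// lerDl powR_ge0.
have [K HK] := @powR_le_expR (q * 2) b c (ltW (mulr_gt0 q0 (ltr0n _ 2))) b0 c0.
have K1 : 0 <= K.
  have := HK 1 ltr01; rewrite powR1 => h.
  by have := lt_le_trans ltr01 h; rewrite pmulr_lgt0 ?expR_gt0// => /ltW.
apply: (@open_integrable_le _ _ _ (fun s => (2 + 2 * K) / q * f s)).
- exact: interval_open.
- by meas.
- move=> s /=; rewrite in_itv/= andbT => s0.
  rewrite ger0_norm ?mulr_ge0 ?powR_ge0 ?expR_ge0//.
  have -> : (2 + 2 * K) / q * f s = s `^ (q - 1) * ((2 + 2 * K) / (1 + s `^ q) ^+ 2).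
    by rewrite /f; field; rewrite !gt_eqF.
  rewrite ler_wpM2l ?powR_ge0// expRN ler_pdivlMr ?exprn_gt0//.
  rewrite mulrC ler_pdivrMr ?expR_gt0//.
  have := HK _ s0; rewrite powRrM (powR_mulrn 2)  ?powR_ge0//.
  set z := s `^ q => h.
  have e1 : 1 <= expR (c * s `^ b) by rewrite -expR0 ler_expR mulr_ge0 ?powR_ge0// ltW.
  have z2 : (1 + z) ^+ 2 <= 2 + 2 * z ^+ 2.
    by rewrite -subr_ge0 (_ : _ - _ = (1 - z) ^+ 2) ?sqr_ge0//; ring.
  by apply: (le_trans z2); lra.
- by apply: eq_integrable (integrableZl _ ((2 + 2 * K) / q) fi).
Qed.

Lemma integrable_le_powR_expRN f C q b c : measurable_fun (`]0, +oo[%classic : set R) f ->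
  0 < q -> 0 < b -> 0 < c ->
  (forall s, 0 < s -> `|f s| <= C * (s `^ (q - 1) * expR (- (c * s `^ b)))) ->
  mu.-integrable `]0, +oo[ (EFin \o f).
Proof.
move=> mf q0 b0 c0 fC.
apply: (@open_integrable_le _ _ _
  (fun s => C * (s `^ (q - 1) * expR (- (c * s `^ b))))) => //.
- by move=> s/=; rewrite in_itv/= andbT; exact: fC.
- by apply: eq_integrable (integrableZl _ C (integrable_powR_expRN q0 b0 c0)).
Qed.

(** As [b < 1], half of the decay [c * s] absorbs [V * s ^ b] up to a constant factor. *)
Lemma integrable_le_powR_expR f C q b c V : measurable_fun (`]0, +oo[%classic : set R) f ->
  0 < q -> 0 < b < 1 -> 0 < c -> 0 <= V -> 0 <= C ->
  (forall s, 0 < s -> `|f s| <= C * (s `^ (q - 1) * expR (V * s `^ b - c * s))) ->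
  mu.-integrable `]0, +oo[ (EFin \o f).
Proof.
move=> mf q0 b01 c0 V0 C0 fC.
have c20 : 0 < c / 2 by rewrite divr_gt0.
have [K HK] := powR_le_linear b01 c20 V0.
apply: (@integrable_le_powR_expRN _ (C * expR K) q 1 (c / 2)) => // s s0.
apply: (le_trans (fC _ s0)); rewrite -(mulrA C (expR K)).
apply: ler_wpM2l => //; rewrite [leRHS]mulrCA; apply: ler_wpM2l; first exact: powR_ge0.
rewrite -expRD ler_expR powRr1 ?(ltW s0)//.
have -> : c * s = c / 2 * s + c / 2 * s by field.
have := HK _ s0; lra.
Qed.

End integrability.

(** * Limits at 0 and at infinity, integrals over the half-line *)

Section limits.
Context {R : realType}.
Notation mu := (@lebesgue_measure R).
Implicit Types (f : R -> R) (b c q r s C K V : R).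

Lemma powR_bound_cvg0 f C r : 0 < r -> (forall s, 0 < s -> `|f s| <= C * s `^ r) ->
  f s @[s --> 0^'+] --> 0.
Proof.
move=> r0 fC.
have h : C * s `^ r @[s --> 0^'+] --> 0.
  by rewrite -[X in _ --> X](mulr0 C); apply: cvgMr; exact: powR_cvg0.
apply: norm_cvg0; apply: (squeeze_cvgr _ (cvg_cst 0) h).
by near=> s; rewrite normr_ge0 fC.
Unshelve. all: by end_near. Qed.

Lemma powR_expRN_bound_cvgy f C r b c : 0 <= r -> 0 < b -> 0 < c -> 0 <= C ->
  (forall s, 0 < s -> `|f s| <= C * (s `^ r * expR (- (c * s `^ b)))) ->
  f s @[s --> +oo] --> 0.
Proof.
move=> r0 b0 c0 C0 fC.
(* One extra power of [s] is taken from the exponential and returned as the vanishing factor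
   [s^-1]. *)
have r10 : 0 <= r + 1 by rewrite addr_ge0.
have [K HK] := powR_le_expR r10 b0 c0.
have h : C * K * s^-1 @[s --> +oo] --> 0.
  rewrite -[X in _ --> X](mulr0 (C * K)); apply: cvgMr.
  apply/gtr0_cvgV0; last exact: cvg_id.
  by near=> s.
apply: norm_cvg0; apply: (squeeze_cvgr _ (cvg_cst 0) h).
near=> s; have s0 : 0 < s by [].
rewrite normr_ge0/= (le_trans (fC _ s0))// -mulrA ler_wpM2l//.
rewrite expRN ler_pdivrMr ?expR_gt0// mulrAC ler_pdivlMr//.
by have := HK _ s0; rewrite powRDp// powRr1// ltW.
Unshelve. all: by end_near. Qed.

Lemma in_itv0y s : (`]0, +oo[%classic : set R) s = (0 < s) :> Prop.
Proof. by rewrite /= in_itv/= andbT. Qed.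

Lemma eq_integrable0y f g : (forall s, 0 < s -> f s = g s) ->
  mu.-integrable `]0, +oo[ (EFin \o f) -> mu.-integrable `]0, +oo[ (EFin \o g).
Proof.
move=> fg; apply: eq_integrable => // s; rewrite inE in_itv0y => s0 /=.
by rewrite fg.
Qed.

Lemma eq_Rintegral0y f g : (forall s, 0 < s -> f s = g s) ->
  \int[mu]_(s in `]0, +oo[) f s = \int[mu]_(s in `]0, +oo[) g s.
Proof. by move=> fg; apply: eq_Rintegral => s; rewrite inE in_itv0y; exact: fg. Qed.

Lemma le_Rintegral0y f g :
  mu.-integrable `]0, +oo[ (EFin \o f) -> mu.-integrable `]0, +oo[ (EFin \o g) ->
  (forall s, 0 < s -> f s <= g s) ->
  \int[mu]_(s in `]0, +oo[) f s <= \int[mu]_(s in `]0, +oo[) g s.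
Proof. by move=> fi gi fg; apply: le_Rintegral => // s; rewrite in_itv0y; exact: fg. Qed.

Lemma normr_Rintegral0y_le f g : measurable_fun (`]0, +oo[%classic : set R) f ->
  mu.-integrable `]0, +oo[ (EFin \o g) -> (forall s, 0 < s -> `|f s| <= g s) ->
  `|\int[mu]_(s in `]0, +oo[) f s| <= \int[mu]_(s in `]0, +oo[) g s.
Proof.
move=> mf gi fg.
have fi : mu.-integrable `]0, +oo[ (EFin \o f).
  apply: (open_integrable_le _ mf _ gi); first exact: interval_open.
  by move=> s; rewrite in_itv0y; exact: fg.
apply: (le_trans (le_normr_Rintegral _ fi)) => //.
by apply: le_Rintegral0y => //; exact: integrable_norm.
Qed.

Lemma integrableD0y f g :
  mu.-integrable `]0, +oo[ (EFin \o f) -> mu.-integrable `]0, +oo[ (EFin \o g) ->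
  mu.-integrable `]0, +oo[ (EFin \o (fun s => f s + g s)).
Proof. by move=> fi gi; apply: eq_integrable (integrableD _ fi gi). Qed.

Lemma integrableZ0y f c :
  mu.-integrable `]0, +oo[ (EFin \o f) ->
  mu.-integrable `]0, +oo[ (EFin \o (fun s => c * f s)).
Proof. by move=> fi; apply: eq_integrable (integrableZl _ c fi). Qed.

Lemma integrableB0y f g :
  mu.-integrable `]0, +oo[ (EFin \o f) -> mu.-integrable `]0, +oo[ (EFin \o g) ->
  mu.-integrable `]0, +oo[ (EFin \o (fun s => f s - g s)).
Proof.
move=> fi gi; apply: integrableD0y => //.
apply: (@eq_integrable0y (fun s => -1 * g s)); first by move=> s _; rewrite mulN1r.
exact: integrableZ0y.
Qed.

End limits.

(** * The Gamma function *)

Section Gamma.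
Context {R : realType}.
Notation mu := (@lebesgue_measure R).
Implicit Types (a s x : R).

Definition Gam x := \int[mu]_(s in `]0, +oo[) (s `^ (x - 1) * expR (- s)).

Lemma integrable_Gam x : 0 < x ->
  mu.-integrable `]0, +oo[ (EFin \o (fun s => s `^ (x - 1) * expR (- s))).
Proof.
move=> x0; apply: (eq_integrable0y _ (integrable_powR_expRN x0 ltr01 ltr01)).
by move=> s s0; rewrite mul1r powRr1// ltW.
Qed.

Lemma Gam_ge0 x : 0 <= Gam x.
Proof. by apply: Rintegral_ge0 => s _; rewrite mulr_ge0 ?powR_ge0 ?expR_ge0. Qed.

(** Integration by parts: the difference of the two integrands is the derivative of - s^x exp(- s),
    which vanishes at both ends. *)
Lemma GamD1 x : 0 < x -> Gam (x + 1) = x * Gam x.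
Proof.
move=> x0; apply/eqP; rewrite -subr_eq0; apply/eqP.
have x1 : 0 < x + 1 by rewrite addr_gt0.
rewrite /Gam -RintegralZl//; last exact: integrable_Gam.
rewrite -RintegralB//; last 2 first.
  exact: integrable_Gam.
  exact/integrableZ0y/integrable_Gam.
rewrite (@itv0y_FTC2 _ (fun s => - (s `^ x * expR (- s)))
  (fun s => s `^ (x + 1 - 1) * expR (- s) - x * (s `^ (x - 1) * expR (- s))) _ _ 0 0)//.
- by rewrite subrr.
- by move=> s s0; derive_eq => //; rewrite addrK; ring.
- by move=> s s0; apply: has_deriv_continuous; drv.
- apply: integrableB0y; first exact: integrable_Gam.
  exact/integrableZ0y/integrable_Gam.
- apply: (@powR_bound_cvg0 _ _ 1 x) => // s s0.
  rewrite normrN ger0_norm ?mulr_ge0 ?powR_ge0 ?expR_ge0// mul1r.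
  by rewrite ler_piMr ?powR_ge0// -expR0 ler_expR oppr_le0 ltW.
- apply: (@powR_expRN_bound_cvgy _ _ 1 x 1 1) => //; first exact: ltW.
  move=> s s0; rewrite normrN ger0_norm ?mulr_ge0 ?powR_ge0 ?expR_ge0// !mul1r.
  by rewrite powRr1// ltW.
Qed.

Lemma Gam1 : Gam 1 = 1.
Proof.
rewrite /Gam.
rewrite (@eq_Rintegral0y _ _ (fun s : R => expR (- s))); last first.
  by move=> s s0; rewrite subrr powRr0 mul1r.
rewrite (@itv0y_FTC2 _ (fun s => - expR (- s)) (fun s => expR (- s)) _ _ (-1) 0)//.
- by rewrite opprK add0r.
- by move=> s s0; derive_eq; ring.
- by move=> s s0; apply: has_deriv_continuous; drv.
- apply: (eq_integrable0y _ (integrable_Gam ltr01)).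
  by move=> s s0; rewrite subrr powRr0 mul1r.
- apply: cvg_at_right_filter; rewrite -[X in _ --> X](_ : - expR (- 0) = -1).
    by apply: (@has_deriv_continuous _ (fun s => - expR (- s))); drv.
  by rewrite oppr0 expR0.
- apply: (@powR_expRN_bound_cvgy _ _ 1 0 1 1) => //.
  move=> s s0; rewrite normrN ger0_norm ?expR_ge0// powRr0 !mul1r.
  by rewrite powRr1// ltW.
Qed.

(** Weighted arithmetic-geometric mean of [y] and 1, from [1 + z <= expR z] at z = (1 - x) ln y and
    at z = - x ln y. *)
Lemma powR_le_tangent y x : 0 < y -> 0 <= x <= 1 -> y `^ x <= x * y + (1 - x).
Proof.
move=> y0 /andP[x0 x1]; rewrite powRE//; set L := ln y.
have h1 := expR_ge1Dx ((1 - x) * L).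
have h2 := expR_ge1Dx (- (x * L)).
set e := expR (x * L).
have e0 : 0 < e by exact: expR_gt0.
have yE : y = e * expR ((1 - x) * L).
  by rewrite /e -expRD -mulrDl addrC subrK mul1r lnK.
have oneE : 1 = e * expR (- (x * L)) by rewrite /e -expRD subrr expR0.
have k1 : e * (1 + (1 - x) * L) <= y by rewrite [leRHS]yE ler_pM2l.
have k2 : e * (1 - x * L) <= 1 by rewrite [leRHS]oneE ler_pM2l.
have k3 : x * (e * (1 + (1 - x) * L)) <= x * y by rewrite ler_wpM2l.
have k4 : (1 - x) * (e * (1 - x * L)) <= (1 - x) * 1 by rewrite ler_wpM2l// subr_ge0.
have -> : e = x * (e * (1 + (1 - x) * L)) + (1 - x) * (e * (1 - x * L)) by ring.
by rewrite (le_trans (lerD k3 k4))// mulr1.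
Qed.

(** Wendel's inequality. Integrating the tangent bound at [s / a] gives a^x times a convex
    combination of Gam a and Gam (a + 1) / a, which are equal. *)
Lemma Gam_le a x : 0 < a -> 0 <= x <= 1 -> Gam (a + x) <= Gam a * a `^ x.
Proof.
move=> a0 x01; have [x0 x1] := andP x01.
have a10 : 0 < a + 1 by rewrite addr_gt0.
have -> : Gam a * a `^ x = a `^ x * (1 - x) * Gam a + a `^ x * x / a * Gam (a + 1).
  by rewrite GamD1//; field; rewrite gt_eqF.
rewrite /Gam -!RintegralZl//; [|exact: integrable_Gam..].
rewrite -RintegralD//; [|exact/integrableZ0y/integrable_Gam..].
apply: le_Rintegral0y.
- by apply: integrable_Gam; rewrite ltr_wpDr.
- by apply: integrableD0y; exact/integrableZ0y/integrable_Gam.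
- move=> s s0.
  have sa0 : 0 < s / a by rewrite divr_gt0.
  have h := powR_le_tangent sa0 x01.
  rewrite (_ : a + x - 1 = (a - 1) + x); last by ring.
  rewrite (_ : a + 1 - 1 = (a - 1) + 1); last by ring.
  rewrite (@powRDp _ _ (a - 1) x)// (@powRDp _ _ (a - 1) 1)// powRr1 ?(ltW s0)//.
  have -> : s `^ x = a `^ x * (s / a) `^ x.
    by rewrite -powRM ?ltW// mulrC divfK// gt_eqF.
  have k : 0 <= s `^ (a - 1) * expR (- s) * a `^ x.
    by rewrite !mulr_ge0 ?powR_ge0 ?expR_ge0.
  have := ler_wpM2l k h.
  congr (_ <= _); first by ring.
  by field; rewrite gt_eqF.
Qed.

Lemma natr_Gam n : Gam n.+1%:R = n`!%:R.
Proof.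
elim: n => [|n IHn]; first exact: Gam1.
by rewrite -[in LHS]natr1 GamD1// IHn factS natrM.
Qed.

(** The functional equation applied at n + x and at n - x produces n^2 - x^2, the factor of Euler's
    sine product. *)
Lemma Gam_reflection_shift x N : 0 < x < 1 ->
  Gam (N.+1%:R + x) * Gam (N.+1%:R - x) =
  Gam x * Gam (1 - x) * x * \prod_(m < N) (m.+1%:R ^+ 2 - x ^+ 2).
Proof.
move=> /andP[x0 x1]; elim: N => [|N IHN].
  by rewrite big_ord0 mulr1 addrC GamD1//; ring.
rewrite big_ord_recr/= [RHS]mulrA -IHN.
rewrite -(natr1 N.+1); have : (1 : R) <= N.+1%:R by rewrite ler1n.
move: (N.+1%:R : R) => n n1.
have n1x : 0 < n + x by rewrite addr_gt0// (lt_le_trans _ n1).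
have n2x : 0 < n - x by rewrite subr_gt0 (lt_le_trans x1).
rewrite addrAC GamD1// (addrAC n 1) GamD1//.
by move: (Gam (n + x)) (Gam (n - x)) => A B; ring.
Qed.

(** For the upper bound Wendel's inequality starts at integers; for the lower bound it steps from N
    + 2 - x and N + 2 + x up to integers, where Gamma is a factorial. *)
Lemma Gam_reflection_bounds x N : 0 < x < 1 ->
  N.+2%:R / N.+3%:R * N.+1`!%:R ^+ 2 <= Gam (N.+2%:R + x) * Gam (N.+2%:R - x)
    <= N.+2%:R / N.+1%:R * N.+1`!%:R ^+ 2.
Proof.
move=> /andP[x0 x1].
have x01 : 0 <= x <= 1 by rewrite !ltW.
have x01' : 0 <= 1 - x <= 1 by apply/andP; split; lra.
have N1 : (1 : R) <= N.+1%:R by rewrite ler1n.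
have N2 : (N.+2%:R : R) = N.+1%:R + 1 by rewrite -natr1.
have N3 : (N.+3%:R : R) = N.+1%:R + 2 by rewrite -natr1 N2; ring.
have G0 := Gam_ge0.
apply/andP; split.
- rewrite mulrAC ler_pdivrMr//.
  (* Both bases are enlarged to [N.+3%:R], so that the exponents x and 1 - x add up to 1. *)
  have h1 : N.+1`!%:R <= Gam (N.+2%:R - x) * N.+3%:R `^ x.
    rewrite -natr_Gam -[X in Gam X <= _](subrK x).
    apply: le_trans (Gam_le _ x01) _; first lra.
    by rewrite ler_wpM2l// ge0_ler_powR// ?nnegrE; lra.
  have h2 : N.+2`!%:R <= Gam (N.+2%:R + x) * N.+3%:R `^ (1 - x).
    rewrite -natr_Gam (_ : N.+3%:R = (N.+2%:R + x) + (1 - x)); last lra.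
    apply: le_trans (Gam_le _ x01') _; first lra.
    rewrite ler_wpM2l// ge0_ler_powR// ?nnegrE; lra.
  have /(le_trans _) := ler_pM (ler0n _ _) (ler0n _ _) h1 h2.
  have -> : Gam (N.+2%:R - x) * N.+3%:R `^ x * (Gam (N.+2%:R + x) * N.+3%:R `^ (1 - x)) =
      Gam (N.+2%:R + x) * Gam (N.+2%:R - x) * (N.+3%:R `^ (x + (1 - x))).
    by rewrite powRDp//; ring.
  rewrite (_ : x + (1 - x) = 1) ?powRr1//; last by ring.
  apply.
  have -> : N.+2`!%:R = N.+2%:R * N.+1`!%:R :> R by rewrite factS natrM.
  by rewrite expr2 mulrCA.
- have h1 : Gam (N.+2%:R + x) <= N.+1`!%:R * N.+2%:R `^ x.
    by rewrite -natr_Gam; apply: Gam_le.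
  have h2 : Gam (N.+2%:R - x) <= N`!%:R * N.+1%:R `^ (1 - x).
    rewrite -natr_Gam (_ : N.+2%:R - x = N.+1%:R + (1 - x)); last lra.
    exact: Gam_le.
  apply: le_trans (ler_pM (G0 _) (G0 _) h1 h2) _.
  have h3 : (N.+2%:R / N.+1%:R : R) `^ x <= N.+2%:R / N.+1%:R.
    by apply: ler1_powR; [rewrite ler_pdivlMr; lra|exact: ltW].
  have h4 : N.+2%:R `^ x = (N.+2%:R / N.+1%:R : R) `^ x * N.+1%:R `^ x.
    by rewrite -powRM ?divr_ge0 ?ler0n// divfK// pnatr_eq0.
  have h5 : N.+1%:R `^ x * N.+1%:R `^ (1 - x) = N.+1%:R :> R.
    by rewrite -powRDp// addrC subrK powRr1.
  have h6 : N.+1`!%:R = N.+1%:R * N`!%:R :> R by rewrite factS natrM.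
  apply: (@le_trans _ _ ((N.+2%:R / N.+1%:R) `^ x * N.+1`!%:R ^+ 2)); last first.
    by rewrite ler_wpM2r// exprn_ge0.
  rewrite le_eqVlt; apply/orP; left; apply/eqP.
  rewrite h4 expr2 [in RHS]h6.
  transitivity ((N.+2%:R / N.+1%:R) `^ x * (N.+1%:R * N`!%:R *
      (N.+1%:R `^ x * N.+1%:R `^ (1 - x) * N`!%:R))); last by rewrite h5.
  rewrite h6; set X := (N.+2%:R / N.+1%:R) `^ x.
  set Y := N.+1%:R `^ x; set Z := N.+1%:R `^ (1 - x).
  by move: X Y Z (N.+1%:R : R) (N`!%:R : R) => X Y Z n B; ring.
Qed.

End Gamma.

(** * Euler's product for the sine and the reflection formula *)

Section sine_product.
Context {R : realType}.
Notation mu := (@lebesgue_measure R).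
Implicit Types (t x y : R) (n N : nat).

Lemma sin_le y : 0 <= y -> sin y <= y.
Proof.
rewrite le_eqVlt => /predU1P[<-|y0]; first by rewrite sin0.
have d (z : R) : is_derive z 1 (fun z : R => z - sin z) (1 - cos z) by derive_eq; ring.
have [c _] := MVT_derive y0 d.
rewrite sin0 !subr0 => h.
by rewrite -subr_ge0 h mulr_ge0 ?subr_ge0 ?cos_le1// ltW.
Qed.

Lemma normr_sin_le y : `|sin y| <= `|y|.
Proof.
wlog y0 : y / 0 <= y.
  move=> h; have [/h//|/ltW y0] := leP 0 y.
  by rewrite -normrN -sinN -(normrN y) h// oppr_ge0.
rewrite (ger0_norm y0) ler_norml sin_le// andbT.
have [y1|y1] := leP y pi.
  by rewrite (@le_trans _ _ 0) ?oppr_le0// sin_ge0_pi// y0.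
have := sin_geN1 y; have := @pi_ge2 R; lra.
Qed.

Lemma cos_ge y : 1 - y ^+ 2 / 2 <= cos y.
Proof.
have -> : cos y = 1 - 2 * sin (y / 2) ^+ 2.
  have {1}-> : y = (y / 2) *+ 2 by field.
  by rewrite cos_mulr2n cos2sin2; ring.
have : sin (y / 2) ^+ 2 <= (y / 2) ^+ 2.
  by rewrite -real_normK ?num_real// -[leRHS]real_normK ?num_real// lerXn2r ?nnegrE// normr_sin_le.
rewrite expr_div_n; lra.
Qed.

Lemma mulr_cos_le_sin t : 0 <= t <= pi / 2 -> t * cos t <= sin t.
Proof.
move=> /andP[]; rewrite le_eqVlt => /predU1P[<-|t0 t1]; first by rewrite mul0r sin0.
have d (z : R) : is_derive z 1 (fun z : R => sin z - z * cos z) (z * sin z).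
  by derive_eq; ring.
have [c /andP[c0 ct]] := MVT_derive t0 d; rewrite sin0 mul0r !subr0 => h.
rewrite -subr_ge0 h mulr_ge0 ?(ltW t0)// mulr_ge0 ?(ltW c0)// sin_ge0_pi//.
have := @pi_gt0 R; lra.
Qed.

(** Order 0 gives sin(pi x), a recurrence in steps of 2 brings in the factors of the sine product,
    and the ratio to the moment at [x = 0] tends to 1 along even orders. *)
Definition cos_moment x n := \int[mu]_(t in `[0, pi / 2]) (cos (2 * x * t) * cos t ^+ n).

Lemma continuous_pihalf_integrable (f : R -> R) : continuous f ->
  mu.-integrable `[0, pi / 2] (EFin \o f).
Proof.
move=> cf; apply: continuous_compact_integrable; first exact: segment_compact.
exact: continuous_subspaceT.
Qed.

Lemma cos_moment_continuous x n : continuous (fun t => cos (2 * x * t) * cos t ^+ n).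
Proof. by move=> t; apply: has_deriv_continuous; drv. Qed.

Let integrable_moment x n :
  mu.-integrable `[0, pi / 2] (EFin \o (fun t => cos (2 * x * t) * cos t ^+ n)).
Proof. exact: continuous_pihalf_integrable (@cos_moment_continuous x n). Qed.

Let integrable_momentZ c x n :
  mu.-integrable `[0, pi / 2] (EFin \o (fun t => c * (cos (2 * x * t) * cos t ^+ n))).
Proof. by apply: eq_integrable (integrableZl _ c (integrable_moment x n)). Qed.

Let pihalf_gt0 : 0 < pi / 2 :> R.
Proof. by rewrite divr_gt0// pi_gt0. Qed.

(** Two integrations by parts, merged into one primitive [F] that vanishes at both ends. *)
Lemma cos_momentSS x n : n.+2%:R * n.+1%:R * cos_moment x n =
  (n.+2%:R ^+ 2 - (2 * x) ^+ 2) * cos_moment x n.+2.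
Proof.
apply/eqP; rewrite -subr_eq0; apply/eqP.
rewrite /cos_moment -!RintegralZl//; [|exact: integrable_moment..].
rewrite -(RintegralB _ (integrable_momentZ _ x n) (integrable_momentZ _ x n.+2))//.
pose F t := 2 * x * sin (2 * x * t) * cos t ^+ n.+2 -
  n.+2%:R * cos (2 * x * t) * cos t ^+ n.+1 * sin t.
pose f t := n.+2%:R * n.+1%:R * (cos (2 * x * t) * cos t ^+ n) -
  (n.+2%:R ^+ 2 - (2 * x) ^+ 2) * (cos (2 * x * t) * cos t ^+ n.+2).
transitivity (F (pi / 2) - F 0); last first.
  by rewrite /F cos_pihalf mulr0 sin0 !exprS !(mulr0, mul0r) subrr.
apply: (@FTC2_Rintegral _ F f 0 (pi / 2) pihalf_gt0); rewrite /f.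
- move=> t _; rewrite /F; derive_eq.
  have E : cos t ^+ n.+1 = cos t * cos t ^+ n by rewrite exprS.
  have E2 : cos t ^+ n.+2 = cos t * (cos t * cos t ^+ n) by rewrite !exprS.
  have S2 : sin t * sin t = 1 - cos t * cos t by rewrite -!expr2 sin2cos2.
  rewrite E2 E.
  move: (cos (2 * x * t)) (sin (2 * x * t)) (cos t ^+ n) => C S cn.
  move: (cos t) (sin t) S2 => c s S2.
  have -> : n.+2%:R = n.+1%:R + 1 :> R by rewrite -natr1.
  move: (n.+1%:R : R) => m.
  transitivity (C * cn * ((m + 1) * m * (s * s) + (2 * x) ^+ 2 * (c * c) - (m + 1) * (c * c))).
    ring.
  by rewrite S2; ring.
- by apply: continuous_subspaceT => t; apply: has_deriv_continuous; drv.
Qed.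

Lemma cos_moment_closed x N : cos_moment x 0 * N.*2`!%:R / 4 ^+ N =
  cos_moment x N.*2 * \prod_(m < N) (m.+1%:R ^+ 2 - x ^+ 2).
Proof.
elim: N => [|N IHN]; first by rewrite big_ord0 fact0 expr0; field.
rewrite big_ord_recr/= doubleS.
have h := cos_momentSS x N.*2.
have e2 : (N.*2.+2%:R : R) = 2 * N.+1%:R by rewrite -doubleS -mul2n natrM.
have E : N.*2.+2%:R ^+ 2 - (2 * x) ^+ 2 = 4 * (N.+1%:R ^+ 2 - x ^+ 2).
  by rewrite e2; ring.
rewrite E in h.
transitivity (cos_moment x 0 * N.*2`!%:R / 4 ^+ N * (N.*2.+2%:R * N.*2.+1%:R) / 4).
  by rewrite !factS !natrM exprS; field.
rewrite IHN; move: (\prod_(m < N) _) (_ - _) h => P d h.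
transitivity (P * ((N.*2.+2%:R * N.*2.+1%:R) * cos_moment x N.*2) / 4); first by field.
by rewrite h; field.
Qed.

Lemma cos_moment0 x : x != 0 -> cos_moment x 0 = sin (pi * x) / (2 * x).
Proof.
move=> x0; pose F t := sin (2 * x * t) / (2 * x).
transitivity (F (pi / 2) - F 0).
  apply: (@FTC2_Rintegral _ F _ _ _ pihalf_gt0).
  - by move=> t _; rewrite /F; derive_eq; rewrite expr0; field.
  - exact/continuous_subspaceT/cos_moment_continuous.
by rewrite /F mulr0 sin0 mul0r subr0; congr (sin _ / _); field.
Qed.

Lemma cos_moment00 : cos_moment 0 0 = pi / 2 :> R.
Proof.
transitivity (pi / 2 - 0 : R); last by rewrite subr0.
apply: (@FTC2_Rintegral _ id _ _ _ pihalf_gt0).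
- by move=> t _; rewrite mulr0 mul0r cos0 expr0 mulr1; exact: is_derive_id.
- exact/continuous_subspaceT/cos_moment_continuous.
Qed.

(** From 1 - cos(2 x t) <= 2 x^2 t^2 and t cos t <= sin t, the defect is at most 2 x^2 (cos^(2N) t -
    cos^(2N+2) t). By the recurrence at [x = 0] the integral of this difference of powers is the
    moment of order 2N + 2 divided by 2N + 1. *)
Lemma cos_moment_bounds x N :
  (1 - 2 * x ^+ 2 / N.*2.+1%:R) * cos_moment 0 N.+1.*2 <= cos_moment x N.+1.*2
    <= cos_moment 0 N.+1.*2.
Proof.
have c0 t : t \in `[0, pi / 2] -> 0 <= cos t.
  rewrite in_itv/= => /andP[t0 t1]; rewrite cos_ge0_pihalf// t1 andbT.
  by rewrite (le_trans _ t0)// oppr_le0 ltW.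
have ce t : cos (2 * 0 * t) = 1 by rewrite mulr0 mul0r cos0.
apply/andP; split; last first.
  apply: le_Rintegral => //; [exact: integrable_moment..|].
  by move=> t /= /c0 ct; rewrite ce ler_wpM2r ?exprn_ge0// cos_le1.
have h0 := cos_momentSS 0 N.*2.
rewrite (_ : (2 * 0) ^+ 2 = 0) in h0; last by rewrite mulr0 expr0n.
rewrite subr0 in h0.
have e2 : (N.*2.+2%:R : R) = N.*2.+1%:R + 1 by rewrite -natr1.
have m0 : (0 : R) < N.*2.+1%:R by [].
have -> : (1 - 2 * x ^+ 2 / N.*2.+1%:R) * cos_moment 0 N.+1.*2 =
    (1 + 2 * x ^+ 2) * cos_moment 0 N.+1.*2 - 2 * x ^+ 2 * cos_moment 0 N.*2.
  have -> : cos_moment 0 N.*2 = N.*2.+2%:R * cos_moment 0 N.+1.*2 / N.*2.+1%:R.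
    have : N.*2.+2%:R * (N.*2.+1%:R * cos_moment 0 N.*2) =
      N.*2.+2%:R * (N.*2.+2%:R * cos_moment 0 N.+1.*2) by rewrite !mulrA -expr2 h0.
    by move/mulfI => <-//; field; rewrite gt_eqF.
  by rewrite e2; field; rewrite gt_eqF.
rewrite /cos_moment -!RintegralZl//; [|exact: integrable_moment..].
rewrite -(RintegralB _ (integrable_momentZ _ 0 N.+1.*2) (integrable_momentZ _ 0 N.*2))//.
apply: le_Rintegral => //.
- apply: eq_integrable (integrableB _ (integrable_momentZ (1 + 2 * x ^+ 2) 0 N.+1.*2)
    (integrable_momentZ (2 * x ^+ 2) 0 N.*2)) => //.
suff key (t : R) : t \in `[0, pi / 2] ->
  (1 + 2 * x ^+ 2) * cos t ^+ N.*2.+2 - 2 * x ^+ 2 * cos t ^+ N.*2 <=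
  cos (2 * x * t) * cos t ^+ N.*2.+2.
  by move=> t tI; rewrite !ce !mul1r; exact: key.
move=> tI; have ct := c0 _ tI; rewrite in_itv/= in tI.
have -> : cos t ^+ N.*2.+2 = cos t ^+ 2 * cos t ^+ N.*2 by rewrite -exprD.
have h1 := cos_ge (2 * x * t).
have h2 := mulr_cos_le_sin tI; have /andP[t0 _] := tI.
have h3 : (t * cos t) ^+ 2 <= 1 - cos t ^+ 2.
  by rewrite -sin2cos2 lerXn2r// ?nnegrE ?mulr_ge0// (le_trans _ h2)// mulr_ge0.
have cn : 0 <= cos t ^+ N.*2 by rewrite exprn_ge0.
move: (cos (2 * x * t)) h1 (cos t ^+ N.*2) cn => C h1 cn cn0.
move: (cos t) ct h3 => c c0' h3.
have k1 : (1 - (2 * x * t) ^+ 2 / 2) * (c ^+ 2 * cn) <= C * (c ^+ 2 * cn).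
  by rewrite ler_wpM2r// mulr_ge0// sqr_ge0.
apply: le_trans k1.
have k2 : 0 <= 2 * x ^+ 2 * cn * (1 - c ^+ 2 - (t * c) ^+ 2).
  apply: mulr_ge0; last by rewrite subr_ge0.
  by apply: mulr_ge0 => //; apply: mulr_ge0 => //; exact: sqr_ge0.
rewrite -subr_ge0; apply: le_trans k2 _; rewrite le_eqVlt; apply/orP; left; apply/eqP.
by field.
Qed.

Lemma cos_moment0_gt0 N : 0 < cos_moment 0 N.*2.
Proof.
elim: N => [|N IHN]; first by rewrite cos_moment00.
have := cos_momentSS 0 N.*2; rewrite mulr0 expr0n subr0 doubleS => h.
have : 0 < N.*2.+2%:R ^+ 2 * cos_moment 0 N.*2.+2 by rewrite -h !mulr_gt0.
by rewrite pmulr_rgt0// exprn_gt0.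
Qed.

(* Euler's product for the sine, up to the factor [r], which tends to 1. *)
Lemma sin_product_bounds x N : 0 < x < 1 ->
  exists2 r, 1 - 2 / N.*2.+1%:R <= r <= 1 &
    sin (pi * x) * N.+1`!%:R ^+ 2 =
    r * (pi * x) * \prod_(m < N.+1) (m.+1%:R ^+ 2 - x ^+ 2).
Proof.
move=> /andP[x0 x1].
have J0 := cos_moment0_gt0 N.+1.
have /andP[b1 b2] := cos_moment_bounds x N.
exists (cos_moment x N.+1.*2 / cos_moment 0 N.+1.*2).
  rewrite ler_pdivrMr// mul1r b2 andbT ler_pdivlMr//; apply: le_trans b1.
  rewrite ler_wpM2r ?(ltW J0)// lerD2l lerN2 ler_wpM2r ?invr_ge0//.
  by rewrite ler_piMr// expr_le1// ltW.
have h1 := cos_moment_closed x N.+1; have h2 := cos_moment_closed 0 N.+1.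
set P := \prod_(m < N.+1) (m.+1%:R ^+ 2 - x ^+ 2) in h1 *.
have P0 : \prod_(m < N.+1) (m.+1%:R ^+ 2 - 0 ^+ 2) = N.+1`!%:R ^+ 2 :> R.
  elim: N.+1 => [|n IHn]; first by rewrite big_ord0 fact0 expr1n.
  by rewrite big_ord_recr/= IHn expr0n subr0 factS natrM exprMn mulrC.
rewrite P0 cos_moment00 in h2; rewrite cos_moment0 ?gt_eqF// in h1.
set K := N.+1.*2`!%:R / 4 ^+ N.+1 : R.
have K0 : K != 0 by rewrite mulf_neq0 ?invr_eq0 ?expf_neq0// pnatr_eq0 -lt0n fact_gt0.
rewrite -!mulrA -/K in h1 h2.
have p0 : (pi : R) != 0 by rewrite gt_eqF// pi_gt0.
move: (N.+1`!%:R) h2 => F h2.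
have -> : F ^+ 2 = pi / 2 * K / cos_moment 0 N.+1.*2.
  by rewrite -(mulrA pi) h2; field; rewrite gt_eqF.
transitivity (2 * x * (sin (pi * x) * ((2 * x)^-1 * K)) * pi / 2 / cos_moment 0 N.+1.*2).
  by field; rewrite !gt_eqF.
by rewrite h1; field; rewrite !gt_eqF.
Qed.

(** The quotient [k] of the two sides is independent of [N], while the shifted Gamma product and the
    finite sine product confine it to within [3 / N.+1%:R] of 1. *)
Lemma Gam_reflection x : 0 < x < 1 -> Gam x * Gam (1 - x) * sin (pi * x) = pi.
Proof.
move=> x01; have /andP[x0 x1] := x01.
have p0 : 0 < pi :> R by exact: pi_gt0.
set k := Gam x * Gam (1 - x) * sin (pi * x) / pi.
suff k1 : k = 1 by rewrite -[LHS](divfK (lt0r_neq0 p0)) -/k k1 mul1r.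
have kN N : `|k - 1| <= 3 / N.+1%:R.
  have [r /andP[r1 r2] h] := sin_product_bounds N x01.
  have /andP[b1 b2] := Gam_reflection_bounds N x01.
  have g := Gam_reflection_shift N.+1 x01.
  have F0 : 0 < N.+1`!%:R ^+ 2 :> R by rewrite exprn_gt0// ltr0n fact_gt0.
  rewrite g in b1 b2.
  set P := \prod_(m < N.+1) (m.+1%:R ^+ 2 - x ^+ 2) in h g b1 b2.
  have kE : k * N.+1`!%:R ^+ 2 = Gam x * Gam (1 - x) * x * P * r.
    transitivity (Gam x * Gam (1 - x) / pi * (sin (pi * x) * N.+1`!%:R ^+ 2)).
      by rewrite /k [RHS]mulrA (mulrAC _ (pi^-1) (sin _)).
    rewrite h; transitivity (Gam x * Gam (1 - x) * x * P * r * (pi / pi)); first by ring.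
    by rewrite divff ?mulr1// gt_eqF.
  set G := Gam x * Gam (1 - x) * x * P in kE b1 b2.
  move: (N.+1`!%:R ^+ 2) F0 kE b1 b2 {h g} => F F0 kE b1 b2.
  have G0 : 0 < G.
    by apply: lt_le_trans b1; rewrite mulr_gt0// divr_gt0.
  have e1 : (N.+2%:R : R) = N.+1%:R + 1 by rewrite -natr1.
  have e2 : (N.+3%:R : R) = N.+1%:R + 2 by rewrite -natr1 e1; ring.
  have e3 : (N.*2.+1%:R : R) = 2 * N.+1%:R - 1.
    by rewrite -(natr1 N) -(natr1 N.*2) -mul2n natrM; ring.
  have n1 : 1 <= N.+1%:R :> R by rewrite ler1n.
  rewrite e1 e2 in b1 b2; rewrite e3 in r1.
  move: (N.+1%:R : R) n1 b1 b2 r1 {e1 e2 e3} => n n1 b1 b2 r1.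
  have up : k <= 1 + n^-1.
    rewrite -(ler_pM2r F0) kE; apply: (@le_trans _ _ G); first by rewrite ler_piMr// ltW.
    apply: le_trans b2 _; rewrite ler_wpM2r ?(ltW F0)//.
    by rewrite mulrDl divff ?mul1r// gt_eqF//; lra.
  have u1 : 2 / (2 * n - 1) <= 2 / n.
    by rewrite ler_pM2l// lef_pV2 ?posrE; lra.
  have u2 : (n + 1) / (n + 2) >= 1 - n^-1.
    rewrite ler_pdivlMr; last lra.
    rewrite -subr_ge0 (_ : _ - _ = 2 / n); first by rewrite divr_ge0//; lra.
    by field; rewrite gt_eqF//; lra.
  have n0 : 0 < n by lra.
  (* The constant 3 comes from (1 - 1 / n) (1 - 2 / n) >= 1 - 3 / n. *)
  have lo : 1 - 3 / n <= k.
    (* For small [n] the factor [r] is not known to be positive; if it is not, then [2 / n] is at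
       least 1 and [0 <= k] suffices. *)
    have [r0|r0] := leP r 0.
      have i1 : 1 <= 2 / n by lra.
      have i2 : 0 <= n^-1 by rewrite invr_ge0 ltW.
      have : 0 <= k.
        rewrite /k divr_ge0 ?(ltW p0)// !mulr_ge0 ?Gam_ge0// sin_ge0_pi//.
        by rewrite mulr_ge0 ?(ltW p0) ?(ltW x0)//= ler_piMr// ltW.
      lra.
    rewrite -(ler_pM2r F0) kE.
    have j1 : (n + 1) / (n + 2) * F * r <= G * r by rewrite ler_wpM2r// ltW.
    apply: le_trans j1; rewrite mulrAC ler_wpM2r ?(ltW F0)//.
    have [s0|s0] := leP (1 - n^-1) 0.
      apply: (@le_trans _ _ 0); first lra.
      by rewrite mulr_ge0 ?(ltW r0)// divr_ge0//; lra.
    have j2 : (1 - n^-1) * r <= (n + 1) / (n + 2) * r by rewrite ler_wpM2r// ltW.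
    apply: le_trans j2.
    have j3 : (1 - n^-1) * (1 - 2 / n) <= (1 - n^-1) * r.
      by rewrite ler_wpM2l ?(ltW s0)//; lra.
    apply: le_trans j3.
    rewrite -subr_ge0 (_ : _ - _ = 2 * n^-1 ^+ 2); last by field; rewrite gt_eqF.
    by rewrite mulr_ge0// sqr_ge0.
  have i2 : 0 <= n^-1 by rewrite invr_ge0 ltW.
  by rewrite ler_norml; apply/andP; split; lra.
apply/eqP; rewrite -subr_eq0 -normr_eq0 eq_le normr_ge0 andbT.
apply/ler_addgt0Pl => e e0; rewrite addr0.
apply: (le_trans (kN (Num.truncn (3 / e)))).
rewrite ler_pdivrMr// -ler_pdivrMl// mulrC ltW//.
exact: truncnS_gt.
Qed.

End sine_product.

(** * Rotation of the ray of integration *)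

Section mean_value.
Context {R : realType}.
Implicit Types (f : R -> R) (x y z M : R).

Lemma normr_MVT f f' M x :
  (forall z, `|z| <= `|x| -> is_derive z 1 f (f' z)) ->
  (forall z, `|z| <= `|x| -> `|f' z| <= M) ->
  `|f x - f 0| <= M * `|x|.
Proof.
move=> df f'M; have [x0|x0|<-] := ltgtP 0 x; last by rewrite subrr !normr0 mulr0.
- have rg z : 0 <= z <= x -> `|z| <= `|x|.
    by move=> /andP[z0 zx]; rewrite !ger0_norm ?(le_trans z0 zx).
  have [||c] := @MVT R f f' 0 x x0.
  + by move=> z /subset_itv_oo_cc; rewrite in_itv/= => /rg; exact: df.
  + by apply: derivable_within_continuous => z; rewrite in_itv/= => /rg /df[].
  + move=> /subset_itv_oo_cc; rewrite in_itv/= subr0 => /rg /f'M h ->.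
    by rewrite normrM ler_wpM2r.
- have rg z : x <= z <= 0 -> `|z| <= `|x|.
    move=> /andP[z0 zx]; rewrite !ler0_norm ?lerN2//.
    exact: le_trans z0 zx.
  have [||c] := @MVT R f f' x 0 x0.
  + by move=> z /subset_itv_oo_cc; rewrite in_itv/= => /rg; exact: df.
  + by apply: derivable_within_continuous => z; rewrite in_itv/= => /rg /df[].
  + move=> /subset_itv_oo_cc; rewrite in_itv/= sub0r => /rg /f'M h E.
    by rewrite distrC E normrM normrN ler_wpM2r.
Qed.

Lemma cos_ge_abs (th th' : R) : `|th'| <= `|th| -> `|th| < pi / 2 -> 0 < cos th <= cos th'.
Proof.
move=> h hth; have p2 : pi / 2 <= pi :> R by have := @pi_ge0 R; lra.
apply/andP; split.
  by rewrite cos_gt0_pihalf// -ltr_norml.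
rewrite -(cos_norm th) -(cos_norm th') leNgt ltr_cos ?in_itv/= -?leNgt ?normr_ge0//=.
- by rewrite (le_trans (ltW hth)).
- by rewrite (le_trans h)// (le_trans (ltW hth)).
Qed.

Lemma normr_sinB_le (x y : R) : `|sin (x + y) - sin x| <= `|y|.
Proof.
rewrite -[leRHS]mul1r -{2}(addr0 x).
apply: (@normr_MVT (fun z => sin (x + z)) (fun z => cos (x + z)) 1 y).
- by move=> z _; derive_eq; ring.
- by move=> z _; exact: cos_max.
Qed.

Lemma expRN_le_inv (y : R) : 0 < y -> expR (- y) <= y^-1.
Proof.
move=> y0; rewrite expRN lef_pV2 ?posrE ?expR_gt0//.
by apply: le_trans (expR_ge1Dx y); rewrite lerDr.
Qed.

End mean_value.

Section rotation.
Context {R : realType}.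
Notation mu := (@lebesgue_measure R).
Variables (b v p B : R).
Hypotheses (b0 : 0 < b) (v0 : 0 < v) (p0 : 0 <= p).
Implicit Types (s th c : R).

Definition rot_phase th s := B + p * th - v * s `^ b * sin th.

(** Imaginary part of e^(i B) z^p e^(- v z) / s at z = s^b e^(i th). *)
Definition rot th s :=
  s `^ (b * p - 1) * expR (- (v * s `^ b * cos th)) * sin (rot_phase th s).

Let drot th s := s `^ (b * p - 1) * expR (- (v * s `^ b * cos th)) *
  (v * s `^ b * sin th * sin (rot_phase th s) +
   (p - v * s `^ b * cos th) * cos (rot_phase th s)).

(** Real part of the same expression without 1 / s, divided by [b]. For a holomorphic H at z = s^b
    e^(i th), the [th]-derivative of H is i s / b times its [s]-derivative. *)
Let prim th s := b^-1 * (s `^ (b * p) * expR (- (v * s `^ b * cos th)) *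
  cos (rot_phase th s)).

Let is_derive_rot th s : is_derive th 1 (rot ^~ s) (drot th s).
Proof. by rewrite /rot /drot /rot_phase; derive_eq; ring. Qed.

(* Rotating the ray of integration changes the integrand by an exact derivative. *)
Let is_derive_prim th s : 0 < s -> is_derive s 1 (prim th) (drot th s).
Proof.
move=> s0; rewrite /prim /drot /rot_phase; derive_eq => //.
rewrite !powRB1//; move: (sin _) (cos (_ - _)) => S C.
by field; rewrite !gt_eqF.
Qed.

(** Dominates [drot] at all angles whose cosine is at least [c], as differentiation under the
    integral sign requires. *)
Let majorant c s := p * (s `^ (b * p - 1) * expR (- (v * c * s `^ b))) +
  2 * v * (s `^ (b * p + b - 1) * expR (- (v * c * s `^ b))).

Let majorant_integrable c : 0 < c -> mu.-integrable `]0, +oo[ (EFin \o majorant c).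
Proof.
move=> c0; have vc0 : 0 < v * c by rewrite mulr_gt0.
apply: integrableD0y; last first.
  by apply: integrableZ0y; apply: integrable_powR_expRN => //; rewrite ltr_wpDl ?mulr_ge0// ltW.
(* At [p = 0] the power in the first term is [1 / s], not integrable at 0, but its coefficient is
   0. *)
move: p0; rewrite le_eqVlt => /predU1P[<-|p_gt0].
  apply: (@eq_integrable0y _ (fun s => 0 * (s `^ (b - 1) * expR (- (v * c * s `^ b))))).
    by move=> s s0; rewrite !mul0r.
  by apply: integrableZ0y; exact: integrable_powR_expRN.
by apply: integrableZ0y; apply: integrable_powR_expRN => //; rewrite mulr_gt0.
Qed.

Let drot_le c th s : 0 < s -> 0 <= c -> c <= cos th -> `|drot th s| <= majorant c s.
Proof.
move=> s0 c0 cth; rewrite /drot /majorant.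
have -> : s `^ (b * p + b - 1) = s `^ (b * p - 1) * s `^ b.
  by rewrite addrAC powRDp.
have vs0 : 0 <= v * s `^ b by rewrite mulr_ge0 ?powR_ge0// ltW.
rewrite !normrM (ger0_norm (powR_ge0 _ _)) (ger0_norm (expR_ge0 _)).
have e1 : expR (- (v * s `^ b * cos th)) <= expR (- (v * c * s `^ b)).
  by rewrite ler_expR lerN2 mulrAC ler_wpM2l.
have e2 : `|v * s `^ b * sin th * sin (rot_phase th s) +
    (p - v * s `^ b * cos th) * cos (rot_phase th s)| <= p + 2 * (v * s `^ b).
  have m1 (x y z : R) : `|x| <= y -> `|z| <= 1 -> `|x * z| <= y.
    move=> xy z1; rewrite normrM (le_trans (ler_pM _ _ xy z1))// mulr1//.
  have h1 : `|v * s `^ b * sin th * sin (rot_phase th s)| <= v * s `^ b.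
    by apply: (m1 _ _ _ _ (sin_max _)); apply: (m1 _ _ _ _ (sin_max _)); rewrite ger0_norm.
  have h2 : `|(p - v * s `^ b * cos th) * cos (rot_phase th s)| <= p + v * s `^ b.
    apply: (m1 _ _ _ _ (cos_max _)); rewrite (le_trans (ler_normB _ _))// (ger0_norm p0) lerD2l.
    by apply: (m1 _ _ _ _ (cos_max _)); rewrite ger0_norm.
  by rewrite (le_trans (ler_normD _ _))// (le_trans (lerD h1 h2))//; lra.
have := ler_pM (mulr_ge0 (powR_ge0 s (b * p - 1)) (expR_ge0 _)) (normr_ge0 _)
  (ler_wpM2l (powR_ge0 s (b * p - 1)) e1) e2.
move=> /le_trans; apply; rewrite le_eqVlt; apply/orP; left; apply/eqP; ring.
Qed.

Let measurable_rot th (D : set R) : measurable_fun D (rot th).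
Proof.
by apply: measurable_funTS; rewrite /rot /rot_phase; meas.
Qed.

Let measurable_drot th (D : set R) : measurable_fun D (drot th).
Proof.
by apply: measurable_funTS; rewrite /drot /rot_phase; meas.
Qed.

Let rotB_le th s : 0 < s -> `|th| < pi / 2 ->
  `|rot th s - rot 0 s| <= majorant (cos th) s * `|th|.
Proof.
move=> s0 hth; apply: (@normr_MVT _ (rot ^~ s) (drot ^~ s)) => // z hz.
by have /andP[c0 c1] := cos_ge_abs hz hth; apply: drot_le => //; exact: ltW.
Qed.

Lemma rotB_integrable th : `|th| < pi / 2 ->
  mu.-integrable `]0, +oo[ (EFin \o (fun s => rot th s - rot 0 s)).
Proof.
move=> hth; have /andP[c0 _] := cos_ge_abs (lexx _) hth.
apply: (@open_integrable_le _ _ _ (fun s => `|th| * majorant (cos th) s)).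
- exact: interval_open.
- by apply: measurable_funB; exact: measurable_rot.
- by move=> s; rewrite in_itv0y => s0; rewrite mulrC rotB_le.
- by apply: integrableZ0y; exact: majorant_integrable.
Qed.

(** The boundary value of [prim] at [s = 0]; for [p = 0] it records the simple pole of the
    integrand. *)
Let flux := if p == 0 then b^-1 * cos B else 0.

Let prim_cvg0 th : 0 <= cos th -> prim th s @[s --> 0^'+] --> flux.
Proof.
move=> c0; rewrite /flux; case: eqP => [p00|/eqP pn0].
  pose k y := b^-1 * (expR (- (v * y * cos th)) * cos (B - v * y * sin th)).
  have kc : k y @[y --> 0] --> b^-1 * cos B.
    have -> : b^-1 * cos B = k 0.
      by rewrite /k !(mulr0, mul0r, oppr0, expR0, mul1r, addr0).
    by apply: has_deriv_continuous; rewrite /k; drv.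
  have -> : prim th = fun s => k (s `^ b).
    apply/funext => s; rewrite /prim /k /rot_phase p00 mulr0 powRr0 mul0r addr0.
    by rewrite mul1r.
  by apply: cvg_comp kc; exact: powR_cvg0.
have p1 : 0 < p by rewrite lt_neqAle eq_sym pn0.
apply: (@powR_bound_cvg0 _ _ b^-1 (b * p)); first by rewrite mulr_gt0.
move=> s s0; rewrite /prim !normrM (ger0_norm (powR_ge0 _ _)) (ger0_norm (expR_ge0 _)).
rewrite ger0_norm ?invr_ge0 ?(ltW b0)// ler_wpM2l ?invr_ge0 ?(ltW b0)//.
rewrite -mulrA ler_piMr ?powR_ge0// mulr_ile1 ?expR_ge0 ?cos_max//.
by rewrite -expR0 ler_expR oppr_le0 mulr_ge0// mulr_ge0 ?powR_ge0// ltW.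
Qed.

Let prim_cvgy th : 0 < cos th -> prim th s @[s --> +oo] --> 0.
Proof.
move=> c0; apply: (@powR_expRN_bound_cvgy _ _ b^-1 (b * p) b (v * cos th)) => //.
- by rewrite mulr_ge0// ltW.
- by rewrite mulr_gt0.
- by rewrite invr_ge0 ltW.
move=> s s0; rewrite /prim !normrM (ger0_norm (powR_ge0 _ _)) (ger0_norm (expR_ge0 _)).
rewrite ger0_norm ?invr_ge0 ?(ltW b0)// ler_wpM2l ?invr_ge0 ?(ltW b0)//.
rewrite (mulrAC v (cos th)) ler_piMr ?cos_max// mulr_ge0 ?powR_ge0 ?expR_ge0//.
Qed.

Let drot_integrable th : `|th| < pi / 2 -> mu.-integrable `]0, +oo[ (EFin \o drot th).
Proof.
move=> hth; have /andP[c0 _] := cos_ge_abs (lexx _) hth.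
apply: (@open_integrable_le _ _ _ (majorant (cos th))).
- exact: interval_open.
- exact: measurable_drot.
- by move=> s; rewrite in_itv0y => s0; apply: drot_le => //; exact: ltW.
- exact: majorant_integrable.
Qed.

Let integral_drot th : `|th| < pi / 2 ->
  \int[mu]_(s in `]0, +oo[) drot th s = - flux.
Proof.
move=> hth; have /andP[c0 _] := cos_ge_abs (lexx _) hth.
rewrite -[RHS]add0r; apply: (@itv0y_FTC2 _ (prim th) (drot th)).
- by move=> s; exact: is_derive_prim.
- by move=> s s0; apply: has_deriv_continuous; rewrite /drot /rot_phase; drv.
- exact: drot_integrable.
- by apply: prim_cvg0; exact: ltW.
- exact: prim_cvgy.
Qed.

(** The angle derivative of the integral is the constant [- flux], so the integral is linear in
    [th]. Subtracting the integrand at angle 0 keeps the statement meaningful for [p = 0], where the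
    pole at 0 can make a single integral diverge. *)
Lemma rotation th : `|th| < pi / 2 ->
  \int[mu]_(s in `]0, +oo[) (rot th s - rot 0 s) =
  - th * (if p == 0 then b^-1 * cos B else 0).
Proof.
move=> hth; rewrite -/flux.
(* An angle strictly between [|th|] and [pi / 2]: a single majorant then serves on an open interval
   around [th]. *)
pose e : R := (`|th| + pi / 2) / 2.
have e0 : 0 < e by rewrite /e; have := normr_ge0 th; have := @pi_gt0 R; lra.
have e1 : `|th| < e by rewrite /e; lra.
have e2 : e < pi / 2 by rewrite /e; lra.
have ee : `|e| = e by rewrite gtr0_norm.
pose Psi z := \int[mu]_(s in `]0, +oo[) (rot z s - rot 0 s).
have dPsi (z : R) : `|z| < e -> is_derive z 1 Psi (- flux).
  move=> ze; have zI : `]-e, e[%classic z by rewrite /= in_itv/= -ltr_norml.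
  have lt_p2 (x : R) : `]-e, e[%classic x -> `|x| < pi / 2.
    by rewrite /= in_itv/= -ltr_norml => xe; exact: lt_trans e2.
  have dfxy (x y : R) : is_derive x 1 ((fun z s => rot z s - rot 0 s) ^~ y) (drot x y).
    apply: (has_deriv_eq (drvD (is_derive_rot x y) (drvN (drv_cst _ _)))).
    by rewrite oppr0 addr0.
  have d1E (x y : R) : partial1of2 (fun z s => rot z s - rot 0 s) x y = drot x y.
    by rewrite partial1of2E; have [] := dfxy x y.
  have h1 (x : R) : `]-e, e[%classic x -> mu.-integrable `]0, +oo[ (EFin \o (fun s => rot x s - rot 0 s)).
    by move=> /lt_p2; exact: rotB_integrable.
  have h2 (x y : R) : `]-e, e[%classic x -> (`]0, +oo[%classic : set R) y ->
      derivable ((fun z s => rot z s - rot 0 s) ^~ y) x 1.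
    by move=> _ _; have [] := dfxy x y.
  have ce : 0 < cos e.
    have hp : `|e| < pi / 2 by rewrite ee.
    by have /andP[] := cos_ge_abs (lexx _) hp.
  have h3 (y : R) : 0 <= `|majorant (cos e) y| by [].
  have h4 : mu.-integrable `]0, +oo[ (EFin \o (fun y => `|majorant (cos e) y|)).
    exact/integrable_norm/majorant_integrable.
  have h5 (x y : R) : `]-e, e[%classic x -> (`]0, +oo[%classic : set R) y ->
      `|partial1of2 (fun z s => rot z s - rot 0 s) x y| <= `|majorant (cos e) y|.
    move=> xe; rewrite in_itv0y => y0; rewrite d1E.
    apply: le_trans (ler_norm _); apply: drot_le => //; first exact: ltW.
    have hp : `|e| < pi / 2 by rewrite ee.
    have xe' : `|x| <= `|e| by rewrite ee ltW//; move: xe; rewrite /= in_itv/= -ltr_norml.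
    by have /andP[] := cos_ge_abs xe' hp.
  have mD : measurable (`]0, +oo[%classic : set (measurableTypeR R)) by exact: measurable_itv.
  apply: DeriveDef.
    exact: (derivable_under_integral mD zI h1 h2 h3 h4 h5).
  rewrite -derive1E (differentiation_under_integral mD zI h1 h2 h3 h4 h5).
  rewrite -(integral_drot (lt_p2 _ zI)); apply: eq_Rintegral0y => y y0.
  exact: d1E.
(* This function has derivative 0 for [|z| <= |th|] and vanishes at 0. *)
have := @normr_MVT _ (fun z => Psi z + z * flux) (fun=> 0) 0 th.
rewrite mul0r => /(_ _ _).
have -> : Psi 0 = 0.
  rewrite /Psi (@eq_Rintegral0y _ _ (fun=> 0)); last by move=> s _; rewrite subrr.
  by rewrite Rintegral_cst// mul0r.
rewrite mul0r addr0 subr0 => h.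
have {h} : `|Psi th + th * flux| <= 0.
  apply: h => [z zth|z _]; last by rewrite normr0.
  have dz := dPsi _ (le_lt_trans zth e1).
  apply: (has_deriv_eq (drvD dz (drvM (drv_id _) (drv_cst _ _)))); ring.
by rewrite normr_le0 addr_eq0 mulNr => /eqP.
Qed.

End rotation.

(** * Taylor expansion of the exponential in a complex direction *)

Section exponential_sum.
Context {R : realType}.
Implicit Types (A chi y Y : R) (n N : nat).

Lemma drv_sum N (f : nat -> R -> R) (df : nat -> R) (x : R) :
  (forall n, has_deriv (f n) x (df n)) ->
  has_deriv (fun y => \sum_(n < N) f n y) x (\sum_(n < N) df n).
Proof.
move=> dfx; elim: N => [|N IHN].
  have -> : (fun y => \sum_(n < 0) f n y) = fun=> 0.
    by apply/funext => y; rewrite big_ord0.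
  by rewrite big_ord0; exact: drv_cst.
have -> : (fun y => \sum_(n < N.+1) f n y) = fun y => \sum_(n < N) f n y + f N y.
  by apply/funext => y; rewrite big_ord_recr.
by rewrite big_ord_recr; exact: drvD.
Qed.

(** Imaginary part of exp(i A + y e^(- i chi)); differentiation in [y] shifts the phase [A] by
    [- chi]. *)
Definition expsin chi A y := expR (y * cos chi) * sin (A - y * sin chi).

Lemma expsin0 chi A : expsin chi A 0 = sin A.
Proof. by rewrite /expsin !mul0r expR0 mul1r subr0. Qed.

Lemma drv_expsin chi A y : has_deriv (expsin chi A) y (expsin chi (A - chi) y).
Proof.
rewrite /expsin; derive_eq.
rewrite (_ : A - chi - y * sin chi = A - y * sin chi - chi); last by ring.
by rewrite (sinB (A - y * sin chi)); ring.
Qed.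

Let term A chi n y := y ^+ n / n`!%:R * sin (A - n%:R * chi).

Let rem A chi N y := expsin chi A y - \sum_(n < N) term A chi n y.

Let drv_term A chi n y : has_deriv (term A chi n) y
  (n%:R * y ^+ n.-1 / n`!%:R * sin (A - n%:R * chi)).
Proof. by rewrite /term; derive_eq; ring. Qed.

Let drv_rem A chi N y : has_deriv (rem A chi N.+1) y (rem (A - chi) chi N y).
Proof.
have := drvD (drv_expsin chi A y) (drvN (drv_sum N.+1 (fun n => drv_term A chi n y))).
rewrite /has_deriv; congr (is_derive _ _ _ _).
rewrite /rem; congr (_ - _); rewrite big_ord_recl/= !mul0r add0r.
apply: eq_bigr => n _; rewrite /term /bump/= add1n.
congr (_ * sin _); last by rewrite -natr1; ring.
rewrite factS natrM; field.
by rewrite pnatr_eq0 -lt0n fact_gt0 nat1r pnatr_eq0.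
Qed.

Let rem_at0 A chi N : rem A chi N.+1 0 = 0.
Proof.
rewrite /rem expsin0 big_ord_recl big1 ?addr0.
  by rewrite /term expr0 fact0 divr1 mul1r mul0r subr0 subrr.
by move=> i _; rewrite /term expr0n mul0r mul0r.
Qed.

Let normr_expsin_le_expR A chi y : 0 <= y -> `|expsin chi A y| <= expR y.
Proof.
move=> y0; rewrite /expsin normrM ger0_norm ?expR_ge0//.
rewrite -[leRHS]mulr1 ler_pM ?expR_ge0 ?sin_max//.
by rewrite ler_expR ler_piMr// cos_le1.
Qed.

Let le_deriv0 (f f' : R -> R) y : 0 <= y -> f 0 <= 0 ->
  (forall x : R, has_deriv f x (f' x)) -> (forall x, 0 <= x <= y -> f' x <= 0) -> f y <= 0.
Proof.
rewrite le_eqVlt => /predU1P[<-//|y0] f0 df f'0.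
have [c /andP[c0 cy] E] := MVT_derive y0 df.
have h : f' c * (y - 0) <= 0.
  by rewrite subr0 mulr_le0_ge0 ?(ltW y0)//; apply: f'0; rewrite !ltW.
by move: h f0; rewrite -E; lra.
Qed.

(** Induction on [N] for all phases at once: the derivative of the remainder of order [N.+1] is the
    remainder of order [N] at phase [A - chi]. The fixed endpoint [Y] keeps the factor [expR Y]
    constant under differentiation. *)
Let rem_le_aux A chi N Y y : 0 <= y <= Y -> rem A chi N y <= expR Y * (y ^+ N / N`!%:R).
Proof.
elim: N A y => [|N IHN] A y /andP[y0 yY].
  rewrite expr0 fact0 divr1 mulr1 /rem big_ord0 subr0.
  rewrite (le_trans (ler_norm _))// (le_trans (normr_expsin_le_expR _ _ y0))//.
  by rewrite ler_expR.
rewrite -subr_le0.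
pose g (z : R) := expR Y * (z ^+ N / N`!%:R).
pose F (z : R) := rem A chi N.+1 z - expR Y * (z ^+ N.+1 / N.+1`!%:R).
pose F' (z : R) := rem (A - chi) chi N z - g z.
have F0 : F 0 <= 0 by rewrite /F rem_at0 expr0n/= mul0r mulr0 subrr.
have dF (x : R) : has_deriv F x (F' x).
  have dg : has_deriv (fun z : R => expR Y * (z ^+ N.+1 / N.+1`!%:R)) x (g x).
    derive_eq; rewrite /g factS natrM; field.
    by rewrite pnatr_eq0 -lt0n fact_gt0 nat1r pnatr_eq0.
  exact: drvD (drv_rem A chi N x) (drvN dg).
have F'0 x : 0 <= x <= y -> F' x <= 0.
  by move=> /andP[x0 xy]; rewrite subr_le0; apply: IHN; rewrite x0 (le_trans xy).
exact: (le_deriv0 y0 F0 dF F'0).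
Qed.

Lemma expsin_taylor A chi N y : 0 <= y ->
  `|expsin chi A y - \sum_(n < N) y ^+ n / n`!%:R * sin (A - n%:R * chi)| <=
  expR y * (y ^+ N / N`!%:R).
Proof.
move=> y0; rewrite -/(rem A chi N y).
have yy : 0 <= y <= y by rewrite y0/=.
rewrite ler_norml (rem_le_aux A chi N yy) andbT.
(* The lower bound is the upper bound at a phase shifted by [pi], which changes the sign of every
   term. *)
suff -> : rem A chi N y = - rem (A + pi) chi N y.
  by rewrite lerN2; exact: rem_le_aux.
have sinDp x : sin (x + pi) = - sin x by exact: sinDpi.
rewrite /rem opprB /expsin addrAC sinDp mulrN opprK.
rewrite [RHS]addrC; congr (_ + _); rewrite -sumrN.
apply: eq_bigr => n _; rewrite /term (addrAC A) sinDp; ring.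
Qed.

(** For [cos chi <= 0] the derivative stays in [-1, 1]. The factor [y] gained at 0 is what
    compensates a weight [1 / s]. *)
Lemma expsinB0_le A chi y : cos chi <= 0 -> 0 <= y -> `|expsin chi A y - sin A| <= y.
Proof.
move=> c0 y0; rewrite -(expsin0 chi A) -[leRHS]mul1r -{2}(ger0_norm y0).
pose f z := expsin chi A `|z|.
have [c0' | ] := leP 0 y; last by rewrite ltNge y0.
rewrite le_eqVlt in y0; case/predU1P : y0 => [<-|y0].
  by rewrite subrr !normr0 mulr0.
have [c /andP[cc0 _] ->] := MVT_derive y0 (drv_expsin chi A).
rewrite subr0 normrM ler_wpM2r// /expsin normrM ger0_norm ?expR_ge0//.
by rewrite mulr_ile1 ?expR_ge0 ?sin_max// -expR0 ler_expR mulr_ge0_le0// ltW.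
Qed.

(** One term of the series of exp(2 y). It gives a geometric rate uniform in [y], paid for by a
    larger exponential. *)
Lemma pow_fact_le N y : 0 <= y -> y ^+ N / N`!%:R <= 2 ^- N * expR (2 * y).
Proof.
move=> y0; have h : (2 * y) ^+ N / N`!%:R <= expR (2 * y).
  case: N => [|N].
    by rewrite expr0 fact0 divr1 -expR0 ler_expR mulr_ge0.
  have y20 : 0 <= 2 * y by rewrite mulr_ge0.
  by apply: le_trans (expR_ge1Dxn N y20); rewrite lerDr.
by rewrite ler_pdivlMl ?exprn_gt0// mulrA -exprMn.
Qed.

Lemma pow_factS_le N y : 0 <= y ->
  y ^+ N.+1 / N.+1`!%:R <= 2 ^- N * (y * expR (2 * y)).
Proof.
move=> y0; apply: (@le_trans _ _ (y * (y ^+ N / N`!%:R))).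
  rewrite exprS -mulrA ler_wpM2l// ler_wpM2l ?exprn_ge0//.
  by rewrite lef_pV2 ?posrE ?ltr0n ?fact_gt0// ler_nat factS leq_pmull.
by rewrite [leRHS]mulrCA; apply: ler_wpM2l => //; exact: pow_fact_le.
Qed.

End exponential_sum.

(** * Summation of the series under the integral sign *)

Section interchange.
Context {R : realType}.
Notation mu := (@lebesgue_measure R).
Variables (beta c : R).
Hypotheses (beta01 : 0 < beta < 1) (c0 : 0 < c).
Implicit Types (k v s chi : R) (A : R -> R) (N : nat).

Let beta0 : 0 < beta. Proof. by case/andP: beta01. Qed.

Definition wgt k s := s `^ (k - 1) * expR (- (c * s)).

Lemma wgt_ge0 k s : 0 <= wgt k s.
Proof. by rewrite mulr_ge0 ?powR_ge0 ?expR_ge0. Qed.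

Lemma wgt_integrable k : 0 < k -> mu.-integrable `]0, +oo[ (EFin \o wgt k).
Proof.
move=> k0; apply: (eq_integrable0y _ (integrable_powR_expRN k0 ltr01 c0)) => s s0.
by rewrite powRr1// ltW.
Qed.

Lemma measurable_wgt k (D : set R) : measurable_fun D (wgt k).
Proof. by apply: measurable_funTS; rewrite /wgt; meas. Qed.

Lemma wgtD k q s : 0 < s -> wgt (k + q) s = s `^ q * wgt k s.
Proof.
move=> s0; rewrite /wgt (_ : k + q - 1 = k - 1 + q); last by ring.
by rewrite powRDp//; ring.
Qed.

Lemma wgt_expR_integrable k q V : 0 <= k -> 0 < q -> 0 <= V ->
  mu.-integrable `]0, +oo[ (EFin \o (fun s => wgt k s * (s `^ q * expR (V * s `^ beta)))).
Proof.
move=> k0 q0 V0.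
apply: (@integrable_le_powR_expR _ _ 1 (k + q) beta c V) => //.
- by rewrite /wgt; meas.
- by rewrite ltr_wpDl.
move=> s s0; rewrite mul1r ger0_norm; last first.
  apply: mulr_ge0; first exact: wgt_ge0.
  by apply: mulr_ge0; [exact: powR_ge0|exact: expR_ge0].
rewrite /wgt (_ : k + q - 1 = k - 1 + q); last by ring.
rewrite (@powRDp _ _ (k - 1) q)// [expR (_ - _)]expRD.
by rewrite le_eqVlt; apply/orP; left; apply/eqP; ring.
Qed.

Lemma sum_wgt_integral k v A chi N : 0 <= k -> measurable_fun setT A ->
  \sum_(n < N) v ^+ n.+1 / n.+1`!%:R *
    \int[mu]_(s in `]0, +oo[) (wgt (k + beta * n.+1%:R) s * sin (A s - n.+1%:R * chi)) =
  \int[mu]_(s in `]0, +oo[) (wgt k s *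
    \sum_(n < N) (v * s `^ beta) ^+ n.+1 / n.+1`!%:R * sin (A s - n.+1%:R * chi)).
Proof.
move=> k0 mA.
have ti n : mu.-integrable `]0, +oo[
    (EFin \o (fun s => wgt (k + beta * n.+1%:R) s * sin (A s - n.+1%:R * chi))).
  apply: (@open_integrable_le _ _ _ (wgt (k + beta * n.+1%:R))).
  - exact: interval_open.
  - apply: measurable_funM; first exact: measurable_wgt.
    by apply: measurable_funTS; meas.
  - move=> s _; rewrite normrM ger0_norm ?wgt_ge0// ler_piMr ?wgt_ge0//.
    exact: sin_max.
  - by apply: wgt_integrable; rewrite ltr_wpDl// mulr_gt0.
have tE n s : 0 < s -> v ^+ n.+1 / n.+1`!%:R *
      (wgt (k + beta * n.+1%:R) s * sin (A s - n.+1%:R * chi)) =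
    wgt k s * ((v * s `^ beta) ^+ n.+1 / n.+1`!%:R * sin (A s - n.+1%:R * chi)).
  move=> s0; rewrite wgtD// powRrM powR_mulrn ?powR_ge0// exprMn.
  by ring.
(* Integrability of the partial sums goes through the same induction, since additivity of the
   integral needs it at each step. *)
suff [_ //] : mu.-integrable `]0, +oo[ (EFin \o (fun s => wgt k s *
    \sum_(n < N) (v * s `^ beta) ^+ n.+1 / n.+1`!%:R * sin (A s - n.+1%:R * chi))) /\
  \sum_(n < N) v ^+ n.+1 / n.+1`!%:R *
    \int[mu]_(s in `]0, +oo[) (wgt (k + beta * n.+1%:R) s * sin (A s - n.+1%:R * chi)) =
  \int[mu]_(s in `]0, +oo[) (wgt k s *
    \sum_(n < N) (v * s `^ beta) ^+ n.+1 / n.+1`!%:R * sin (A s - n.+1%:R * chi)).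
elim: N => [|N [IHi IHE]].
  split; last first.
    rewrite big_ord0 (@eq_Rintegral0y _ _ (fun=> 0)).
      by rewrite Rintegral_cst// mul0r.
    by move=> s _; rewrite big_ord0 mulr0.
  apply: (@eq_integrable0y _ (fun s => 0 * wgt 1 s)).
    by move=> s _; rewrite big_ord0 mulr0 mul0r.
  exact/integrableZ0y/wgt_integrable.
have tiN := integrableZ0y (v ^+ N.+1 / N.+1`!%:R) (ti N).
split.
  apply: eq_integrable0y (integrableD0y IHi tiN) => s s0.
  by rewrite big_ord_recr/= tE// mulrDr.
rewrite big_ord_recr/= IHE -RintegralZl//.
rewrite -RintegralD//; apply: eq_Rintegral0y => s s0.
by rewrite big_ord_recr/= tE// mulrDr.
Qed.

(** The term of order 0, [sin (A s)], is taken out because it need not be integrable at 0 against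
    [wgt 0]. *)
Definition expsin_integral k A chi v :=
  \int[mu]_(s in `]0, +oo[) (wgt k s * (expsin chi (A s) (v * s `^ beta) - sin (A s))).

Lemma measurable_expsin_integrand k A chi v (D : set R) : measurable_fun setT A ->
  measurable_fun D (fun s => wgt k s * (expsin chi (A s) (v * s `^ beta) - sin (A s))).
Proof. by move=> mA; apply: measurable_funTS; rewrite /wgt /expsin; meas. Qed.

Lemma expsin_integrable k A chi v : 0 <= k -> 0 <= v -> cos chi <= 0 ->
  measurable_fun setT A -> mu.-integrable `]0, +oo[
    (EFin \o (fun s => wgt k s * (expsin chi (A s) (v * s `^ beta) - sin (A s)))).
Proof.
move=> k0 v0 chi0 mA.
apply: (@open_integrable_le _ _ _ (fun s => v * wgt (k + beta) s)).
- exact: interval_open.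
- exact: measurable_expsin_integrand.
- move=> s; rewrite in_itv0y => s0; rewrite wgtD// normrM ger0_norm ?wgt_ge0//.
  rewrite mulrA mulrC ler_wpM2r ?wgt_ge0// expsinB0_le//.
  by rewrite mulr_ge0 ?powR_ge0.
- by apply/integrableZ0y/wgt_integrable; rewrite ltr_wpDl.
Qed.

(** The Taylor remainder integrates to at most [2 ^- N] times an integral that does not depend on
    [N]. *)
Lemma expsin_integral_series k A chi v : 0 <= k -> 0 <= v -> cos chi <= 0 ->
  measurable_fun setT A ->
  (\sum_(n < N) v ^+ n.+1 / n.+1`!%:R *
    \int[mu]_(s in `]0, +oo[) (wgt (k + beta * n.+1%:R) s * sin (A s - n.+1%:R * chi)))
  @[N --> \oo] --> expsin_integral k A chi v.
Proof.
move=> k0 v0 chi0 mA.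
(* With [y = v * s ^ beta], the coefficient 3 adds [expR y] from the Taylor bound and [expR (2 * y)]
   from the factorial bound; [beta < 1] makes the result integrable against [expR (- (c * s))]. *)
pose M := \int[mu]_(s in `]0, +oo[) (v * (wgt k s * (s `^ beta * expR (3 * v * s `^ beta)))).
have Mi := integrableZ0y v (@wgt_expR_integrable k beta (3 * v) k0 beta0 (mulr_ge0 (ler0n _ 3) v0)).
have key N : `|expsin_integral k A chi v - \sum_(n < N) v ^+ n.+1 / n.+1`!%:R *
    \int[mu]_(s in `]0, +oo[) (wgt (k + beta * n.+1%:R) s * sin (A s - n.+1%:R * chi))| <=
    2 ^- N * M.
  rewrite sum_wgt_integral//.
  have dE s : wgt k s * (expsin chi (A s) (v * s `^ beta) - sin (A s)) -
      wgt k s * (\sum_(n < N) (v * s `^ beta) ^+ n.+1 / n.+1`!%:R * sin (A s - n.+1%:R * chi)) =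
    wgt k s * (expsin chi (A s) (v * s `^ beta) -
      \sum_(n < N.+1) (v * s `^ beta) ^+ n / n`!%:R * sin (A s - n%:R * chi)).
    rewrite -mulrBr big_ord_recl/= expr0 fact0 divr1 mul1r mul0r subr0.
    by rewrite opprD addrA.
  have dle s : 0 < s -> `|wgt k s * (expsin chi (A s) (v * s `^ beta) -
      \sum_(n < N.+1) (v * s `^ beta) ^+ n / n`!%:R * sin (A s - n%:R * chi))| <=
      2 ^- N * (v * (wgt k s * (s `^ beta * expR (3 * v * s `^ beta)))).
    move=> s0; have y0 : 0 <= v * s `^ beta by rewrite mulr_ge0 ?powR_ge0.
    rewrite normrM ger0_norm ?wgt_ge0//.
    have h := le_trans (expsin_taylor (A s) chi N.+1 y0)
      (ler_wpM2l (expR_ge0 _) (pow_factS_le N y0)).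
    apply: le_trans (ler_wpM2l (wgt_ge0 _ _) h) _.
    rewrite (_ : 3 * v * s `^ beta = v * s `^ beta + 2 * (v * s `^ beta)); last by ring.
    by rewrite expRD le_eqVlt; apply/orP; left; apply/eqP; ring.
  have mS (D : set R) : measurable_fun D (fun s => wgt k s * (expsin chi (A s) (v * s `^ beta) -
      \sum_(n < N.+1) (v * s `^ beta) ^+ n / n`!%:R * sin (A s - n%:R * chi))).
    apply: measurable_funTS; apply: measurable_funM; first exact: measurable_wgt.
    apply: measurable_funB; first by rewrite /expsin; meas.
    by apply: measurable_sum => n; meas.
  rewrite /expsin_integral -RintegralB//.
  - rewrite (@eq_Rintegral0y _ _ _ (fun s _ => dE s)) /M -RintegralZl//.
    by apply: normr_Rintegral0y_le => //; exact: integrableZ0y.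
  - exact: expsin_integrable.
  - have Ei := @expsin_integrable k A chi v k0 v0 chi0 mA.
    have Si := integrableZ0y (2 ^- N) Mi.
    have {}Si : mu.-integrable `]0, +oo[ (EFin \o (fun s => wgt k s *
        (expsin chi (A s) (v * s `^ beta) -
         \sum_(n < N.+1) (v * s `^ beta) ^+ n / n`!%:R * sin (A s - n%:R * chi)))).
      apply: (@open_integrable_le _ _ _ _ _ _ _ Si).
      + exact: interval_open.
      + exact: mS.
      + by move=> s; rewrite in_itv0y; exact: dle.
    apply: eq_integrable0y (integrableB0y Ei Si) => s _.
    by rewrite -dE opprB addrCA subrr addr0.
have h0 : 2 ^- N * M @[N --> \oo] --> (0 : R).
  rewrite -[X in _ --> X](mul0r M); apply: cvgMl.
  have -> : (fun N : nat => 2 ^- N : R) = (fun N => 2^-1 ^+ N).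
    by apply/funext => N; rewrite exprVn.
  by apply: cvg_expr; rewrite ger0_norm; lra.
apply/cvgrPdist_le => e e0; near=> N.
apply: le_trans (key N) _.
by apply: le_trans (ler_norm _) _; near: N; move/cvgr0_norm_le : h0; exact.
Unshelve. all: by end_near. Qed.

End interchange.

(** * Euler's integral on a rotated ray *)

Section rotated_Gamma.
Context {R : realType}.
Notation mu := (@lebesgue_measure R).
Implicit Types (p th B s : R).

(** The rotation identity with [b = v = 1]; for [p > 0] there is no boundary term and both integrals
    converge separately. *)
Lemma Gam_rotated p th B : 0 < p -> `|th| < pi / 2 ->
  \int[mu]_(s in `]0, +oo[) (wgt (cos th) p s * sin (B + p * th - s * sin th)) =
  Gam p * sin B.
Proof.
move=> p0 hth; have /andP[c0 _] := cos_ge_abs (lexx `|th|) hth.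
have rE t s : 0 < s -> rot 1 1 p B t s =
    wgt (cos t) p s * sin (B + p * t - s * sin t).
  move=> s0; rewrite /rot /rot_phase /wgt !mul1r powRr1; last exact: ltW.
  by rewrite (mulrC s (cos t)).
have i1 : mu.-integrable `]0, +oo[ (EFin \o rot 1 1 p B th).
  apply: (@open_integrable_le _ _ _ (wgt (cos th) p)).
  - exact: interval_open.
  - by apply: measurable_funTS; rewrite /rot /rot_phase; meas.
  - move=> s; rewrite in_itv0y => s0; rewrite rE// normrM (ger0_norm (wgt_ge0 _ _ _)).
    by rewrite ler_piMr ?wgt_ge0// sin_max.
  - exact: wgt_integrable.
have r0E s : 0 < s -> rot 1 1 p B 0 s = s `^ (p - 1) * expR (- s) * sin B.
  by move=> s0; rewrite rE// /wgt cos0 sin0 !mulr0 addr0 subr0 mul1r.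
have ig := integrableZ0y (sin B) (integrable_Gam p0).
have i2 : mu.-integrable `]0, +oo[ (EFin \o rot 1 1 p B 0).
  by apply: eq_integrable0y ig => s s0; rewrite r0E// mulrC.
have := @rotation R 1 1 p B ltr01 ltr01 (ltW p0) th hth.
rewrite gt_eqF// mulr0 RintegralB// => /eqP; rewrite subr_eq0 => /eqP h.
rewrite -(@eq_Rintegral0y _ _ _ (rE th)) h mulrC /Gam -RintegralZl//; last exact: integrable_Gam.
by apply: eq_Rintegral0y => s s0; rewrite r0E// mulrC.
Qed.

End rotated_Gamma.

(** * Wright series on a ray *)

Section ray_functions.
Context {R : realType}.
Notation mu := (@lebesgue_measure R).
Variables (beta psi dl : R).
Hypotheses (beta0 : 0 < beta) (beta13 : 3 * beta < 1).
Hypotheses (psi_le : psi <= pi) (psi_ge : 2 * pi / 3 <= psi).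
Implicit Types (k v s a chi : R).

(* For this angle both gam + pi - psi and gam - pi + psi lie in
   ]- pi / 2, pi / 2[, uniformly in psi; this is where 3 * beta < 1 is used. *)
Let th : R := pi / 3 + pi * beta / 2.
Let gam : R := beta * (pi - th).
Let c : R := cos th.
(** A common decay rate: [vt1] and [vt2] below are at most [gam + pi / 3] in absolute value, so [m]
    bounds their cosines from below. *)
Let m : R := cos (gam + pi / 3).
Let A k a s : R := k * th - s * sin th + a.
Let J k v chi a := expsin_integral beta c k (A k a) chi v.

Let p0 : 0 < pi :> R. Proof. exact: pi_gt0. Qed.

Let beta01 : 0 < beta < 1. Proof. by have := beta13; have := beta0 => ? ?; apply/andP; split; lra. Qed.

Let hth : `|th| < pi / 2.
Proof.
have h1 : 0 < pi * beta by rewrite mulr_gt0.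
have h2 : pi * (3 * beta) < pi by rewrite -[ltRHS]mulr1 ltr_pM2l.
by rewrite /th gtr0_norm; lra.
Qed.

Let c0 : 0 < c.
Proof. by have /andP[] := cos_ge_abs (lexx `|th|) hth. Qed.

Let gam_gt0 : 0 < gam.
Proof. by rewrite /gam mulr_gt0//; move: hth; have := p0; rewrite ltr_norml => ? /andP[_ ?]; lra. Qed.

Let gam_lt : gam < pi / 6.
Proof.
rewrite -subr_gt0.
have -> : pi / 6 - gam = pi / 6 * ((1 - 3 * beta) * (1 - beta)) by rewrite /gam /th; field.
by have := beta13; have := beta0 => ? ?; rewrite !mulr_gt0//; lra.
Qed.

Let hgam : `|gam + pi / 3| < pi / 2.
Proof. by have := gam_gt0; have := gam_lt; have := p0 => ? ? ?; rewrite gtr0_norm; lra. Qed.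

Let m0 : 0 < m.
Proof. by have /andP[] := cos_ge_abs (lexx _) hgam. Qed.

(** The directions [gam - psi] and, in [vt2], [gam + psi], measured from the negative real axis;
    below [pi / 2] the exponentials decay. *)
Let vt1 : R := gam + pi - psi.
Let vt2 : R := gam - pi + psi.

Let vt_le x : x = vt1 \/ x = vt2 -> `|x| < pi / 2 /\ m <= cos x.
Proof.
move=> hx; have xle : `|x| <= `|gam + pi / 3|.
  have g0 := gam_gt0; have := p0 => ?; rewrite (@ger0_norm _ (gam + pi / 3)); last lra.
  have := psi_le; have := psi_ge => ? ?.
  by rewrite ler_norml; case: hx => ->; rewrite /vt1 /vt2; apply/andP; split; lra.
by have /andP[_] := cos_ge_abs xle hgam; split=> //; exact: le_lt_trans hgam.
Qed.

Let chi1E : cos (gam - psi) = - cos vt1 /\ sin (gam - psi) = - sin vt1.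
Proof.
rewrite /vt1 addrAC; split.
  by rewrite (@cosDpi R (gam - psi)) opprK.
by rewrite (@sinDpi R (gam - psi)) opprK.
Qed.

Let chi2E : cos (gam + psi) = - cos vt2 /\ sin (gam + psi) = - sin vt2.
Proof.
have -> : gam + psi = vt2 + pi by rewrite /vt2; ring.
by split; [exact: cosDpi|exact: sinDpi].
Qed.

Let mA k a : measurable_fun setT (A k a).
Proof. by rewrite /A; meas. Qed.

(* [J k] is half the integral representation of the Wright series on a ray. *)
Definition ray_sum k v := (J k v (gam - psi) dl + J k v (gam + psi) (- dl)) / 2.

(** The product of sine and cosine splits into sin(X + Y) and sin(X - Y), one for each [J]. Rotating
    Gamma adds [beta * n * th] to the phase [- pi * beta * n], which leaves [- n * gam]. *)
Lemma ray_sum_series k v : 0 <= k -> 0 <= v ->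
  (\sum_(n < N) v ^+ n.+1 / n.+1`!%:R * (Gam (k + beta * n.+1%:R) *
    sin (- (pi * beta * n.+1%:R)) * cos (dl + n.+1%:R * psi)))
  @[N --> \oo] --> ray_sum k v.
Proof.
move=> k0 v0.
have chi1 : cos (gam - psi) <= 0.
  have [-> _] := chi1E; rewrite oppr_le0.
  by have [_ /(le_trans (ltW m0))] := vt_le (or_introl erefl).
have chi2 : cos (gam + psi) <= 0.
  have [-> _] := chi2E; rewrite oppr_le0.
  by have [_ /(le_trans (ltW m0))] := vt_le (or_intror erefl).
have h1 := expsin_integral_series beta01 c0 k0 v0 chi1 (mA k dl).
have h2 := expsin_integral_series beta01 c0 k0 v0 chi2 (mA k (- dl)).
set F1 := (X in X @ _ --> _) in h1; set F2 := (X in X @ _ --> _) in h2.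
suff -> : (fun N => \sum_(n < N) v ^+ n.+1 / n.+1`!%:R * (Gam (k + beta * n.+1%:R) *
    sin (- (pi * beta * n.+1%:R)) * cos (dl + n.+1%:R * psi))) =
    fun N => (F1 N + F2 N) / 2.
  by apply: cvgMl; exact: cvgD h1 h2.
rewrite /F1 /F2.
apply/funext => N /=; rewrite -big_split/= mulr_suml; apply: eq_bigr => n _.
rewrite -mulrDr -(mulrA (v ^+ n.+1 / n.+1`!%:R)); congr (_ * _).
have q0 : 0 < k + beta * n.+1%:R by rewrite ltr_wpDl// mulr_gt0.
have wi := @wgt_integrable R c c0 _ q0.
have si (f : R -> R) : measurable_fun setT f -> mu.-integrable `]0, +oo[
    (EFin \o (fun s => wgt c (k + beta * n.+1%:R) s * sin (f s))).
  move=> mf; apply: (@open_integrable_le _ _ _ (wgt c (k + beta * n.+1%:R))) => //.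
  - apply: measurable_funM; first exact: measurable_wgt.
    by apply: measurable_funTS; meas.
  - by move=> s _; rewrite normrM ger0_norm ?wgt_ge0// ler_piMr ?wgt_ge0// sin_max.
rewrite -(@Gam_rotated R (k + beta * n.+1%:R) th)//.
rewrite -RintegralD//; last 2 first.
  by apply: si; rewrite /A; meas.
  by apply: si; rewrite /A; meas.
rewrite -/c -RintegralZr//; last by apply: si; meas.
rewrite -RintegralZr//; last first.
  apply: integrableD0y; by apply: si; rewrite /A; meas.
apply: eq_Rintegral0y => s _; rewrite /A.
set X := - (pi * beta * n.+1%:R) + (k + beta * n.+1%:R) * th - s * sin th.
set Y := dl + n.+1%:R * psi.
have -> : k * th - s * sin th + dl - n.+1%:R * (gam - psi) = X + Y.
  by rewrite /X /Y /gam; ring.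
have -> : k * th - s * sin th - dl - n.+1%:R * (gam + psi) = X - Y.
  by rewrite /X /Y /gam; ring.
by rewrite (sinD X Y) (sinB X Y); field.
Qed.

Let J_le k v chi a : 0 <= k -> 0 <= v -> cos chi <= 0 ->
  `|J k v chi a| <= v * \int[mu]_(s in `]0, +oo[) wgt c (k + beta) s.
Proof.
move=> k0 v0 chi0.
have q0 : 0 < k + beta by rewrite ltr_wpDl.
have wi := @wgt_integrable R c c0 _ q0.
rewrite -RintegralZl//; apply: normr_Rintegral0y_le.
- exact: measurable_expsin_integrand.
- exact: integrableZ0y.
- move=> s s0; rewrite wgtD// normrM (ger0_norm (wgt_ge0 _ _ _)) mulrA mulrC.
  rewrite ler_wpM2r ?wgt_ge0// expsinB0_le//.
  by rewrite mulr_ge0 ?powR_ge0.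
Qed.

Lemma ray_sum_le : exists C, forall k v, 0 <= v -> k = 1 -> `|ray_sum k v| <= C * v.
Proof.
pose M := \int[mu]_(s in `]0, +oo[) wgt c (1 + beta) s.
exists M => k v v0 ->.
have chi1 : cos (gam - psi) <= 0.
  have [-> _] := chi1E; rewrite oppr_le0.
  by have [_ /(le_trans (ltW m0))] := vt_le (or_introl erefl).
have chi2 : cos (gam + psi) <= 0.
  have [-> _] := chi2E; rewrite oppr_le0.
  by have [_ /(le_trans (ltW m0))] := vt_le (or_intror erefl).
have h1 := J_le dl ler01 v0 chi1; have h2 := J_le (- dl) ler01 v0 chi2.
rewrite /ray_sum normrM (@ger0_norm _ 2^-1)// ler_pdivrMr//.
rewrite (le_trans (ler_normD _ _))// (le_trans (lerD h1 h2))//.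
by rewrite -/M; lra.
Qed.

Let expsin_le chi vt a y : cos chi = - cos vt -> m <= cos vt -> 0 <= y ->
  `|expsin chi a y| <= expR (- (m * y)).
Proof.
move=> cE mvt y0; rewrite /expsin cE normrM ger0_norm ?expR_ge0//.
rewrite -[leRHS]mulr1 ler_pM ?expR_ge0 ?sin_max//.
by rewrite ler_expR mulrN lerN2 [leRHS]mulrC ler_wpM2r.
Qed.

(** The exponential part is at most of order 1 / v, by exp(- y) <= 1 / y; the subtracted sine
    integrates to exactly [Gam 1 * sin a] by rotation. *)
Let J1E v chi vt a : 0 < v -> cos chi = - cos vt -> m <= cos vt ->
  exists2 I, `|I| <= (m * v)^-1 * \int[mu]_(s in `]0, +oo[) wgt c (1 - beta) s &
    J 1 v chi a = I - sin a.
Proof.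
move=> v0 cE mvt.
have b1 : 0 < 1 - beta by rewrite subr_gt0; case/andP: beta01.
have wi := @wgt_integrable R c c0 _ b1.
have wi1 := @wgt_integrable R c c0 1 ltr01.
exists (\int[mu]_(s in `]0, +oo[) (wgt c 1 s * expsin chi (A 1 a s) (v * s `^ beta))).
  rewrite -RintegralZl//; apply: normr_Rintegral0y_le.
  - by apply: measurable_funTS; rewrite /wgt /expsin /A; meas.
  - exact: integrableZ0y.
  - move=> s s0; rewrite normrM (ger0_norm (wgt_ge0 _ _ _)).
    have y0 : 0 < v * s `^ beta by rewrite mulr_gt0// powR_gt0.
    rewrite wgtD// powRN mulrA mulrC ler_wpM2r ?wgt_ge0//.
    apply: le_trans (expsin_le (A 1 a s) cE mvt (ltW y0)) _.
    by rewrite -invfM -mulrA; apply: expRN_le_inv; rewrite mulr_gt0.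
have gE : \int[mu]_(s in `]0, +oo[) (wgt c 1 s * sin (A 1 a s)) = sin a.
  transitivity (Gam 1 * sin a); last by rewrite Gam1 mul1r.
  rewrite -(@Gam_rotated R 1 th a ltr01 hth).
  by apply: eq_Rintegral0y => s _; congr (_ * sin _); rewrite /A; ring.
have bd (f : R -> R) : measurable_fun setT f -> (forall s, 0 < s -> `|f s| <= 1) ->
    mu.-integrable `]0, +oo[ (EFin \o (fun s => wgt c 1 s * f s)).
  move=> mf f1; apply: (@open_integrable_le _ _ _ (wgt c 1)) => //.
  - apply: measurable_funM; first exact: measurable_wgt.
    exact: measurable_funTS.
  - move=> s; rewrite in_itv0y => s0.
    by rewrite normrM ger0_norm ?wgt_ge0// ler_piMr ?wgt_ge0// f1.
rewrite -gE -RintegralB//.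
- by apply: eq_Rintegral0y => s _; rewrite mulrBr.
- apply: bd; first by rewrite /expsin /A; meas.
  move=> s s0; have y0 : 0 <= v * s `^ beta by rewrite mulr_ge0 ?powR_ge0// ltW.
  apply: le_trans (expsin_le _ cE mvt y0) _.
  by rewrite -expR0 ler_expR oppr_le0 mulr_ge0// ltW.
- by apply: bd; [rewrite /A; meas|move=> s _; exact: sin_max].
Qed.

(** The constants left by the two halves are [sin dl] and [sin (- dl)]; they cancel. *)
Lemma ray_sum1_decay : exists C, forall v, 0 < v -> `|ray_sum 1 v| <= C / v.
Proof.
pose M := \int[mu]_(s in `]0, +oo[) wgt c (1 - beta) s.
exists (m^-1 * M) => v v0.
have [I1 h1 E1] := J1E dl v0 chi1E.1 (vt_le (or_introl erefl)).2.
have [I2 h2 E2] := J1E (- dl) v0 chi2E.1 (vt_le (or_intror erefl)).2.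
rewrite /ray_sum E1 E2 sinN.
have -> : I1 - sin dl + (I2 - - sin dl) = I1 + I2 by ring.
rewrite normrM (@ger0_norm _ 2^-1)// ler_pdivrMr//.
rewrite (le_trans (ler_normD _ _))// (le_trans (lerD h1 h2))//.
rewrite -/M invfM le_eqVlt; apply/orP; left; apply/eqP; ring.
Qed.

(** For [k = 0] the exponential part and the subtracted sine can each have a pole at [s = 0].
    [Delta] is the exponential part minus the same with the factor exp(- s e^(i th)) replaced by 1;
    its bracket is at most [2 * s], which removes the pole. *)
Let Delta v vt a s := s `^ (-1) * expR (- (v * s `^ beta * cos vt)) *
  (expR (- (c * s)) * sin (a - s * sin th + v * s `^ beta * sin vt) -
   sin (a + v * s `^ beta * sin vt)).

Let Delta_le v vt a s : 0 < s -> 0 < v -> m <= cos vt ->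
  `|Delta v vt a s| <= 2 * expR (- (m * v * s `^ beta)).
Proof.
move=> s0 v0 mvt; rewrite /Delta powR_inv1 ?(ltW s0)//.
set y := v * s `^ beta; have y0 : 0 < y by rewrite mulr_gt0// powR_gt0.
have c1 : c <= 1 by exact: cos_le1.
rewrite !normrM (ger0_norm (expR_ge0 _)) (@ger0_norm _ s^-1) ?invr_ge0 ?(ltW s0)//.
have h1 : expR (- (y * cos vt)) <= expR (- (m * v * s `^ beta)).
  by rewrite ler_expR lerN2 -mulrA mulrC ler_wpM2l ?(ltW y0).
have h2 : `|expR (- (c * s)) * sin (a - s * sin th + y * sin vt) - sin (a + y * sin vt)| <= 2 * s.
  set X := sin (a - _ + _); set Y := sin (a + _).
  have -> : expR (- (c * s)) * X - Y = (expR (- (c * s)) - 1) * X + (X - Y) by ring.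
  have k1 : `|(expR (- (c * s)) - 1) * X| <= s.
    rewrite normrM -[leRHS]mulr1 ler_pM ?sin_max//.
    have e1 : expR (- (c * s)) <= 1.
      by rewrite -expR0 ler_expR oppr_le0 mulr_ge0// ?(ltW c0)// ltW.
    have := expR_ge1Dx (- (c * s)).
    have : c * s <= s by rewrite ler_piMl// ltW.
    by rewrite ler0_norm ?subr_le0//; lra.
  have k2 : `|X - Y| <= s.
    have := normr_sinB_le (a + y * sin vt) (- (s * sin th)).
    rewrite -/Y (_ : a + y * sin vt - s * sin th = a - s * sin th + y * sin vt); last by ring.
    move=> /le_trans; apply; rewrite normrN normrM (ger0_norm (ltW s0)).
    by rewrite ler_piMr ?sin_max// ltW.
  by rewrite (le_trans (ler_normD _ _))//; lra.
have := ler_pM (mulr_ge0 (ltW (_ : 0 < s^-1)) (expR_ge0 _)) (normr_ge0 _)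
  (ler_wpM2l (ltW (_ : 0 < s^-1)) h1) h2.
rewrite invr_gt0 => /(_ s0 s0) /le_trans; apply.
by rewrite le_eqVlt; apply/orP; left; apply/eqP; field; rewrite gt_eqF.
Qed.

Let measurable_Delta v vt a (D : set R) : measurable_fun D (Delta v vt a).
Proof.
by apply: measurable_funTS; rewrite /Delta; meas.
Qed.

Let Delta_integrable v vt a : 0 < v -> m <= cos vt ->
  mu.-integrable `]0, +oo[ (EFin \o Delta v vt a).
Proof.
move=> v0 mvt; apply: (@integrable_le_powR_expRN _ _ 2 1 beta (m * v)) => //.
- by rewrite mulr_gt0.
- by move=> s s0; rewrite subrr powRr0 mul1r; exact: Delta_le.
Qed.

(** Each integrand is [Delta], minus two rotation differences, plus [sin a] times a Frullani
    integrand. The last is odd in [a] and cancels between [dl] and [- dl]. The rotations contribute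
    (vt1 + vt2) / beta + 2 th = 2 gam / beta + 2 th = 2 pi, times [cos dl]. *)
Let J0E v : 0 < v -> J 0 v (gam - psi) dl + J 0 v (gam + psi) (- dl) =
  2 * pi * cos dl + \int[mu]_(s in `]0, +oo[) (Delta v vt1 dl s + Delta v vt2 (- dl) s).
Proof.
move=> v0; have [hv1 m1] := vt_le (or_introl erefl); have [hv2 m2] := vt_le (or_intror erefl).
have chi1 : cos (gam - psi) <= 0 by have [-> _] := chi1E; rewrite oppr_le0 (le_trans (ltW m0)).
have chi2 : cos (gam + psi) <= 0 by have [-> _] := chi2E; rewrite oppr_le0 (le_trans (ltW m0)).
pose r1 vt a s := rot beta v 0 (- a) vt s - rot beta v 0 (- a) 0 s.
pose r2 a s := rot 1 1 0 a th s - rot 1 1 0 a 0 s.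
have r1i vt a : `|vt| < pi / 2 -> mu.-integrable `]0, +oo[ (EFin \o r1 vt a).
  by move=> hvt; exact: rotB_integrable.
have r2i a : mu.-integrable `]0, +oo[ (EFin \o r2 a) by exact: rotB_integrable.
have r1E vt a : `|vt| < pi / 2 -> \int[mu]_(s in `]0, +oo[) r1 vt a s = - vt * (beta^-1 * cos a).
  by move=> hvt; rewrite /r1 rotation// eqxx cosN.
have r2E a : \int[mu]_(s in `]0, +oo[) r2 a s = - th * cos a.
  by rewrite /r2 rotation// eqxx invr1 mul1r.
have ptw chi vt a s : 0 < s -> cos chi = - cos vt -> sin chi = - sin vt ->
    wgt c 0 s * (expsin chi (A 0 a s) (v * s `^ beta) - sin (A 0 a s)) =
    Delta v vt a s - r1 vt a s - r2 a s +
    s `^ (-1) * (expR (- (v * s `^ beta)) - expR (- s)) * sin a.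
  move=> s0 cE sE; rewrite /Delta /r1 /r2 /rot /rot_phase /wgt /expsin /A cE sE.
  rewrite !(mulr0, mul0r, add0r, mul1r, subr0, sub0r, addr0, cos0, sin0, mulr1).
  rewrite powRr1 ?(ltW s0)// -/c !mulrN !opprK sinN.
  rewrite (_ : - a - v * s `^ beta * sin vt = - (a + v * s `^ beta * sin vt)); last by ring.
  rewrite (mulrC s c) sinN (_ : - (s * sin th) + a = a - s * sin th); last by ring.
  by ring.
have i1 := @expsin_integrable R beta c beta01 c0 0 (A 0 dl) (gam - psi) v (lexx _) (ltW v0) chi1 (mA 0 dl).
have i2 := @expsin_integrable R beta c beta01 c0 0 (A 0 (- dl)) (gam + psi) v (lexx _) (ltW v0) chi2 (mA 0 (- dl)).
have D1 := Delta_integrable dl v0 m1; have D2 := Delta_integrable (- dl) v0 m2.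
rewrite /J /expsin_integral -RintegralD//.
transitivity (\int[mu]_(s in `]0, +oo[) ((Delta v vt1 dl s + Delta v vt2 (- dl) s) -
   (r1 vt1 dl s + r1 vt2 (- dl) s) - (r2 dl s + r2 (- dl) s))).
  apply: eq_Rintegral0y => s s0.
  rewrite (ptw _ vt1 dl)//; [|exact: chi1E.1|exact: chi1E.2].
  rewrite (ptw _ vt2 (- dl))//; [|exact: chi2E.1|exact: chi2E.2].
  by rewrite sinN; ring.
have I1 := integrableD0y D1 D2.
have I2 := integrableD0y (r1i vt1 dl hv1) (r1i vt2 (- dl) hv2).
have I3 := integrableD0y (r2i dl) (r2i (- dl)).
rewrite RintegralB//; last exact: integrableB0y.
rewrite RintegralB// (RintegralD _ (r1i _ _ hv1) (r1i _ _ hv2))// (RintegralD _ (r2i _) (r2i _))//.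
rewrite !r1E// !r2E cosN /vt1 /vt2 /gam.
move: (\int[mu]_(s in _) _) => I; by field; rewrite gt_eqF.
Qed.

Lemma ray_sum0_decay : exists C, forall v, 1 <= v -> `|cos dl - ray_sum 0 v / pi| <= C / v.
Proof.
have b1 : 0 < 1 - beta by rewrite subr_gt0; case/andP: beta01.
have m20 : 0 < m / 2 by rewrite divr_gt0.
have Ki := integrable_powR_expRN b1 beta0 m20.
pose K := \int[mu]_(s in `]0, +oo[) (s `^ (1 - beta - 1) * expR (- (m / 2 * s `^ beta))).
exists ((2 * pi)^-1 * (8 / m * K)) => v v1; have v0 : 0 < v by exact: lt_le_trans v1.
have [hv1 m1] := vt_le (or_introl erefl); have [hv2 m2] := vt_le (or_intror erefl).
rewrite /ray_sum J0E//.
set I := \int[mu]_(s in _) _.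
have -> : cos dl - (2 * pi * cos dl + I) / 2 / pi = - ((2 * pi)^-1 * I).
  by move: (pi : R) p0 => p pp; field; rewrite gt_eqF.
rewrite normrN normrM ger0_norm ?invr_ge0 ?mulr_ge0 ?(ltW p0)// -mulrA.
rewrite ler_wpM2l ?invr_ge0 ?mulr_ge0 ?(ltW p0)//.
have -> : 8 / m * K / v = (8 / m / v) * K by ring.
rewrite /K -RintegralZl//; apply: normr_Rintegral0y_le.
- by apply: measurable_funD; exact: measurable_Delta.
- exact: integrableZ0y.
- move=> s s0.
  have h1 := Delta_le dl s0 v0 m1; have h2 := Delta_le (- dl) s0 v0 m2.
  apply: le_trans (ler_normD _ _) _; apply: le_trans (lerD h1 h2) _.
  have sb0 : 0 < s `^ beta by exact: powR_gt0.
  (* One half of the exponent, with [v] lowered to 1, provides integrability; the other half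
     provides the factor 1 / v. *)
  have -> : m * v * s `^ beta = m / 2 * v * s `^ beta + m / 2 * v * s `^ beta by field.
  rewrite opprD expRD.
  have e1 : expR (- (m / 2 * v * s `^ beta)) <= expR (- (m / 2 * s `^ beta)).
    by rewrite ler_expR lerN2 ler_wpM2r ?(ltW sb0)// ler_peMr// ltW.
  have e2 : expR (- (m / 2 * v * s `^ beta)) <= (m / 2 * v * s `^ beta)^-1.
    by apply: expRN_le_inv; rewrite !mulr_gt0.
  have -> : s `^ (1 - beta - 1) = (s `^ beta)^-1.
    by rewrite -powRN; congr (_ `^ _); ring.
  have := ler_pM (expR_ge0 _) (expR_ge0 _) e2 e1.
  move: (expR (- (m / 2 * s `^ beta))) => E2.
  move: (expR (- (m / 2 * v * s `^ beta))) => E1 h.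
  have -> : 8 / m / v * ((s `^ beta)^-1 * E2) = 4 * ((m / 2 * v * s `^ beta)^-1 * E2).
    by field; rewrite !gt_eqF.
  by lra.
Qed.

End ray_functions.

(** * Power series with infinite radius of convergence *)

Section entire_series.
Context {R : realType}.
Implicit Types (c e : R ^nat) (K x v C M q beta : R) (n : nat).

(** Equivalent to an infinite radius of convergence, in a form that passes directly to dominated
    coefficients and to differentiated series. *)
Definition rapid_decay c := forall K, 0 < K -> exists M, forall n, `|c n| * K ^+ n <= M.

Lemma rapid_decay_cvg c x : rapid_decay c -> cvgn (pseries c x).
Proof.
(* The factor 2 yields a geometric majorant of ratio 1 / 2; the added 1 keeps the radius positive at
   [x = 0]. *)
move=> rc; have K0 : 0 < 2 * (`|x| + 1) by rewrite mulr_gt0// ltr_pwDr.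
have [M cM] := rc _ K0; have M0 : 0 <= M.
  by apply: le_trans (cM 0%N); rewrite mulr_ge0// exprn_ge0// ltW.
apply: normed_cvg; apply: (@series_le_cvg _ _ (geometric M 2^-1)).
- by move=> n /=; exact: normr_ge0.
- by move=> n; rewrite mulr_ge0// exprn_ge0.
- move=> n /=; rewrite normrM normrX exprVn ler_pdivlMr ?exprn_gt0//.
  apply: le_trans (cM n); rewrite -mulrA ler_wpM2l// mulrC exprMn ler_wpM2l ?exprn_ge0//.
  by rewrite lerXn2r ?nnegrE ?addr_ge0// lerDl.
- by apply: is_cvg_geometric_series; rewrite ger0_norm; lra.
Qed.

Lemma rapid_decay_diffs c : rapid_decay c -> rapid_decay (pseries_diffs c).
Proof.
(* Doubling the radius absorbs the factor n + 1 of the derivative, since n + 1 <= 2^(n+1). *)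
move=> rc K K0; have K20 : 0 < 2 * K by rewrite mulr_gt0.
have [M cM] := rc _ K20; exists (M / K) => n.
rewrite ler_pdivlMr//; apply: le_trans (cM n.+1).
rewrite /pseries_diffs normrM (ger0_norm (ler0n _ _)).
rewrite [leLHS](_ : _ = `|c n.+1| * (n.+1%:R * K ^+ n.+1)); last by rewrite exprSr; ring.
rewrite ler_wpM2l// exprMn ler_wpM2r ?exprn_ge0 ?(ltW K0)//.
by rewrite -natrX ler_nat ltnW// ltn_expl.
Qed.

Lemma rapid_decay_is_derive c x : rapid_decay c ->
  is_derive x 1 (fun y => limn (pseries c y)) (limn (pseries (pseries_diffs c) x)).
Proof.
move=> rc; apply: (@pseries_snd_diffs _ _ (`|x| + 1)).
- exact: rapid_decay_cvg.
- exact/rapid_decay_cvg/rapid_decay_diffs.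
- exact/rapid_decay_cvg/rapid_decay_diffs/rapid_decay_diffs.
- by rewrite [ltRHS]ger0_norm ?addr_ge0// ltrDl.
Qed.

Lemma rapid_decay_le c e C : rapid_decay c -> (forall n, `|e n| <= C * `|c n|) ->
  rapid_decay e.
Proof.
move=> rc ec K K0; have [M cM] := rc _ K0; exists (`|C| * M) => n.
apply: (@le_trans _ _ (`|C| * (`|c n| * K ^+ n))); last by rewrite ler_wpM2l.
rewrite mulrA ler_wpM2r ?exprn_ge0 ?(ltW K0)//.
by rewrite (le_trans (ec n))// ler_wpM2r// ler_norm.
Qed.

(** Under Euler's integral (K s^beta)^n / n! is at most exp(K s^beta), a bound independent of [n]
    and integrable against e^(- s) because [beta < 1]. *)
Lemma Gam_rapid_decay q beta : 0 < q -> 0 < beta < 1 ->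
  rapid_decay (fun n => Gam (q + beta * n%:R) / n`!%:R).
Proof.
move=> q0 b01 K K0; have b0 : 0 < beta by case/andP: b01.
have Wi := @wgt_expR_integrable R beta 1 b01 ltr01 0 q K (lexx _) q0 (ltW K0).
exists (\int[lebesgue_measure]_(s in `]0, +oo[) (wgt 1 0 s * (s `^ q * expR (K * s `^ beta)))).
move=> n; have qn0 : 0 < q + beta * n%:R by rewrite ltr_pwDl// mulr_ge0// ltW.
rewrite ger0_norm ?mulr_ge0 ?Gam_ge0 ?invr_ge0// -mulrA mulrC.
rewrite /Gam -RintegralZl//; last exact: integrable_Gam.
apply: le_Rintegral0y => //; first exact/integrableZ0y/integrable_Gam.
move=> s s0; have -> : s `^ (q + beta * n%:R - 1) * expR (- s) = wgt 1 (0 + q) s * s `^ (beta * n%:R).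
  rewrite /wgt add0r mul1r mulrAC; congr (_ * _); rewrite -powRDp//.
  by congr (_ `^ _); ring.
rewrite wgtD// powRrM powR_mulrn ?powR_ge0//.
have y0 : 0 <= K * s `^ beta by rewrite mulr_ge0 ?powR_ge0// ltW.
have h : (K * s `^ beta) ^+ n / n`!%:R <= expR (K * s `^ beta).
  case: n {qn0} => [|n]; first by rewrite expr0 fact0 divr1 -expR0 ler_expR.
  by apply: le_trans (expR_ge1Dxn n y0); rewrite lerDr.
have := ler_wpM2l (mulr_ge0 (wgt_ge0 1 0 s) (powR_ge0 s q)) h.
rewrite exprMn; congr (_ <= _); last by ring.
by ring.
Qed.

Lemma is_cvg_lim_combo (u1 u2 : R ^nat) (x1 x2 : R) : cvgn (series u1) -> cvgn (series u2) ->
  x1 * limn (series u1) + x2 * limn (series u2) =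
  limn (series (fun n => x1 * u1 n + x2 * u2 n)).
Proof.
move=> c1 c2; apply/esym/cvg_lim => //.
have -> : series (fun n => x1 * u1 n + x2 * u2 n) =
    (fun n => x1 * series u1 n + x2 * series u2 n).
  by apply/funext => n; rewrite /series/= !mulr_sumr -big_split.
by apply: cvgD; apply: cvgMr; [exact: c1|exact: c2].
Qed.

End entire_series.

(** * The reciprocal Gamma function on the real axis *)

Section reciprocal_Gamma.
Context {R : realType}.
Notation mu := (@lebesgue_measure R).
Local Open Scope complex_scope.
Implicit Types (x s : R) (n : nat).

(* 1 / Gamma by the reflection formula, hence also for x <= 0. *)
Definition recip_Gam x := Gam (1 - x) * sin (pi * x) / pi.

Lemma Gam_shift x n : 0 < x -> Gam (x + n%:R) = (\prod_(k < n) (x + k%:R)) * Gam x.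
Proof.
move=> x0; elim: n => [|n IHn]; first by rewrite big_ord0 addr0 mul1r.
rewrite big_ord_recr/= -natr1 addrA GamD1 ?IHn; first by ring.
by rewrite ltr_pwDl.
Qed.

Let pi_neq0 : pi != 0 :> R.
Proof. by rewrite gt_eqF// pi_gt0. Qed.

(** With [n] free, induction can move a negative [x] to [x + 1]. It ends at 0, where the first
    factor and the sine both vanish, or in ]0, 1[, where the reflection formula applies. *)
Lemma recip_Gam_prod x n : x < 1 -> 0 < x + n%:R ->
  (\prod_(k < n) (x + k%:R)) / Gam (x + n%:R) = recip_Gam x.
Proof.
have pos_case (y : R) m : 0 < y -> y < 1 ->
    (\prod_(k < m) (y + k%:R)) / Gam (y + m%:R) = recip_Gam y.
  move=> y0 y1; rewrite Gam_shift//.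
  have P0 : \prod_(k < m) (y + k%:R) != 0.
    by apply/prodf_neq0 => k _; rewrite gt_eqF// ltr_pwDl.
  have r : Gam y * Gam (1 - y) * sin (pi * y) = pi by apply: Gam_reflection; rewrite y0.
  have G0 : Gam y != 0.
    by apply/eqP => g0; move: r; rewrite g0 !mul0r => /eqP; rewrite eq_sym (negbTE pi_neq0).
  rewrite invfM mulrA divff// mul1r /recip_Gam; apply: (mulfI G0).
  by rewrite divff// !mulrA r divff.
elim: n x => [|n IHn] x x1.
  by rewrite addr0 => x0; rewrite -(pos_case x 0%N)// addr0.
move=> xn; have [x0|x0|x0] := ltgtP x 0; last 2 first.
- exact: pos_case.
- rewrite x0 /recip_Gam mulr0 sin0 mulr0 mul0r big_ord_recl/= addr0 !mul0r//.
have x1n : 0 < (x + 1) + n%:R by rewrite -addrA nat1r.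
have := IHn (x + 1) _ x1n => /(_ _).
have lt1 : x + 1 < 1 by rewrite gtrDr.
move=> /(_ lt1); rewrite -addrA nat1r => E.
rewrite big_ord_recl/= addr0.
have -> : \prod_(i < n) (x + (bump 0 i)%:R) = \prod_(k < n) (x + 1 + k%:R).
  by apply: eq_bigr => k _; rewrite /bump/= add1n -addrA nat1r.
rewrite -mulrA E /recip_Gam.
have -> : sin (pi * (x + 1)) = - sin (pi * x).
  by rewrite mulrDr mulr1; exact: sinDpi.
have -> : 1 - x = - x + 1 by rewrite addrC.
rewrite GamD1 ?oppr_gt0// (_ : 1 - (x + 1) = - x); last by ring.
by ring.
Qed.

Lemma Gamma_integral_real x : Gamma_integral x%:C = (Gam x)%:C.
Proof.
have E s : Gamma_integrand x%:C s = (expR ((x - 1) * ln s - s))%:C.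
  rewrite /Gamma_integrand /cexp.
  have -> : (x%:C - 1) * (ln s)%:C - s%:C = ((x - 1) * ln s - s)%:C.
    by rewrite rmorphB rmorphM rmorphB rmorph1.
  by rewrite /= cos0 sin0 mulr1 mulr0.
rewrite /Gamma_integral; congr (_ +i* _).
  apply: eq_Rintegral0y => s s0; rewrite E/= powRE// -expRD.
  by congr expR.
rewrite (@eq_Rintegral0y _ _ (fun=> 0)); last by move=> s s0; rewrite E.
by rewrite Rintegral_cst// mul0r.
Qed.

Lemma rGamma_real x : x < 1 -> rGamma x%:C = (recip_Gam x)%:C.
Proof.
move=> x1; rewrite /rGamma; cbv zeta.
set n := (_).+1.
have xn : 0 < x + n%:R by rewrite -ltrBlDl sub0r; exact: truncnS_gt.
have -> : x%:C + n%:R = (x + n%:R)%:C by rewrite rmorphD rmorph_nat.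
rewrite Gamma_integral_real -(recip_Gam_prod x1 xn) fmorph_div rmorph_prod.
congr (_ / _); apply: eq_bigr => k _.
by rewrite rmorphD rmorph_nat.
Qed.

End reciprocal_Gamma.

(** * The series f and g on a ray *)

Section ray_series.
Context {R : realType}.
Variables (beta psi dl : R).
Hypotheses (beta0 : 0 < beta) (beta13 : 3 * beta < 1).
Implicit Types (v C : R) (n : nat).

Definition wright0_coef n : R := recip_Gam (- (beta * n%:R)) / n`!%:R.

Definition wright0_ray v := limn (pseries (fun n => wright0_coef n * cos (dl + n%:R * psi)) v).

(** By reflection, cos(dl + n psi) / (n! Gamma(1 - beta n)): the Wright function with second
    parameter 1 on the ray. The case n = 0 is set apart because Gamma(beta n) has a pole there. *)
Let prim_coef n : R := if n is 0%N then cos dl else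
  - (Gam (beta * n%:R) * sin (- (pi * beta * n%:R)) / pi / n`!%:R) * cos (dl + n%:R * psi).

Definition wright1_ray v := limn (pseries prim_coef v).

Let b01 : 0 < beta < 1.
Proof. by have := beta13; have := beta0 => ? ?; apply/andP; split; lra. Qed.

Let p0 : 0 < pi :> R. Proof. exact: pi_gt0. Qed.

Let wright0_coefE n : wright0_coef n =
  Gam (1 + beta * n%:R) * sin (- (pi * beta * n%:R)) / pi / n`!%:R.
Proof. by rewrite /wright0_coef /recip_Gam opprK mulrN (mulrA pi). Qed.

Lemma wright0_rapid_decay (e : R ^nat) : (forall n, `|e n| <= 1) ->
  rapid_decay (fun n => wright0_coef n * e n).
Proof.
move=> e1; apply: (@rapid_decay_le _ _ _ pi^-1 (Gam_rapid_decay ltr01 b01)) => n.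
rewrite wright0_coefE !normrM (@ger0_norm _ pi^-1) ?invr_ge0 ?(ltW p0)//.
apply: le_trans (ler_piMr _ (e1 n)) _; first by rewrite !mulr_ge0 ?invr_ge0 ?(ltW p0).
by rewrite mulrA ler_wpM2r// (mulrC pi^-1) ler_wpM2r ?invr_ge0 ?(ltW p0)// ler_piMr// sin_max.
Qed.

Let prim_rapid_decay : rapid_decay prim_coef.
Proof.
have ib : 0 <= beta^-1 by rewrite invr_ge0 ltW.
have ip : 0 <= pi^-1 :> R by rewrite invr_ge0 ltW.
apply: (@rapid_decay_le _ _ _ (1 + pi^-1 * beta^-1) (Gam_rapid_decay ltr01 b01)) => -[|n].
  rewrite /= mulr0 addr0 Gam1 fact0 divr1 normr1 mulr1.
  by rewrite (le_trans (cos_max _))// lerDl mulr_ge0.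
have n0 : 0 < beta * n.+1%:R by rewrite mulr_gt0.
have GE : Gam (beta * n.+1%:R) <= beta^-1 * Gam (1 + beta * n.+1%:R).
  rewrite (addrC 1) GamD1// mulrA -mulrA mulrA mulrA mulVf ?gt_eqF// mul1r.
  by rewrite ler_peMl ?Gam_ge0// ler1n.
rewrite /prim_coef normrM normrN.
apply: (@le_trans _ _ (`|Gam (beta * n.+1%:R) * sin (- (pi * beta * n.+1%:R)) / pi / n.+1`!%:R| * 1)).
  by rewrite ler_wpM2l// cos_max.
rewrite mulr1 !normrM (ger0_norm (Gam_ge0 _)) (ger0_norm (Gam_ge0 _)) (ger0_norm ip).
rewrite (@ger0_norm _ (_^-1)) ?invr_ge0// mulrA ler_wpM2r ?invr_ge0//.
have h : Gam (beta * n.+1%:R) * `|sin (- (pi * beta * n.+1%:R))| <= beta^-1 * Gam (1 + beta * n.+1%:R).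
  by apply: le_trans GE; rewrite ler_piMr ?Gam_ge0// sin_max.
apply: le_trans (ler_wpM2r ip h) _.
rewrite mulrDl mul1r ler_wpDl ?Gam_ge0// le_eqVlt; apply/orP; left; apply/eqP; ring.
Qed.

Lemma is_derive_wright0_ray v :
  exists d, is_derive v (1 : R) wright0_ray d.
Proof.
eexists; apply: rapid_decay_is_derive; apply: wright0_rapid_decay => n.
exact: cos_max.
Qed.

Lemma is_derive_wright1_ray v :
  exists2 d, is_derive v 1 wright1_ray d & beta * v * d = - wright0_ray v.
Proof.
have rp := prim_rapid_decay.
exists (limn (pseries (pseries_diffs prim_coef) v)); first exact: rapid_decay_is_derive.
have c1 : cvgn (pseries (pseries_diffs prim_coef) v).
  exact/rapid_decay_cvg/rapid_decay_diffs.
have c2 : cvgn (pseries (fun n => wright0_coef n * cos (dl + n%:R * psi)) v).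
  by apply/rapid_decay_cvg/wright0_rapid_decay => n; exact: cos_max.
have h1 : beta * v * pseries (pseries_diffs prim_coef) v n @[n --> \oo] -->
    beta * v * limn (pseries (pseries_diffs prim_coef) v).
  by apply: cvgMr; exact: c1.
(* Multiplying the derivative by [v] shifts the index by one, and the coefficient of order 0 of f is
   0; hence [n.+1]. *)
have h2 : - pseries (fun n => wright0_coef n * cos (dl + n%:R * psi)) v n.+1
    @[n --> \oo] --> - wright0_ray v.
  by apply: cvgN; rewrite (cvg_shiftS (pseries _ v)); exact: c2.
apply: (cvg_unique _ h1) => //; move: h2.
rewrite (_ : (fun n => _) = (fun n => beta * v * pseries (pseries_diffs prim_coef) v n)) //.
apply/funext => n; rewrite /pseries /series/= !big_mkord big_ord_recl/=.
have -> : wright0_coef 0 = 0 by rewrite wright0_coefE !mulr0 oppr0 sin0 mulr0 !mul0r.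
rewrite !mul0r add0r mulr_sumr -sumrN; apply: eq_bigr => i _.
rewrite /bump/= add1n /pseries_diffs /prim_coef wright0_coefE.
have n0 : 0 < beta * i.+1%:R by rewrite mulr_gt0.
by rewrite (addrC 1) GamD1// exprS; ring.
Qed.

Hypotheses (psi_le : psi <= pi) (psi_ge : 2 * pi / 3 <= psi).

Lemma wright0_rayE v : 0 <= v -> wright0_ray v = ray_sum beta psi dl 1 v / pi.
Proof.
move=> v0; have h := ray_sum_series (dl := dl) beta0 beta13 psi_le psi_ge ler01 v0.
apply/cvg_lim => //; rewrite -(cvg_shiftS (pseries _ v)).
rewrite (_ : (fun n => _) = (fun N => (\sum_(n < N) v ^+ n.+1 / n.+1`!%:R *
    (Gam (1 + beta * n.+1%:R) * sin (- (pi * beta * n.+1%:R)) *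
     cos (dl + n.+1%:R * psi))) / pi)); first by apply: cvgMl; exact: h.
apply/funext => N; rewrite /pseries /series/= big_mkord big_ord_recl/=.
rewrite {1}wright0_coefE mulr0 mulr0 oppr0 sin0 mulr0 !mul0r add0r mulr_suml.
by apply: eq_bigr => i _; rewrite /bump/= add1n wright0_coefE; ring.
Qed.

Lemma wright1_rayE v : 0 <= v -> wright1_ray v = cos dl - ray_sum beta psi dl 0 v / pi.
Proof.
move=> v0; have h := ray_sum_series (dl := dl) beta0 beta13 psi_le psi_ge (lexx 0) v0.
apply/cvg_lim => //; rewrite -(cvg_shiftS (pseries _ v)).
rewrite (_ : (fun n => _) = (fun N => cos dl - (\sum_(n < N) v ^+ n.+1 / n.+1`!%:R *
    (Gam (0 + beta * n.+1%:R) * sin (- (pi * beta * n.+1%:R)) *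
     cos (dl + n.+1%:R * psi))) / pi)).
  by apply: cvgB; [exact: cvg_cst|apply: cvgMl; exact: h].
apply/funext => N; rewrite /pseries /series/= big_mkord big_ord_recl/= expr0 mulr1.
rewrite mulr_suml -sumrN; congr (_ + _).
by apply: eq_bigr => i _; rewrite /bump/= add1n add0r /prim_coef; ring.
Qed.

(** Joins the linear bound near 0 with the 1 / v decay. The shape v / (1 + v^2) is v times the
    derivative of [atan], so the resulting majorant of the kernel has an explicit primitive. *)
Lemma wright0_ray_bound : exists2 C, 0 <= C &
  forall v, 0 < v -> `|wright0_ray v| <= C * (v / (1 + v ^+ 2)).
Proof.
have [C1 h1] := ray_sum_le dl beta0 beta13 psi_le psi_ge.
have [C2 h2] := ray_sum1_decay dl beta0 beta13 psi_le psi_ge.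
have ip : 0 <= pi^-1 :> R by rewrite invr_ge0 ltW.
exists (2 * (`|C1| + `|C2|) / pi); first by rewrite !mulr_ge0// addr_ge0.
move=> v v0; rewrite wright0_rayE ?(ltW v0)// normrM (ger0_norm ip) mulrAC ler_wpM2r//.
have v20 : 0 < 1 + v ^+ 2 by rewrite ltr_pwDl// sqr_ge0.
rewrite mulrA ler_pdivlMr//.
have k1 : `|ray_sum beta psi dl 1 v| <= `|C1| * v.
  by rewrite (le_trans (h1 _ _ (ltW v0) erefl))// ler_wpM2r ?ler_norm// ltW.
have k2 : `|ray_sum beta psi dl 1 v| * v <= `|C2|.
  by rewrite -ler_pdivlMr// (le_trans (h2 _ v0))// ler_wpM2r ?invr_ge0 ?ler_norm// ltW.
have := normr_ge0 (ray_sum beta psi dl 1 v); have := normr_ge0 C1; have := normr_ge0 C2.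
move: (`|ray_sum beta psi dl 1 v|) k1 k2 => X k1 k2 c2 c1 X0.
have k3 : X * v * v <= `|C2| * v by rewrite ler_wpM2r// ltW.
have [v1|v1] := leP v 1.
  have : X * v ^+ 2 <= X by rewrite ler_piMr// expr_le1// ltW.
  have : 0 <= `|C2| * v by rewrite mulr_ge0// ltW.
  by rewrite mulrDr mulr1; lra.
have : X <= X * v ^+ 2 by rewrite ler_peMr// expr_ge1 ?ltW// ltW.
have : 0 <= `|C1| * v by rewrite mulr_ge0// ltW.
by rewrite mulrDr mulr1 expr2; lra.
Qed.

Lemma wright1_ray_decay : exists C, forall v, 1 <= v -> `|wright1_ray v| <= C / v.
Proof.
have [C h] := ray_sum0_decay dl beta0 beta13 psi_le psi_ge.
exists C => v v1; rewrite wright1_rayE; first exact: h.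
exact: le_trans v1.
Qed.

Lemma wright1_ray0 : wright1_ray 0 = cos dl.
Proof.
apply/cvg_lim => //; rewrite -cvg_shiftS.
rewrite (_ : (fun n => _) = fun=> cos dl); first exact: cvg_cst.
apply/funext => n; rewrite /pseries /series/= big_mkord big_ord_recl/= expr0 mulr1.
by rewrite big1 ?addr0// => i _; rewrite exprS mul0r mulr0.
Qed.

End ray_series.

(** * The kernels and their limits *)

Section approximate_identity.
Context {R : realType}.
Notation mu := (@lebesgue_measure R).
Variables (beta t T : R) (f g tau : R -> R).
Hypotheses (beta0 : 0 < beta) (t0 : 0 < t) (tT : t <= T).
Hypothesis f_cont : continuous f.
Hypothesis g_deriv : forall v : R, exists2 d, is_derive v (1 : R) g d & beta * v * d = - f v.
Variables (C Cg : R).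
Hypothesis C0 : 0 <= C.
Hypothesis f_bound : forall v : R, 0 < v -> `|f v| <= C * (v / (1 + v ^+ 2)).
Hypothesis g_decay : forall v, 1 <= v -> `|g v| <= Cg / v.
Hypothesis tau_cont : {within `[0, T], continuous tau}.
Implicit Types (h eta : R) (n : nat).

Let u h eta := h / (t - eta) `^ beta.
Let K h eta := (t - eta)^-1 * f (u h eta).
(* The eta-derivative of atan (u h eta) / beta. *)
Let B h eta := (t - eta)^-1 * (u h eta / (1 + u h eta ^+ 2)).

(** With [n.+3] the inequality [lo n < hi n] is strict already at [n = 0]. *)
Let lo n : R := t / n.+3%:R.
Let hi n : R := t - t / n.+3%:R.

Let lo_gt0 n : 0 < lo n. Proof. by rewrite divr_gt0. Qed.

Let lt_lohi n : lo n < hi n.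
Proof.
rewrite /lo /hi ltrBrDr -mulrDl ltr_pdivrMr//.
have tN : t * 3 <= t * n.+3%:R by rewrite ler_wpM2l ?(ltW t0)// ler_nat.
by apply: lt_le_trans tN; have := t0 => ?; lra.
Qed.

Let lo_noninc : nonincreasing_seq lo.
Proof.
move=> n m nm; rewrite /lo ler_pM2l// lef_pV2 ?posrE//.
by rewrite ler_nat.
Qed.

Let hi_nondec : nondecreasing_seq hi.
Proof. by move=> n m nm; rewrite /hi lerD2l lerN2; exact: lo_noninc. Qed.

Let lo_cvg0 : lo n @[n --> \oo] --> 0.
Proof.
rewrite -[X in _ --> X](mulr0 t); apply: cvgMr.
have := @cvg_harmonic R; rewrite -(cvg_shiftn 2); apply: cvg_trans.
rewrite (_ : (fun n => _) = [sequence (@harmonic R) (n + 2)%N]_n)//.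
by apply/funext => n /=; rewrite addn2.
Qed.

Let itvE : `]0, t[%classic = \bigcup_n `[lo n, hi n]%classic.
Proof.
apply/seteqP; split => x /=.
  rewrite in_itv/= => /andP[x0 xt].
  have d0 : 0 < Num.min x (t - x) by rewrite lt_min x0 subr_gt0.
  have [N _ hN] : \forall n \near \oo, lo n < Num.min x (t - x).
    exact: (cvgr_lt 0 lo_cvg0).
  exists N => //=; have := hN N (leqnn N); rewrite lt_min => /andP[l1 l2].
  by rewrite in_itv/= (ltW l1)/= /hi -/(lo N); lra.
move=> [n _]/=; rewrite !in_itv/= => /andP[h1 h2].
rewrite (lt_le_trans (lo_gt0 n) h1)/= (le_lt_trans h2)// /hi ltrBlDr ltrDl.
exact: lo_gt0.
Qed.

Let in_itv0t eta : (`]0, t[%classic : set R) eta = (0 < eta < t) :> Prop.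
Proof. by rewrite /= in_itv. Qed.

Let u_gt0 h eta : 0 < h -> eta < t -> 0 < u h eta.
Proof. by move=> h0 et; rewrite divr_gt0// powR_gt0// subr_gt0. Qed.

Let drv_u h eta : eta < t -> has_deriv (u h) eta (beta * u h eta / (t - eta)).
Proof.
move=> et; have s0 : 0 < t - eta by rewrite subr_gt0.
have p0 : (t - eta) `^ beta != 0 by rewrite gt_eqF// powR_gt0.
rewrite /u; derive_eq => //; rewrite powRB1//.
by field; rewrite p0 gt_eqF.
Qed.

Let drv_g (v : R) : has_deriv g v ('D_1 g v) /\ beta * v * 'D_1 g v = - f v.
Proof. by have [d [dg <-] E] := g_deriv v. Qed.

Let drv_inv eta : eta < t -> {for eta, continuous (fun eta => (t - eta)^-1)}.
Proof.
move=> et; apply: has_deriv_continuous; drv.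
by rewrite gt_eqF// subr_gt0.
Qed.

Let K_cont h eta : eta < t -> {for eta, continuous (K h)}.
Proof.
move=> et; apply: continuousM; first exact: drv_inv.
apply: continuous_comp; last exact: f_cont.
exact: has_deriv_continuous (drv_u h et).
Qed.

(** The bound on the mass is uniform in [h], because [atan] takes its values in an interval of
    length [pi]. *)
Let B_integral h : 0 < h ->
  mu.-integrable `]0, t[ (EFin \o B h) /\ \int[mu]_(eta in `]0, t[) B h eta <= pi / beta.
Proof.
move=> h0; pose F eta := atan (u h eta) / beta.
have dF x : (`]0, t[%classic : set R) x -> is_derive x 1 F (B h x).
  rewrite in_itv0t => /andP[_ xt]; rewrite /F.
  apply: (has_deriv_eq (drvM (drv_atan (drv_u h xt)) (drv_cst _ _))).
  have s0 : t - x != 0 by rewrite gt_eqF// subr_gt0.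
  have v0 : 1 + u h x ^+ 2 != 0 by rewrite gt_eqF// ltr_pwDl// sqr_ge0.
  by rewrite /B; field; rewrite s0 v0 gt_eqF.
have cB x : (`]0, t[%classic : set R) x -> {for x, continuous (B h)}.
  rewrite in_itv0t => /andP[_ xt]; apply: continuousM; first exact: drv_inv.
  apply: has_deriv_continuous.
  apply: drvM (drv_u h xt) _; apply: drvV; last by apply: drvD (drv_cst _ _) (drvX _ (drv_u h xt)).
  by rewrite gt_eqF// ltr_pwDl// sqr_ge0.
have B0 x : (`]0, t[%classic : set R) x -> 0 <= B h x.
  rewrite in_itv0t => /andP[_ xt]; have v0 := u_gt0 h0 xt.
  rewrite mulr_ge0 ?invr_ge0 ?subr_ge0 ?(ltW xt)// divr_ge0 ?(ltW v0)//.
  by rewrite addr_ge0// sqr_ge0.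
have FM n : F (hi n) - F (lo n) <= pi / beta.
  rewrite /F -mulrBl ler_wpM2r ?invr_ge0 ?(ltW beta0)//.
  have := atan_ltpi2 (u h (hi n)); have := atan_gtNpi2 (u h (lo n)); lra.
have oD : open (`]0, t[%classic : set R) by exact: interval_open.
split; first exact: (ge0_exhaustion_integrable oD lt_lohi lo_noninc hi_nondec itvE dF cB B0 FM).
exact: (ge0_exhaustion_le oD lt_lohi lo_noninc hi_nondec itvE dF cB B0 FM).
Qed.

Let K_le h eta : 0 < h -> eta < t -> `|K h eta| <= C * B h eta.
Proof.
move=> h0 et; have s0 : 0 < (t - eta)^-1 by rewrite invr_gt0 subr_gt0.
rewrite /K /B normrM (ger0_norm (ltW s0)) mulrCA ler_wpM2l ?(ltW s0)//.
by apply: f_bound; exact: u_gt0.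
Qed.

Let measurable_K h : measurable_fun (`]0, t[%classic : set R) (K h).
Proof.
apply: open_continuous_measurable_fun; first exact: interval_open.
by move=> x; rewrite inE in_itv0t => /andP[_]; exact: K_cont.
Qed.

Let CB_integrable h : 0 < h -> mu.-integrable `]0, t[ (EFin \o (fun eta => C * B h eta)).
Proof.
move=> h0; have [Bi _] := B_integral h0.
by apply: eq_integrable (integrableZl _ C Bi).
Qed.

Let K_integrable h : 0 < h -> mu.-integrable `]0, t[ (EFin \o K h).
Proof.
move=> h0; apply: (@open_integrable_le _ _ _ (fun eta => C * B h eta)).
- exact: interval_open.
- exact: measurable_K.
- by move=> x; rewrite in_itv0t => /andP[_]; exact: K_le.
- exact: CB_integrable.
Qed.

Let integral_K h : 0 < h -> \int[mu]_(eta in `]0, t[) K h eta = g (h / t `^ beta).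
Proof.
move=> h0; pose F eta := - g (u h eta).
have oD : open (`]0, t[%classic : set R) by exact: interval_open.
have dF x : (`]0, t[%classic : set R) x -> is_derive x 1 F (K h x).
  rewrite in_itv0t => /andP[_ xt].
  have [dg E] := drv_g (u h x).
  apply: (has_deriv_eq (drvN (drv_comp dg (drv_u h xt)))).
  rewrite /K; have -> : f (u h x) = - (beta * u h x * 'D_1 g (u h x)) by rewrite E opprK.
  by ring.
have cK x : (`]0, t[%classic : set R) x -> {for x, continuous (K h)}.
  by rewrite in_itv0t => /andP[_]; exact: K_cont.
have Fa : F (lo n) @[n --> \oo] --> - g (h / t `^ beta).
  have -> : - g (h / t `^ beta) = F 0 by rewrite /F /u subr0.
  apply: (@cvg_comp _ _ _ lo F _ (nbhs 0)); first exact: lo_cvg0.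
  apply: has_deriv_continuous; exact: (drvN (drv_comp (drv_g _).1 (drv_u h t0))).
have Fb : F (hi n) @[n --> \oo] --> 0.
  have h1 : Cg / h * lo n `^ beta @[n --> \oo] --> 0.
    rewrite -[X in _ --> X](mulr0 (Cg / h)); apply: cvgMr.
    have := (cvg_at_rightP _ _ _).1 (powR_cvg0 beta0); apply.
    by split; [exact: lo_gt0|exact: lo_cvg0].
  have hE n : t - hi n = lo n by rewrite /hi opprB addrC subrK.
  (* The decay of [g] is assumed from 1 on only; close to [t] its argument [h / lo n ^ beta] has
     passed 1. *)
  have ule : \forall n \near \oo, lo n `^ beta <= h.
    have lc : lo n `^ beta @[n --> \oo] --> 0.
      have := (cvg_at_rightP _ _ _).1 (powR_cvg0 beta0); apply.
      by split; [exact: lo_gt0|exact: lo_cvg0].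
    exact: (cvgr_le _ lc _ h0).
  apply: norm_cvg0; apply: (squeeze_cvgr _ (cvg_cst 0) h1).
  near=> n; rewrite normr_ge0/= /F normrN /u hE.
  have l0 : 0 < lo n `^ beta by rewrite powR_gt0.
  have v1 : 1 <= h / lo n `^ beta by rewrite ler_pdivlMr// mul1r; near: n.
  by rewrite (le_trans (g_decay v1))// invf_div mulrA mulrAC.
rewrite (@exhaustion_FTC2 _ _ F _ _ _ oD lt_lohi lo_noninc hi_nondec itvE dF cK _ _ (K_integrable h0) Fa Fb).
by rewrite sub0r opprK.
Unshelve. all: by end_near. Qed.

Let T0 : 0 < T. Proof. exact: lt_le_trans tT. Qed.

Let tau_bounded : exists2 M, 0 <= M & forall x, 0 <= x <= T -> `|tau x| <= M.
Proof.
have [c1 _ h1] := EVT_max (ltW T0) tau_cont; have [c2 _ h2] := EVT_min (ltW T0) tau_cont.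
exists (`|tau c1| + `|tau c2|); first by rewrite addr_ge0.
move=> x xT; have xI : x \in `[0, T] by rewrite in_itv.
have := h1 x xI; have := h2 x xI.
have := ler_norm (tau c1); have := lerNnormlW (lexx `|tau c2|).
have := normr_ge0 (tau c1); have := normr_ge0 (tau c2) => *.
by rewrite ler_norml; apply/andP; split; lra.
Qed.

Let tau_left : tau x @[x --> t^'-] --> tau t.
Proof.
have /(continuous_within_itvP _ T0)[h1 _ h2] := tau_cont.
move: tT; rewrite le_eqVlt => /predU1P[->//|tT'].
by apply: cvg_at_left_filter; apply: h1; rewrite in_itv/= t0.
Qed.

Let tau_in x : 0 < x < t -> {for x, continuous tau}.
Proof.
have /(continuous_within_itvP _ T0)[h1 _ _] := tau_cont.
by move=> /andP[x0 xt]; apply: h1; rewrite in_itv/= x0 (lt_le_trans xt).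
Qed.

Let measurable_tau : measurable_fun (`]0, t[%classic : set R) tau.
Proof.
apply: open_continuous_measurable_fun; first exact: interval_open.
by move=> x; rewrite inE in_itv0t; exact: tau_in.
Qed.

Let Ktau_integrable h : 0 < h -> mu.-integrable `]0, t[ (EFin \o (fun eta => K h eta * tau eta)).
Proof.
move=> h0; have [M M0 tM] := tau_bounded.
apply: (@open_integrable_le _ _ _ (fun eta => M * (C * B h eta))).
- exact: interval_open.
- by apply: measurable_funM.
- move=> x; rewrite in_itv0t => /andP[x0 xt]; rewrite normrM mulrC.
  apply: ler_pM => //; last exact: K_le.
  by apply: tM; rewrite (ltW x0)/= (le_trans (ltW xt)).
- by apply: eq_integrable (integrableZl _ M (CB_integrable h0)).
Qed.

(** The kernel has mass g(h / t^beta), not 1. The integral is first compared with this mass times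
    [tau t], and continuity of [g] at 0 finishes. *)
Lemma approximate_identity :
  \int[mu]_(eta in `[0, t[) (K h eta * tau eta) @[h --> 0^'+] --> g 0 * tau t.
Proof.
have [M M0 tM] := tau_bounded.
(* Near [t] the oscillation [e] of [tau] is multiplied by the uniform mass; away from [t] the kernel
   itself is O(h). *)
have main e : 0 < e -> exists D, forall h, 0 < h ->
    `|\int[mu]_(eta in `[0, t[) (K h eta * tau eta) - g (h / t `^ beta) * tau t| <=
      e * (C * (pi / beta)) + D * h.
  move=> e0.
  have [d /= d0 hd] : \forall d \near 0^'+, forall x, 0 < x < t -> t - x < d -> `|tau x - tau t| <= e.
    have /cvgrPdist_le /(_ e e0) := tau_left.
    rewrite near_withinE => -[r /= r0 hr].
    exists r => // d /= hd d0 x /andP[x0 xt] td; rewrite distrC; apply: hr => //=.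
    rewrite gtr0_norm ?subr_gt0// (lt_trans td)//.
    by move: hd; rewrite sub0r normrN gtr0_norm.
  pose dd := d / 2; have dd0 : 0 < dd by rewrite divr_gt0.
  have {}hd x : 0 < x < t -> t - x < dd -> `|tau x - tau t| <= e.
    apply: (hd dd) => //=; rewrite sub0r normrN gtr0_norm// /dd; lra.
  (* For t - eta >= dd, [B h eta] is at most (t - eta)^-1 u, hence at most dd^-1 h / dd^beta, and
     [tau] varies by at most [M + M]. *)
  pose D1 := (M + M) * (C * (dd^-1 / dd `^ beta)).
  have D10 : 0 <= D1.
    by rewrite !mulr_ge0 ?addr_ge0 ?invr_ge0 ?powR_ge0 ?(ltW dd0).
  exists (D1 * t) => h h0.
  have Ki := K_integrable h0; have Kti := Ktau_integrable h0.
  rewrite -Rintegral_itv_obnd_cbnd// -integral_K// mulrC.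
  have Kci : mu.-integrable `]0, t[ (EFin \o (fun eta => tau t * K h eta)).
    by apply: eq_integrable (integrableZl _ (tau t) Ki).
  rewrite -RintegralZl// -RintegralB//.
  have [Bi Ble] := B_integral h0.
  have eBi : mu.-integrable `]0, t[ (EFin \o (fun eta => e * (C * B h eta))).
    by apply: eq_integrable (integrableZl _ e (CB_integrable h0)).
  have cstf : mu.-integrable `]0, t[ (EFin \o (fun _ : R => D1 * h)).
    apply: (ge0_exhaustion_integrable (F := fun x => D1 * h * x) _ lt_lohi lo_noninc hi_nondec itvE _ _ _ (M := D1 * h * t)).
    - exact: interval_open.
    - by move=> x _; derive_eq; ring.
    - by move=> x _; exact: cvg_cst.
    - by move=> x _; rewrite mulr_ge0// ltW.
    - move=> n; rewrite -mulrBr ler_wpM2l ?(mulr_ge0 D10 (ltW h0))// /hi.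
      by rewrite -addrA gerDl -opprD oppr_le0 addr_ge0 ?(ltW (lo_gt0 n)).
  have sumi : mu.-integrable `]0, t[ (EFin \o (fun eta => e * (C * B h eta) + D1 * h)).
    by apply: eq_integrable (integrableD _ eBi cstf).
  have diffi : mu.-integrable `]0, t[ (EFin \o (fun eta => K h eta * tau eta - tau t * K h eta)).
    by apply: eq_integrable (integrableB _ Kti Kci).
  apply: le_trans (le_normr_Rintegral _ diffi) _ => //.
  apply: (@le_trans _ _ (\int[mu]_(eta in `]0, t[) (e * (C * B h eta) + D1 * h))).
    apply: le_Rintegral => //; first exact: integrable_norm.
    move=> x; rewrite in_itv0t => /andP[x0 xt].
    have xT : 0 <= x <= T by rewrite (ltW x0)/= (le_trans (ltW xt)).
    have tT' : 0 <= t <= T by rewrite (ltW t0).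
    rewrite (mulrC (tau t)) -mulrBr normrM.
    have kle := K_le h0 xt.
    have B0 : 0 <= C * B h x by apply: le_trans kle.
    have [small|large] := ltP (t - x) dd.
      have x0t : 0 < x < t by rewrite x0.
      have := ler_pM (normr_ge0 _) (normr_ge0 _) kle (hd x x0t small).
      move=> /le_trans; apply.
      by rewrite (mulrC (_ * _) e) lerDl mulr_ge0// ltW.
    have s0 : 0 < t - x by rewrite subr_gt0.
    have ux := u_gt0 h0 xt.
    have k2 : C * B h x <= C * (dd^-1 / dd `^ beta) * h.
      rewrite -mulrA ler_wpM2l// /B.
      have b1 : u h x / (1 + u h x ^+ 2) <= u h x.
        by rewrite ler_pdivrMr ?ltr_pwDl ?sqr_ge0// ler_peMr ?(ltW ux)// lerDl sqr_ge0.
      have b2 : u h x <= h / dd `^ beta.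
        rewrite /u ler_wpM2l ?(ltW h0)// lef_pV2 ?posrE ?powR_gt0//.
        by rewrite ge0_ler_powR ?nnegrE ?(ltW beta0) ?(ltW dd0) ?(ltW s0).
      have b3 : (t - x)^-1 <= dd^-1 by rewrite lef_pV2 ?posrE.
      have b4 : 0 <= u h x / (1 + u h x ^+ 2).
        by rewrite divr_ge0 ?(ltW ux)// addr_ge0 ?sqr_ge0.
      have := ler_pM (ltW (_ : 0 < (t - x)^-1)) b4 b3 (le_trans b1 b2).
      rewrite invr_gt0 => /(_ s0) /le_trans; apply.
      by rewrite le_eqVlt; apply/orP; left; apply/eqP; ring.
    have k3 : `|tau x - tau t| <= M + M.
      by rewrite (le_trans (ler_normB _ _))// lerD// tM.
    have := ler_pM (normr_ge0 _) (normr_ge0 _) (le_trans kle k2) k3.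
    move=> /le_trans; apply; apply: ler_wpDl; first by rewrite mulr_ge0// ltW.
    by rewrite le_eqVlt /D1; apply/orP; left; apply/eqP; ring.
  rewrite (RintegralD _ eBi cstf)// RintegralZl//; last exact: CB_integrable.
  rewrite RintegralZl// Rintegral_cst//= lebesgue_measure_itv/= lte_fin t0/= subr0.
  rewrite (_ : D1 * h * t = D1 * t * h); last by ring.
  by rewrite lerD2r ler_wpM2l ?(ltW e0)// ler_wpM2l.
have gl : g (h / t `^ beta) * tau t @[h --> 0^'+] --> g 0 * tau t.
  apply: cvgMl; apply: cvg_at_right_filter.
  have -> : g 0 = (fun h => g (h / t `^ beta)) 0 by rewrite mul0r.
  apply: has_deriv_continuous; apply: (drv_comp (drv_g _).1).
  exact: drvM (drv_id _) (drv_cst _ _).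
apply: cvg_sub0 gl; apply/cvgrPdist_le => e e0.
have P0 : 0 <= C * (pi / beta).
  by rewrite mulr_ge0// divr_ge0 ?pi_ge0// ltW.
(* The added 1 avoids a division by zero when [C = 0]. *)
pose e1 := e / 2 / (C * (pi / beta) + 1).
have P1 : 0 < C * (pi / beta) + 1 by rewrite ltr_wpDl.
have e10 : 0 < e1 by rewrite !divr_gt0.
have [D hD] := main e1 e10.
have e1P : e1 * (C * (pi / beta)) <= e / 2.
  rewrite /e1 mulrAC ler_pdivrMr// ler_wpM2l ?divr_ge0 ?(ltW e0)//.
  by rewrite lerDl.
near=> h.
have h0 : 0 < h by [].
rewrite sub0r normrN; apply: le_trans (hD h h0) _.
have Dh : D * h <= e / 2.
  apply: (@le_trans _ _ (`|D| * h)); first by rewrite ler_wpM2r ?ler_norm// ltW.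
  apply: (@le_trans _ _ ((`|D| + 1) * h)); first by rewrite ler_wpM2r ?lerDl// ltW.
  rewrite -ler_pdivlMl ?ltr_wpDl//; near: h.
  by apply: nbhs_right_le; rewrite mulr_gt0 ?invr_gt0 ?ltr_wpDl// divr_gt0.
lra.
Unshelve. all: by end_near. Qed.

End approximate_identity.

(** * Real and imaginary parts of the Wright function *)

Section complex_exponent.
Context {R : realType}.
Local Open Scope complex_scope.
Implicit Types (r th : R) (n : nat).

Definition cis th : R[i] := cos th +i* sin th.

Lemma cisD th1 th2 : cis (th1 + th2) = cis th1 * cis th2.
Proof. by rewrite /cis cosD sinD; congr (_ +i* _); rewrite addrC; ring. Qed.

Lemma cis_expr th n : cis th ^+ n = cis (n%:R * th).
Proof.
elim: n => [|n IHn]; first by rewrite mul0r /cis cos0 sin0.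
by rewrite exprS IHn -cisD -natr1 mulrDl mul1r addrC.
Qed.

Lemma omega3E : omega3 R = cis (2 * pi / 3).
Proof. by rewrite /omega3 /cexp/= expR0 !mul1r. Qed.

End complex_exponent.

Section wright_series.
Context {R : realType}.
Local Open Scope complex_scope.
Variable beta : R.
Hypotheses (beta0 : 0 < beta) (beta13 : 3 * beta < 1).
Implicit Types (r th dl : R) (n : nat) (e : R ^nat).

Let b01 : 0 < beta < 1.
Proof. by have := beta13; have := beta0 => ? ?; apply/andP; split; lra. Qed.

Definition wright2_coef n : R := recip_Gam (2 * beta - beta * n%:R) / n`!%:R.

Lemma wright2_rapid_decay e : (forall n, `|e n| <= 1) ->
  rapid_decay (fun n => wright2_coef n * e n).
Proof.
move=> e1; have q0 : 0 < 1 - 2 * beta by have := beta13; have := beta0 => ? ?; lra.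
have ip : 0 <= pi^-1 :> R by rewrite invr_ge0 pi_ge0.
apply: (@rapid_decay_le _ _ _ pi^-1 (Gam_rapid_decay q0 b01)) => n.
apply: (@le_trans _ _ `|wright2_coef n|); first by rewrite normrM ler_piMr.
rewrite /wright2_coef /recip_Gam.
have -> : 1 - (2 * beta - beta * n%:R) = 1 - 2 * beta + beta * n%:R by ring.
rewrite !normrM (ger0_norm ip) mulrA ler_wpM2r// (mulrC pi^-1) ler_wpM2r//.
by rewrite ler_piMr// sin_max.
Qed.

Lemma wright2_coef_diffs e n :
  pseries_diffs (pseries_diffs (fun n => wright2_coef n * e n)) n =
  wright0_coef beta n * e n.+2.
Proof.
rewrite /pseries_diffs /wright2_coef /wright0_coef.
have -> : 2 * beta - beta * n.+2%:R = - (beta * n%:R) by rewrite -addn2 natrD; ring.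
rewrite !factS !natrM.
have h1 : (n`!%:R : R) != 0 by rewrite pnatr_eq0 -lt0n fact_gt0.
have h2 : (n.+1%:R : R) != 0 by rewrite pnatr_eq0.
have h3 : (n.+2%:R : R) != 0 by rewrite pnatr_eq0.
move: (n`!%:R : R) (n.+1%:R : R) (n.+2%:R : R) (recip_Gam _) h1 h2 h3 => x y z w h1 h2 h3.
by field; rewrite h1 h2 h3.
Qed.

Let wright2_cvg e r : (forall n, `|e n| <= 1) ->
  cvgn (pseries (fun n => wright2_coef n * e n) r).
Proof. by move=> e1; exact/rapid_decay_cvg/wright2_rapid_decay. Qed.

Lemma wright_cis th r : wright (- beta) (2 * beta)%:C (cis th * r%:C) =
  limn (pseries (fun n => wright2_coef n * cos (n%:R * th)) r) +i*
  limn (pseries (fun n => wright2_coef n * sin (n%:R * th)) r).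
Proof.
have tE n : wright_term (- beta) (2 * beta)%:C (cis th * r%:C) n =
    (wright2_coef n * cos (n%:R * th) * r ^+ n) +i*
    (wright2_coef n * sin (n%:R * th) * r ^+ n).
  rewrite /wright_term -rmorphD rGamma_real; last first.
    have : 0 <= beta * n%:R by rewrite mulr_ge0// ltW.
    by have := beta13; have := beta0 => ? ? ?; lra.
  rewrite exprMn cis_expr -rmorphXn.
  have -> : n`!%:R^-1 = (n`!%:R^-1 : R)%:C :> R[i] by rewrite fmorphV rmorph_nat.
  have -> : - beta * n%:R + 2 * beta = 2 * beta - beta * n%:R by ring.
  have sc (p q x : R) : (p +i* q) * x%:C = (p * x) +i* (q * x).
    by congr (_ +i* _); ring.
  by rewrite /cis !sc /wright2_coef; congr (_ +i* _); ring.
by congr (_ +i* _); congr (limn _); apply/funext => n;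
  rewrite /pseries /series/=; apply: eq_bigr => i _; rewrite tE.
Qed.

Lemma Re_wright r : complex.Re (wright (- beta) (2 * beta)%:C r%:C) =
  limn (pseries (fun n => wright2_coef n * 1) r).
Proof.
have -> : r%:C = cis 0 * r%:C by rewrite /cis cos0 sin0 mul1r.
rewrite wright_cis/=; congr (limn _); apply/funext => n.
by rewrite /pseries /series/=; apply: eq_bigr => i _; rewrite mulr0 cos0.
Qed.

Lemma Re_cis_wright th r :
  complex.Re (cis th * wright (- beta) (2 * beta)%:C (cis th * r%:C)) =
  limn (pseries (fun n => wright2_coef n * cos (n.+1%:R * th)) r).
Proof.
rewrite wright_cis/= -mulNr is_cvg_lim_combo.
- congr (limn _); apply/funext => n; rewrite /pseries /series/=.
  apply: eq_bigr => i _; rewrite -natr1 mulrDl mul1r cosD; ring.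
- by apply: wright2_cvg => n; exact: cos_max.
- by apply: wright2_cvg => n; exact: sin_max.
Qed.

Lemma Im_cis_wright th r :
  complex.Im (cis th * wright (- beta) (2 * beta)%:C (cis th * r%:C)) =
  limn (pseries (fun n => wright2_coef n * sin (n.+1%:R * th)) r).
Proof.
rewrite wright_cis/= is_cvg_lim_combo.
- congr (limn _); apply/funext => n; rewrite /pseries /series/=.
  apply: eq_bigr => i _; rewrite -natr1 mulrDl mul1r sinD; ring.
- by apply: wright2_cvg => n; exact: sin_max.
- by apply: wright2_cvg => n; exact: cos_max.
Qed.

End wright_series.

(** * Second derivatives of the kernels *)

Section kernels.
Context {R : realType}.
Variables (alpha a : R).
Hypotheses (alpha0 : 0 < alpha) (alpha1 : alpha < 1).
Implicit Types (x s C : R) (e : R ^nat).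
Let beta := alpha / 3.

Let beta0 : 0 < beta. Proof. by rewrite divr_gt0. Qed.
Let beta13 : 3 * beta < 1.
Proof. by rewrite /beta mulrCA divff ?mulr1. Qed.

Lemma derive2_pseries (F : R -> R) e C S x : rapid_decay e ->
  (\forall y \near x, F y = C * limn (pseries e ((y - a) / S))) ->
  derive1n 2 F x =
    C / S ^+ 2 * limn (pseries (pseries_diffs (pseries_diffs e)) ((x - a) / S)).
Proof.
move=> re FE.
have dH e' D y : rapid_decay e' ->
    has_deriv (fun y => D * limn (pseries e' ((y - a) / S))) y
      (D / S * limn (pseries (pseries_diffs e') ((y - a) / S))).
  move=> re'.
  have di : has_deriv (fun y => (y - a) / S) y (1 / S) by derive_eq; ring.
  have dc := drv_comp (f := fun y => (y - a) / S) (rapid_decay_is_derive ((y - a) / S) re') di.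
  by apply: (has_deriv_eq (drvM (drv_cst D y) dc)); ring.
rewrite derive1nS derive1n1 derive1E.
have E1 : \forall y \near x, derive1 F y = C / S * limn (pseries (pseries_diffs e) ((y - a) / S)).
  (* The second derivative needs the first on a whole neighbourhood, so the local formula for [F] is
     used around every point near [x]. *)
  have := near_join FE; apply: filterS => y Fy.
  rewrite derive1E (near_eq_derive _ Fy).
  by have [_ ->] := dH e C y re.
rewrite (near_eq_derive _ E1).
have [_ ->] := dH _ (C / S) x (rapid_decay_diffs re).
by rewrite expr2 invfM mulrA.
Qed.

(** The prefactor of the kernel times the s^(- 2 beta) of two differentiations is exactly of order 1
    / s, the scaling of an approximate identity in s = t - eta. *)
Lemma kernel_scale s : 0 < s ->
  1 / (3 * s `^ (1 - 2 * beta)) / (s `^ beta) ^+ 2 = 1 / 3 / s.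
Proof.
move=> s0; have p0 : 0 < s `^ beta by exact: powR_gt0.
have -> : s `^ (1 - 2 * beta) = s / (s `^ beta) ^+ 2.
  rewrite powRDp// powRr1 ?(ltW s0)//; congr (_ * _).
  by rewrite powRN mulrC powRrM powR_mulrn// powR_ge0.
by field; rewrite !gt_eqF.
Qed.

Let eq_lim_pseries (e1 e2 : R ^nat) v : e1 =1 e2 ->
  limn (pseries e1 v) = limn (pseries e2 v).
Proof. by move=> /funext ->. Qed.

Lemma derive2_wright (F : R -> R) e c s x : 0 < s -> (forall n, `|e n| <= 1) ->
  (\forall y \near x, F y = 1 / (3 * s `^ (1 - 2 * beta)) *
    (c * limn (pseries (fun n => wright2_coef beta n * e n) ((y - a) / s `^ beta)))) ->
  derive1n 2 F x = c / 3 *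
    (s^-1 * limn (pseries (fun n => wright0_coef beta n * e n.+2) ((x - a) / s `^ beta))).
Proof.
move=> s0 e1 FE; have re := wright2_rapid_decay beta0 beta13 e1.
rewrite (@derive2_pseries F _ (1 / (3 * s `^ (1 - 2 * beta)) * c) (s `^ beta) x re); last first.
  by apply: filterS FE => y ->; rewrite mulrA.
rewrite [X in X * _](mulrAC _ c) kernel_scale// [RHS]mulrA; congr (_ * _).
  by field; rewrite gt_eqF.
by apply: eq_lim_pseries => n; exact: wright2_coef_diffs.
Qed.

(** The explicit factor [omega3] and the two produced by differentiation multiply to
    [omega3 ^+ 3 = 1]. *)
Let pi3 n : n.+3%:R * (2 * pi / 3) = n%:R * (2 * pi / 3) + pi *+ 2 :> R.
Proof. by rewrite -addn3 natrD mulr2n; field. Qed.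

Let alphaE : 2 * alpha / 3 = 2 * beta. Proof. by rewrite /beta mulrA. Qed.

Lemma derive2_G_right s x : 0 < s -> a < x ->
  derive1n 2 (fun y => G alpha (y - a) s) x =
    - (2 / 3) * (s^-1 * wright0_ray beta (2 * pi / 3) 0 ((x - a) / s `^ beta)).
Proof.
move=> s0 ax; rewrite (@derive2_wright _ (fun n => cos (n.+1%:R * (2 * pi / 3))) (- 2) s)//.
- rewrite mulNr; congr (_ * (_ * _)); apply: eq_lim_pseries => n.
  by rewrite pi3 add0r cosD2pi.
- by move=> n; exact: cos_max.
- near=> y; have ay : a < y by near: y; exact: lt_nbhsr.
  rewrite /G ifF ?alphaE; last by rewrite ltNge subr_ge0 (ltW ay).
  rewrite omega3E.
  by rewrite (Re_cis_wright beta0 beta13).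
Unshelve. all: by end_near. Qed.

(** The sine of the imaginary part is a cosine with phase [dl = - (pi / 2)]. *)
Lemma derive2_V_right s x : 0 < s ->
  derive1n 2 (fun y => V alpha (y - a) s) x =
    1 / 3 * (s^-1 * wright0_ray beta (2 * pi / 3) (- (pi / 2)) ((x - a) / s `^ beta)).
Proof.
move=> s0; rewrite (@derive2_wright _ (fun n => sin (n.+1%:R * (2 * pi / 3))) 1 s)//.
- congr (_ * (_ * _)); apply: eq_lim_pseries => n.
  by rewrite pi3 sinD2pi cosD cosN sinN cos_pihalf sin_pihalf mul0r mulN1r opprK add0r.
- by move=> n; exact: sin_max.
- near=> y; rewrite /V alphaE omega3E (Im_cis_wright beta0 beta13).
  by congr (_ * _); rewrite mul1r.
Unshelve. all: by end_near. Qed.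

(** The negative argument is carried by the ray [psi = pi], through (-1)^n = cos(n pi). *)
Lemma derive2_G_left s x : 0 < s -> x < a ->
  derive1n 2 (fun y => G alpha (y - a) s) x =
    1 / 3 * (s^-1 * wright0_ray beta pi 0 ((a - x) / s `^ beta)).
Proof.
move=> s0 xa; rewrite (@derive2_wright _ (fun=> 1) 1 s)//.
- congr (_ * (_ * _)); congr (limn _); apply/funext => n; rewrite /pseries /series/=.
  apply: eq_bigr => i _; rewrite add0r mulrC (mulrC (wright0_coef _ _)).
  have -> : cos (i%:R * pi) = (-1) ^+ i :> R.
    elim: i => [|i IHi]; first by rewrite mul0r cos0.
    by rewrite -natr1 mulrDl mul1r cosDpi IHi exprS mulN1r.
  rewrite -(opprB a x) mulNr -[X in X ^+ i * _]mulN1r exprMn; ring.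
- by move=> n; rewrite normr1.
- near=> y; have ya : y < a by near: y; exact: lt_nbhsl.
  rewrite /G subr_lt0 ya alphaE (Re_wright beta0 beta13).
  by congr (_ * _); rewrite mul1r.
Unshelve. all: by end_near. Qed.

End kernels.

(** * One-sided limits of the integrals *)

Section wright_limit.
Context {R : realType}.
Notation mu := (@lebesgue_measure R).
Variables (beta psi dl T t : R) (tau : R -> R).
Hypotheses (beta0 : 0 < beta) (beta13 : 3 * beta < 1).
Hypotheses (psi_le : psi <= pi) (psi_ge : 2 * pi / 3 <= psi).
Hypotheses (t0 : 0 < t) (tT : t <= T) (tau_cont : {within `[0, T], continuous tau}).

Lemma wright_limit (c : R) :
  \int[mu]_(eta in `[0, t[)
     (c * ((t - eta)^-1 * wright0_ray beta psi dl (h / (t - eta) `^ beta)) * tau eta)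
  @[h --> 0^'+] --> c * cos dl * tau t.
Proof.
have [C C0 hC] := wright0_ray_bound dl beta0 beta13 psi_le psi_ge.
have [Cg hCg] := wright1_ray_decay dl beta0 beta13 psi_le psi_ge.
have fc : continuous (wright0_ray beta psi dl).
  move=> v; have [d] := is_derive_wright0_ray psi dl beta0 beta13 v.
  exact: has_deriv_continuous.
(* The factor [c] is moved into the density, so the approximate identity applies to the bare
   kernel. *)
have ctau : {within `[0, T], continuous (fun eta => c * tau eta)}.
  by move=> x; apply: cvgMr; exact: tau_cont.
have := approximate_identity beta0 t0 tT fc (is_derive_wright1_ray psi dl beta0 beta13)
  C0 hC hCg ctau.
rewrite wright1_ray0 mulrCA mulrA; apply: cvg_trans; apply: near_eq_cvg.
by apply: nearW => h; apply: eq_Rintegral => x _; ring.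
Qed.

End wright_limit.

Lemma cvg_at_right_shift {R : realType} (F : R -> R) (a l : R) :
  F h @[h --> 0^'+] --> l -> F (x - a) @[x --> a^'+] --> l.
Proof.
move=> Fl; apply: (cvg_comp _ _ _ Fl) => A [e /= e0 eA].
exists e => //= x xe ax; apply: eA; rewrite /= ?subr_gt0//.
by rewrite sub0r opprB.
Qed.

Lemma cvg_at_left_shift {R : realType} (F : R -> R) (a l : R) :
  F h @[h --> 0^'+] --> l -> F (a - x) @[x --> a^'-] --> l.
Proof.
move=> Fl; apply: (cvg_comp _ _ _ Fl) => A [e /= e0 eA].
exists e => //= x xe ax; apply: eA; rewrite /= ?subr_gt0//.
by rewrite sub0r opprB distrC.
Qed.

Theorem lemma2 (R : realType) (alpha T a : R) (tau3 tau4 : R -> R)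
  (alpha_gt0 : 0 < alpha) (alpha_lt1 : alpha < 1) (T_gt0 : 0 < T)
  (tau3_cont : {within `[0, T], continuous tau3})
  (tau4_cont : {within `[0, T], continuous tau4}) :
  forall t : R, 0 < t -> t <= T ->
    [/\ w3 alpha a tau3 x t @[x --> a^'-] --> 1 / 3 * tau3 t,
        w3 alpha a tau3 x t @[x --> a^'+] --> - (2 / 3) * tau3 t
      & w4 alpha a tau4 x t @[x --> a^'+] --> (0 : R)].
Proof.
move=> t t0 tT; have b0 : 0 < alpha / 3 by rewrite divr_gt0.
have b13 : 3 * (alpha / 3) < 1 by rewrite mulrCA divff ?mulr1.
have psi_le : 2 * pi / 3 <= pi :> R by have := @pi_gt0 R; move: (pi : R) => p ?; lra.
(* The half-open domain leaves out [eta = t], so the formulas for the second derivatives hold at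
   every point of integration. *)
have s0 eta : eta \in `[0, t[%classic -> 0 < t - eta.
  by rewrite inE/= in_itv/= subr_gt0 => /andP[].
split.
- have := @wright_limit R (alpha / 3) pi 0 T t tau3 b0 b13 (lexx pi) psi_le t0 tT tau3_cont (1 / 3).
  rewrite cos0 mulr1 => /(cvg_at_left_shift a); apply: cvg_trans; apply: near_eq_cvg; near=> x.
  have xa : x < a by near: x; exact: nbhs_left_lt.
  by apply: eq_Rintegral => eta /s0 e0; rewrite derive2_G_left.
- have := @wright_limit R (alpha / 3) (2 * pi / 3) 0 T t tau3 b0 b13 psi_le (lexx (2 * pi / 3)) t0 tT tau3_cont (- (2 / 3)).
  rewrite cos0 mulr1 => /(cvg_at_right_shift a); apply: cvg_trans; apply: near_eq_cvg; near=> x.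
  have ax : a < x by near: x; exact: nbhs_right_gt.
  by apply: eq_Rintegral => eta /s0 e0; rewrite derive2_G_right.
- have := @wright_limit R (alpha / 3) (2 * pi / 3) (- (pi / 2)) T t tau4 b0 b13 psi_le (lexx (2 * pi / 3)) t0 tT tau4_cont (1 / 3).
  rewrite cosN cos_pihalf mulr0 mul0r => /(cvg_at_right_shift a); apply: cvg_trans; apply: near_eq_cvg; near=> x.
  by apply: eq_Rintegral => eta /s0 e0; rewrite derive2_V_right.
Unshelve. all: by end_near. Qed.
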